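(* Let $d\in\mathbb{N}$ and let $\mathcal{H}$ be a radially weighted Besov space on $\mathbb{B}_d$ that is also a complete Pick space. Let $f\in\mathcal{H}$ be zero-free on $\mathbb{B}_d$ and have bounded argument. Then: (a) $\log f\in N^+(\mathcal{H})$ if and only if $f$ is cyclic in $\mathcal{H}$. (b) If in addition $\|f\|_\infty=\sup_{z\in\mathbb{B}_d}|f(z)|\le 1$, then the following are equivalent: (1) $f$ is cyclic in $\mathcal{H}$; (2) there is $n\in\mathbb{N}$ such that $G_n\circ\log(1/f)\in N^+(\mathcal{H})$; (3) for every $n\in\mathbb{N}$, $G_n\circ\log(1/f)\in N^+(\mathcal{H})$. Hence, in case (b), a sufficient condition for cyclicity of $f$ in $\mathcal{H}$ is that $G_n\circ\log(1/f)\in\mathcal{H}$ for some $n\in\mathbb{N}$.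
   Context: $\mathbb{N}=\{1,2,\dots\}$; $\mathbb{B}_d$ is the open unit ball of $\mathbb{C}^d$; $\mathrm{Hol}(\mathbb{B}_d)$ is the set of analytic functions on $\mathbb{B}_d$. Hilbert function space on a set $X$: a Hilbert space of complex-valued functions on $X$ for which all point evaluations are continuous. $\mathrm{Mult}(\mathcal{H})=\{\varphi:\varphi f\in\mathcal{H}\text{ for all }f\in\mathcal{H}\}$. A function $f\in\mathcal{H}$ is cyclic in $\mathcal{H}$ if $\{\varphi f:\varphi\in\mathrm{Mult}(\mathcal{H})\}$ is dense in $\mathcal{H}$. The Pick-Smirnov class is $N^+(\mathcal{H})=\{\varphi/\psi:\varphi,\psi\in\mathrm{Mult}(\mathcal{H}),\ \psi\text{ cyclic in }\mathcal{H}\}$. Radially weighted Besov space: an admissible radial measure is a measure $\omega$ on $\overline{\mathbb{B}_d}$ of the form $d\omega(z)=d\mu(r)\,d\sigma(w)$, $z=rw$, where $\sigma$ is the normalized rotation-invariant measure on $\partial\mathbb{B}_d$ and $\mu$ is a finite positive Borel measure on $[0,1]$ with $\mu((r,1])>0$ for every $0<r<1$. Let $R=\sum_{j=1}^d z_j\frac{\partial}{\partial z_j}$. For an integer $N\ge 0$, $B^N_\omega=\{f\in\mathrm{Hol}(\mathbb{B}_d):R^Nf\in L^2(\omega)\}$, with norm $\|f\|^2_{B^0_\omega}=\|f\|^2_{L^2(\omega)}$ and $\|f\|^2_{B^N_\omega}=\omega(\overline{\mathbb{B}_d})|f(0)|^2+\|R^Nf\|^2_{L^2(\omega)}$ for $N>0$;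 if $\mu$ has a point mass at $1$, then for analytic $f$ one sets $\|f\|^2_{L^2(\omega)}=\int_{\mathbb{B}_d}|f|^2d\omega+\mu(\{1\})\|f\|^2_{H^2(\partial\mathbb{B}_d)}$, where $H^2(\partial\mathbb{B}_d)$ is the Hardy space of the ball. A radially weighted Besov space is a space $B^N_\omega$ of this form. Complete Pick space: a reproducing kernel $k$ on $X$ is a normalized complete Pick kernel if there are $w_0\in X$, a Hilbert space $\mathcal{K}$ and a function $b:X\to\mathcal{K}$ with $b(w_0)=0$ and $k_w(z)=\frac{1}{1-\langle b(z),b(w)\rangle_{\mathcal{K}}}$. A complete Pick space is a Hilbert function space admitting an equivalent norm whose reproducing kernel is a normalized complete Pick kernel. A zero-free $f\in\mathrm{Hol}(\mathbb{B}_d)$ has bounded argument if there is $M>0$ with $|\operatorname{Im}\log f|\le M$ on $\mathbb{B}_d$ for some (equivalently every, with possibly different $M$) analytic branch of $\log f$. In the statement, $\log f$ and $\log(1/f)$ denote any analytic branch. $G_1(z)=z$ and $G_{n+1}(z)=\log(1+G_n(z))$ for $n\in\mathbb{N}$, with the principal branch of $\log$, on the right half plane $\operatorname{Re}z\ge 0$ (each $G_n$ maps $\{\operatorname{Re} z\ge0\}$ into itself). *)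

(* Defs.v *)
From HB Require Import structures.
From mathcomp Require Export all_boot all_order all_algebra.
From mathcomp Require Export complex.
From mathcomp Require Export all_classical all_reals all_analysis.

Set Implicit Arguments.
Unset Strict Implicit.
Unset Printing Implicit Defensive.

Export Order.TTheory GRing.Theory Num.Theory numFieldNormedType.Exports.

Local Open Scope classical_set_scope.
Local Open Scope ring_scope.
Local Open Scope complex_scope.

(* R[i] packed as a numClosedFieldType: this way it is found to be a normed
   module over itself (complex.v only makes R[i] a module over R). *)
Definition Cplx (R : realType) : numClosedFieldType := R[i].

Section ComplexFunctions.
Variable R : realType.
Local Notation C := (Cplx R).

Definition cabs (z : C) : R := Normc.normc z.

Definition cexp (z : C) : C :=
  (expR (complex.Re z) * cos (complex.Im z)) +i*
  (expR (complex.Re z) * sin (complex.Im z)).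

(* values in ]-pi, pi] for z != 0 *)
Definition carg (z : C) : R :=
  if 0 <= complex.Im z then acos (complex.Re z / cabs z)
  else - acos (complex.Re z / cabs z).

Definition clog (z : C) : C := ln (cabs z) +i* carg z.

(* G 1 = id, and G n.+1 z = clog (1 + G n z) for n >= 1; G 0 is not used. *)
Definition G (n : nat) (z : C) : C := iter n.-1 (fun w => clog (1 + w)) z.

End ComplexFunctions.

Section HilbertFunctionSpaces.
Variable R : realType.
Local Notation C := (Cplx R).

Record hilbertSpace := HilbertSpace {
  hs_sort :> completeNormedModType C ;
  hs_dot : {dot hs_sort for Num.conj} ; (* linear in the first argument *)
  hs_normE : forall x : hs_sort, `|x| ^+ 2 = hs_dot x x }.

(* The elements of a Hilbert space are identified with functions on X through
   an injective linear map. *)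
Record hilbertFunctionSpace (X : Type) := HilbertFunctionSpace {
  hfs_space :> hilbertSpace ;
  hfs_fun : hfs_space -> X -> C ;
  hfs_fun_linear : forall (a : C) (u v : hfs_space) (x : X),
    hfs_fun (a *: u + v) x = a * hfs_fun u x + hfs_fun v x ;
  hfs_fun_inj : injective hfs_fun ;
  hfs_fun_continuous : forall x : X, continuous (fun u => hfs_fun u x) }.

Variable X : Type.
Implicit Types H : hilbertFunctionSpace X.

Definition hfs_set H : set (X -> C) := range (@hfs_fun X H).

Definition multiplier H : set (X -> C) :=
  [set phi | forall f, hfs_set H f -> hfs_set H (fun x => phi x * f x)].

Definition cyclic H (f : X -> C) : Prop :=
  hfs_set H f /\
  dense [set g : H | exists2 phi, multiplier H phi &
                       hfs_fun g = (fun x => phi x * f x)].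

Definition pick_smirnov H : set (X -> C) :=
  [set h | exists phi psi : X -> C,
    [/\ multiplier H phi, multiplier H psi, cyclic H psi &
        h = (fun x => phi x / psi x)]].

(* k w z stands for k_w(z). *)
Definition reproducing_kernel H (k : X -> X -> C) : Prop :=
  forall w, exists2 kw : H, hfs_fun kw = k w &
    forall f : H, hfs_fun f w = hs_dot H f kw.

Definition normalized_complete_pick_kernel (k : X -> X -> C) : Prop :=
  exists (w0 : X) (K : hilbertSpace) (b : X -> K), b w0 = 0 /\
    forall w z, 1 - hs_dot K (b z) (b w) != 0 /\
                k w z = 1 / (1 - hs_dot K (b z) (b w)).

Definition equivalent_norms H H' : Prop :=
  hfs_set H = hfs_set H' /\
  exists c1 c2 : C, [/\ 0 < c1, 0 < c2 &
    forall (u : H) (u' : H'), hfs_fun u = hfs_fun u' ->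
      c1 * `|u| <= `|u'| /\ `|u'| <= c2 * `|u|].

Definition complete_pick H : Prop :=
  exists H' : hilbertFunctionSpace X, equivalent_norms H H' /\
    exists2 k, reproducing_kernel H' k & normalized_complete_pick_kernel k.

End HilbertFunctionSpaces.

Section Ball.
Variables (R : realType) (d : nat).
Local Notation C := (Cplx R).

(* The norm that the library puts on 'rV_d is the sup norm, hence the explicit
   Euclidean norms. *)
Definition unit_ball : set 'rV[C]_d :=
  [set z : 'rV[C]_d | \sum_(j < d) `|z 0 j| ^+ 2 < 1].
Definition closed_unit_ball : set 'rV[C]_d :=
  [set z : 'rV[C]_d | \sum_(j < d) `|z 0 j| ^+ 2 <= 1].
Definition unit_sphere : set 'rV[C]_d :=
  [set z : 'rV[C]_d | \sum_(j < d) `|z 0 j| ^+ 2 = 1].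

Definition extend0 (f : unit_ball -> C) : 'rV[C]_d -> C := 'valL_ 0 f.

(* complex (Frechet) differentiability at every point of the open ball *)
Definition hol : set (unit_ball -> C) :=
  [set f | forall z, unit_ball z -> differentiable (extend0 f) z].

Definition radial_derivative (F : 'rV[C]_d -> C) (z : 'rV[C]_d) : C :=
  \sum_(j < d) z 0 j * 'D_(delta_mx 0 j) F z.

Definition log_branch (f L : unit_ball -> C) : Prop :=
  hol L /\ forall z, cexp (L z) = f z.

Definition bounded_argument (f : unit_ball -> C) : Prop :=
  exists2 L, log_branch f L &
    exists2 M : R, 0 < M & forall z, `|complex.Im (L z)| <= M.

Definition sup_norm (f : unit_ball -> C) : \bar R :=
  ereal_sup (range (fun z => (cabs (f z))%:E)).

Definition borelCd := g_sigma_algebraType (@open 'rV[C]_d).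

Definition normalized_sphere_measure (sigma : probability borelCd R) : Prop :=
  sigma unit_sphere = 1%E /\
  forall (U : 'M[C]_d) (A : set borelCd), U \is unitarymx -> measurable A ->
    sigma ((fun w : 'rV[C]_d => w *m U) @^-1` A) = sigma A.

Implicit Types (sigma : probability borelCd R)
  (mu : {finite_measure set R -> \bar R})
  (omega : {measure set borelCd -> \bar R}).

(* d omega (r w) = d mu (r) d sigma (w), where mu is carried by [0, 1] *)
Definition admissible_radial sigma mu omega : Prop :=
  [/\ mu (~` `[0%R, 1%R]%classic) = 0%E,
      forall r : R, 0 < r < 1 -> (0 < mu `]r, 1%R]%classic)%E &
      forall A : set borelCd, measurable A ->
        omega A = (\int[mu]_(r in `[0%R, 1%R]%classic)
                     sigma [set w : 'rV[C]_d | A (r%:C *: w)])%E].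

Definition hardy_normsq sigma (F : 'rV[C]_d -> C) : \bar R :=
  ereal_sup [set (\int[sigma]_(w in unit_sphere)
                    (cabs (F (r%:C *: (w : 'rV[C]_d))) ^+ 2)%:E)%E
            | r in `]0, 1[%classic].

Definition L2_normsq sigma mu omega (F : 'rV[C]_d -> C) : \bar R :=
  (\int[omega]_(z in unit_ball) (cabs (F z) ^+ 2)%:E
   + mu [set 1%R] * hardy_normsq sigma F)%E.

Definition besov sigma mu omega (N : nat) : set (unit_ball -> C) :=
  [set f | hol f /\
    (L2_normsq sigma mu omega (iter N radial_derivative (extend0 f)) < +oo)%E].

Definition besov_normsq sigma mu omega (N : nat) (f : unit_ball -> C) :
    \bar R :=
  ((if N == 0%N then 0
    else omega closed_unit_ball * (cabs (extend0 f 0) ^+ 2)%:E)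
   + L2_normsq sigma mu omega (iter N radial_derivative (extend0 f)))%E.

Definition radially_weighted_besov (H : hilbertFunctionSpace R unit_ball) :
    Prop :=
  exists sigma mu omega (N : nat),
    [/\ normalized_sphere_measure sigma,
        admissible_radial sigma mu omega,
        hfs_set H = besov sigma mu omega N &
        forall u : H, (complex.Re (`|u| ^+ 2))%:E =
                      besov_normsq sigma mu omega N (hfs_fun u)].

End Ball.

Arguments unit_ball : clear implicits.
Arguments closed_unit_ball : clear implicits.
Arguments unit_sphere : clear implicits.
Arguments hol : clear implicits.

(* Main.v *)
(* Let K be an analytic function with K = p / q, where p and q are multipliers and q is
   cyclic. If Im K is bounded then q^m e^(K - (dl K)^2) is a multiplier for large m, because
   its partial derivatives in (p, q) of order at most N are bounded, and for the same reason
   q^m e^(- (dl K)^2) tends to q^m in H as dl tends to 0. So for e^(-K) in H the multiples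
   q^m e^(K - (dl K)^2) e^(-K) of e^(-K) tend to the cyclic function q^m, and e^(-K) is cyclic.
   Conversely, every f in H is a quotient p / q of multipliers with q cyclic: in the complete
   Pick norm with |f| = 1 and A(z) = <f, k_z f>, both f / A and 1 - 1 / A are contractive
   multipliers. If f is cyclic then so is p, and (p q)^m log (p / q) is a multiplier, hence
   log f is in N^+. Finally K is in N^+ if and only if log (1 + K) is: q^m log (1 + K) is a
   multiplier if K = p / q, and if log (1 + K) = p / q then u = q^m e^(- p / q) is a cyclic
   multiplier, by the first argument, with 1 + K = q^m / u.
   The calculus needs that the radial derivative of an analytic function is analytic, which
   rests on Goursat's theorem and the Cauchy formula for the derivative. *)

From HB Require Import structures.
Require Import Defs.
From mathcomp Require Import ring lra zify measurable_realfun.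

Set Implicit Arguments.
Unset Strict Implicit.
Unset Printing Implicit Defensive.

Local Open Scope classical_set_scope.
Local Open Scope ring_scope.
Local Open Scope complex_scope.

(** Multiplier algebras are not closed under exp or log, and [e^K] may be unbounded when only [Im K]
    is bounded. The remedy is homogeneity: if the derivatives of [F] grow polynomially,
    [t^m F(s / t)] has bounded partial derivatives at [(p, q)] for large [m], because
    [|q| (1 + |p / q|) = |q| + |p|] is bounded, so that one power of [q] pays for one power of
    [1 + |p / q|]. The Gaussian tames [e^K] because [Re K^2 = (Re K)^2 - (Im K)^2]; this is where
    the bounded argument enters. The norm sees [N] radial derivatives in [L^2], where products are
    not controlled directly. All derivatives of [p], [q] and [h] are therefore collected in
    coefficients [Ex] that do not depend on [F], and these are shown to be square integrable by
    testing the expansion on the monomials [p^i q^j]. For [log (1 + K)] with [Re K >= 0] the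
    argument is bounded automatically, so the chain of the [G n] can be descended from any [n]. The
    Pick norm is only equivalent to the Besov norm; multipliers and cyclicity are carried across. *)

Section ComplexNorm.
Variable R : realType.
Local Notation C := (Cplx R).
Local Notation Re := (@complex.Re R).
Local Notation Im := (@complex.Im R).
Implicit Types (z w : C) (x y : R).

(** * The real-valued modulus and the topology of C *)

Lemma normCabs z : `|z| = (cabs z)%:C.
Proof. by case: z => a b; rewrite normc_def. Qed.

Lemma cabs_ge0 z : 0 <= cabs z.
Proof. by rewrite -lecR -normCabs normr_ge0. Qed.

Lemma cabsM z w : cabs (z * w) = cabs z * cabs w.
Proof. exact: Normc.normcM. Qed.

Lemma cabsV z : cabs z^-1 = (cabs z)^-1.
Proof. exact: Normc.normcV. Qed.

Lemma cabsD z w : cabs (z + w) <= cabs z + cabs w.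
Proof. exact: le_normcD. Qed.

Lemma cabsN z : cabs (- z) = cabs z.
Proof. exact: normcN. Qed.

Lemma cabsB z w : cabs (z - w) <= cabs z + cabs w.
Proof. by rewrite -(cabsN w); exact: cabsD. Qed.

Lemma cabs0 : cabs (0 : C) = 0.
Proof. exact: Normc.normc0. Qed.

Lemma cabs1 : cabs (1 : C) = 1.
Proof. exact: Normc.normc1. Qed.

Lemma cabs_eq0 z : (cabs z == 0) = (z == 0).
Proof. by rewrite -(inj_eq (@complexI R)) -normCabs normr_eq0. Qed.

Lemma cabs_gt0 z : (0 < cabs z) = (z != 0).
Proof. by rewrite lt_def cabs_eq0 cabs_ge0 andbT. Qed.

Lemma cabsX z n : cabs (z ^+ n) = cabs z ^+ n.
Proof. by elim: n => [|n IH]; rewrite ?cabs1 // !exprS cabsM IH. Qed.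

Lemma cabsR x : cabs (x%:C : C) = `|x|.
Proof. by rewrite /cabs /= expr0n /= addr0 sqrtr_sqr. Qed.

Lemma cabs_nat n : cabs (n%:R : C) = n%:R.
Proof. by rewrite -(rmorph_nat (real_complex R)) cabsR normr_nat. Qed.

Lemma sqr_cabs z : cabs z ^+ 2 = Re z ^+ 2 + Im z ^+ 2.
Proof. by case: z => a b; rewrite /cabs /= sqr_sqrtr // addr_ge0 ?sqr_ge0. Qed.

Lemma Re_le_cabs z : `|Re z| <= cabs z.
Proof.
rewrite -(@ler_pXn2r _ 2) ?nnegrE ?normr_ge0 ?cabs_ge0 //.
by rewrite sqr_cabs real_normK ?num_real // lerDl sqr_ge0.
Qed.

Lemma Im_le_cabs z : `|Im z| <= cabs z.
Proof.
rewrite -(@ler_pXn2r _ 2) ?nnegrE ?normr_ge0 ?cabs_ge0 //.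
by rewrite sqr_cabs real_normK ?num_real // lerDr sqr_ge0.
Qed.

Lemma cabs_le_ReIm z : cabs z <= `|Re z| + `|Im z|.
Proof.
rewrite -(@ler_pXn2r _ 2) ?nnegrE ?addr_ge0 ?cabs_ge0 //.
rewrite sqr_cabs sqrrD !real_normK ?num_real //.
by rewrite -addrA [X in _ <= _ + X]addrC addrA lerDl mulrn_wge0 // mulr_ge0.
Qed.

Lemma ReD z w : Re (z + w) = Re z + Re w. Proof. by case: z w => ? ? []. Qed.
Lemma ImD z w : Im (z + w) = Im z + Im w. Proof. by case: z w => ? ? []. Qed.
Lemma ReN z : Re (- z) = - Re z. Proof. by case: z. Qed.
Lemma ImN z : Im (- z) = - Im z. Proof. by case: z. Qed.
Lemma ReM z w : Re (z * w) = Re z * Re w - Im z * Im w.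
Proof. by case: z w => ? ? []. Qed.
Lemma ImM z w : Im (z * w) = Re z * Im w + Im z * Re w.
Proof. by case: z w => ? ? []. Qed.

Lemma complex_eqP z w : Re z = Re w -> Im z = Im w -> z = w.
Proof. by case: z w => a b [c e] /= -> ->. Qed.

Lemma posC (e : C) : 0 < e -> exists2 r : R, 0 < r & e = r%:C.
Proof.
case: e => a b; rewrite ltcE /= => /andP[/eqP -> a0]; by exists a.
Qed.

Lemma cvgC_cabs {T : Type} {F : set_system T} {FF : Filter F} (f : T -> C) (l : C) :
  f @ F --> l <-> forall e : R, 0 < e -> \forall t \near F, cabs (f t - l) < e.
Proof.
split.
  move=> /cvgrPdist_lt fl e e0.
  have /fl : 0 < (e%:C : C) by rewrite (ltcR 0 e).
  by apply: filterS => t; rewrite distrC normCabs ltcR.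
move=> fl; apply/cvgrPdist_lt => e /posC[r r0 ->].
apply: filterS (fl r r0) => t; by rewrite distrC normCabs ltcR.
Qed.

Lemma near_cabs z (e : R) : 0 < e -> \forall w \near z, cabs (w - z) < e.
Proof.
move=> e0; apply/nbhs_normP; exists e%:C; first by rewrite /= (ltcR 0 e).
by move=> w /=; rewrite distrC normCabs ltcR.
Qed.

Lemma Re_continuous : continuous (Re : C -> R).
Proof.
move=> z; apply/(@cvgrPdist_lt _ _ _ (nbhs z)) => e e0.
apply: filterS (near_cabs z e0) => w; apply: le_lt_trans.
by rewrite distrC -ReN -ReD Re_le_cabs.
Qed.

Lemma Im_continuous : continuous (Im : C -> R).
Proof.
move=> z; apply/(@cvgrPdist_lt _ _ _ (nbhs z)) => e e0.
apply: filterS (near_cabs z e0) => w; apply: le_lt_trans.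
by rewrite distrC -ImN -ImD Im_le_cabs.
Qed.

Lemma cvg_complex {T : Type} {F : set_system T} {FF : Filter F} (f g : T -> R)
    (a b : R) :
  f @ F --> a -> g @ F --> b -> (fun t => f t +i* g t : C) @ F --> (a +i* b : C).
Proof.
move=> /cvgrPdist_lt fa /cvgrPdist_lt gb; apply/cvgC_cabs => e e0.
have e20 : 0 < e / 2 by rewrite divr_gt0.
apply: filterS2 (fa _ e20) (gb _ e20) => t.
rewrite distrC => h1; rewrite distrC => h2.
by apply: (le_lt_trans (cabs_le_ReIm _)); rewrite /=; lra.
Qed.

End ComplexNorm.

(** * Integrals of continuous complex functions on real intervals *)

Section Integral.
Variables (R : realType) (lo : R).
Local Notation C := (Cplx R).
Local Notation Re := (@complex.Re R).
Local Notation Im := (@complex.Im R).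
Local Notation mu := (@lebesgue_measure R).

Let prim (f : R -> R) (x : R) : R := \int[mu]_(t in `[lo, x]) f t.

Let integrable_cc (f : R -> R) (a b : R) :
  continuous f -> mu.-integrable `[a, b] (EFin \o f).
Proof.
move=> fc; apply: continuous_compact_integrable; first exact: segment_compact.
exact: continuous_subspaceT.
Qed.

Let prim_derive (f : R -> R) (x : R) : continuous f -> lo < x ->
  is_derive x 1 (prim f) (f x).
Proof.
move=> fc lox.
have xx1 : x < x + 1 by rewrite ltrDl.
have [dP eP] := continuous_FTC1_closed xx1 (integrable_cc lo (x + 1) fc) lox (fc x).
by split; [exact: dP|rewrite -eP derive1E].
Qed.

Let prim_mvt (f : R -> R) (a b : R) : continuous f -> lo < a -> a <= b ->
  exists2 c, a <= c <= b & prim f b - prim f a = f c * (b - a).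
Proof.
move=> fc loa ab.
have [||c cab ->] := @MVT_segment R (prim f) f a b ab.
- move=> x; rewrite in_itv /= => /andP[ax _].
  by apply: prim_derive => //; exact: lt_trans ax.
- apply: derivable_within_continuous => x; rewrite in_itv /= => /andP[ax _].
  by have [] := prim_derive fc (lt_le_trans loa ax).
by exists c.
Qed.

(** A difference of primitives based at [lo], so that splitting an interval is pure algebra. The
    fundamental theorem of calculus is used at interior points, which is why the estimates ask for
    [lo < a]. *)
Definition cint (f : R -> C) (a b : R) : C :=
  (prim (Re \o f) b - prim (Re \o f) a) +i* (prim (Im \o f) b - prim (Im \o f) a).

Lemma cint_split f a b c : cint f a c = cint f a b + cint f b c.
Proof. by apply: complex_eqP => /=; ring. Qed.

Let Re_comp (f : R -> C) : continuous f -> continuous (Re \o f).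
Proof. by move=> fc x; apply: continuous_comp; [exact: fc|exact: Re_continuous]. Qed.

Let Im_comp (f : R -> C) : continuous f -> continuous (Im \o f).
Proof. by move=> fc x; apply: continuous_comp; [exact: fc|exact: Im_continuous]. Qed.

(** The mean value theorem is applied to the real and the imaginary part separately, at two
    different points; this costs the factor 2. *)
Lemma cint_near (f : R -> C) (a b : R) (w : C) (e : R) :
  continuous f -> lo < a -> a <= b ->
  (forall x, a <= x <= b -> cabs (f x - w) <= e) ->
  cabs (cint f a b - w * (b - a)%:C) <= 2 * e * (b - a).
Proof.
move=> fc loa ab fw; rewrite /cint.
have [c /fw cw ->] := prim_mvt (Re_comp fc) loa ab.
have [c' /fw c'w ->] := prim_mvt (Im_comp fc) loa ab.
apply: (le_trans (cabs_le_ReIm _)).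
rewrite ReD ReN ImD ImN ReM ImM /= !mulr0 !(subr0, addr0, add0r, mulr0) -!mulrBl.
rewrite !normrM (ger0_norm (_ : 0 <= b - a)) ?subr_ge0 // -mulrDl.
apply: ler_wpM2r; rewrite ?subr_ge0 // mulr_natl mulr2n; apply: lerD.
  by apply: le_trans cw; rewrite -ReN -ReD Re_le_cabs.
by apply: le_trans c'w; rewrite -ImN -ImD Im_le_cabs.
Qed.

Lemma cint_bound (f : R -> C) (a b : R) (e : R) :
  continuous f -> lo < a -> a <= b ->
  (forall x, a <= x <= b -> cabs (f x) <= e) ->
  cabs (cint f a b) <= 2 * e * (b - a).
Proof.
move=> fc loa ab fe; have := @cint_near f a b 0 e fc loa ab.
by rewrite mul0r subr0; apply => x /fe; rewrite subr0.
Qed.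

Lemma cint_lin (z : C) (f g : R -> C) (a b : R) : continuous f -> continuous g ->
  cint (fun x => z * f x + g x) a b = z * cint f a b + cint g a b.
Proof.
move=> fc gc.
have rf := Re_comp fc; have rg := Re_comp gc.
have jf := Im_comp fc; have jg := Im_comp gc.
have lin (x y : R) (u v w : R -> R) t : continuous u -> continuous v -> continuous w ->
    prim (fun s => x * u s + y * v s + w s) t = x * prim u t + y * prim v t + prim w t.
  move=> uc vc wc; rewrite /prim.
  have su (k : R) (k0 : R -> R) : continuous k0 -> continuous (fun s => k * k0 s).
    by move=> kc s; apply: cvgM; [exact: cvg_cst|exact: kc].
  have xuyv : continuous (fun s => x * u s + y * v s).
    by move=> s; apply: cvgD; [exact: (su x u uc s)|exact: (su y v vc s)].
  rewrite RintegralD //; [|exact: integrable_cc..].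
  rewrite RintegralD //; [|by apply: integrable_cc; exact: su..].
  by rewrite !RintegralZl //; exact: integrable_cc.
have eRe t : prim (Re \o (fun x => z * f x + g x)) t
   = Re z * prim (Re \o f) t + (- Im z) * prim (Im \o f) t + prim (Re \o g) t.
  rewrite -lin //; congr (prim _ t); apply/funext => s /=.
  by rewrite ReD ReM mulNr.
have eIm t : prim (Im \o (fun x => z * f x + g x)) t
   = Re z * prim (Im \o f) t + Im z * prim (Re \o f) t + prim (Im \o g) t.
  rewrite -lin //; congr (prim _ t); apply/funext => s /=.
  by rewrite ImD ImM.
rewrite /cint !eRe !eIm.
by apply: complex_eqP; rewrite ?(ReD, ReM, ImD, ImM) /=; ring.
Qed.

End Integral.

(** Rectangles that reach arbitrarily far to the left need a base point that varies; this lemma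
    compares the results. *)
Lemma cint_lo (R : realType) (lo lo' : R) (f : R -> Cplx R) a b : continuous f ->
  lo <= a -> lo' <= a -> a <= b -> cint lo f a b = cint lo' f a b.
Proof.
move=> fc loa lo'a ab.
have ic l (g : R -> R) : continuous g -> lebesgue_measure.-integrable `[l, b] (EFin \o g).
  move=> gc; apply: continuous_compact_integrable; first exact: segment_compact.
  exact: continuous_subspaceT.
have rf : continuous (@complex.Re R \o f).
  by move=> x; apply: continuous_comp; [exact: fc|exact: Re_continuous].
have jf : continuous (@complex.Im R \o f).
  by move=> x; apply: continuous_comp; [exact: fc|exact: Im_continuous].
by rewrite /cint !Rintegral_itvB ?bnd_simp //; exact: ic.
Qed.

(** * Goursat's theorem on rectangles *)

Section Goursat.
Variables (R : realType) (lo : R).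
Local Notation C := (Cplx R).
Variable F : R -> R -> C.
Hypothesis Fc1 : forall x, continuous (F x).
Hypothesis Fc2 : forall y, continuous (fun x => F x y).

Definition cdiff_at (x0 y0 : R) := exists A : C, forall e : R, 0 < e ->
  exists2 dl : R, 0 < dl & forall x y, `|x - x0| < dl -> `|y - y0| < dl ->
    cabs (F x y - F x0 y0 - A * ((x - x0) +i* (y - y0))) <= e * (`|x - x0| + `|y - y0|).

(** The integral along the boundary of the rectangle with sides [[a, b]] and [[c, d]],
    counterclockwise, with opposite sides grouped. *)
Let I (a b c d : R) : C := cint lo (fun x => F x c - F x d) a b
  + 'i * cint lo (fun y => F b y - F a y) c d.

Let Fd2 c d : continuous (fun x => F x c - F x d).
Proof. by move=> x; apply: cvgB; exact: Fc2. Qed.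

Let Fd1 a b : continuous (fun y => F b y - F a y).
Proof. by move=> x; apply: cvgB; exact: Fc1. Qed.

Let I_splitx m a b c d : I a b c d = I a m c d + I m b c d.
Proof.
rewrite /I (cint_split _ _ _ m).
have -> : (fun y => F b y - F a y) =
    (fun y => 1 * (F b y - F m y) + (F m y - F a y)).
  by apply/funext => y; rewrite mul1r addrA subrK.
by rewrite cint_lin //; ring.
Qed.

Let I_splity m a b c d : I a b c d = I a b c m + I a b m d.
Proof.
rewrite /I [cint _ _ c d](cint_split _ _ _ m).
have -> : (fun x => F x c - F x d) =
    (fun x => 1 * (F x c - F x m) + (F x m - F x d)).
  by apply/funext => y; rewrite mul1r addrA subrK.
by rewrite cint_lin //; ring.
Qed.

(** An affine function integrates to 0 along the boundary: its contributions to the horizontal and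
    the vertical sides cancel. Only the deviation from it is left to estimate. *)
Let I_small a b c d x0 y0 A e : lo < a -> lo < c ->
  a <= x0 <= b -> c <= y0 <= d -> 
  (forall x y, a <= x <= b -> c <= y <= d ->
    cabs (F x y - F x0 y0 - A * ((x - x0) +i* (y - y0))) <= e) ->
  cabs (I a b c d) <= 4 * e * ((b - a) + (d - c)).
Proof.
move=> loa loc xab ycd err.
have ab : a <= b by lra.
have cd : c <= d by lra.
have h1 : cabs (cint lo (fun x => F x c - F x d) a b - (A * (0 +i* (c - d))) * (b - a)%:C)
    <= 2 * (2 * e) * (b - a).
  apply: cint_near => // x xab'.
  have e1 := err x c xab' (_ : c <= c <= d); have e2 := err x d xab' (_ : c <= d <= d).
  have {}e1 := e1 ltac:(lra); have {}e2 := e2 ltac:(lra).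
  have -> : F x c - F x d - A * (0 +i* (c - d)) =
      (F x c - F x0 y0 - A * ((x - x0) +i* (c - y0)))
      - (F x d - F x0 y0 - A * ((x - x0) +i* (d - y0))).
    have -> : (0 +i* (c - d)) = ((x - x0) +i* (c - y0)) - ((x - x0) +i* (d - y0)) :> C.
      by apply: complex_eqP => /=; ring.
    by ring.
  by apply: (le_trans (cabsB _ _)); lra.
have h2 : cabs (cint lo (fun y => F b y - F a y) c d - (A * (b - a)%:C) * (d - c)%:C)
    <= 2 * (2 * e) * (d - c).
  apply: cint_near => // y ycd'.
  have e1 := err b y (_ : a <= b <= b) ycd'; have e2 := err a y (_ : a <= a <= b) ycd'.
  have {}e1 := e1 ltac:(lra); have {}e2 := e2 ltac:(lra).
  have -> : F b y - F a y - A * (b - a)%:C =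
      (F b y - F x0 y0 - A * ((b - x0) +i* (y - y0)))
      - (F a y - F x0 y0 - A * ((a - x0) +i* (y - y0))).
    have -> : (b - a)%:C = ((b - x0) +i* (y - y0)) - ((a - x0) +i* (y - y0)) :> C.
      by apply: complex_eqP => /=; ring.
    by ring.
  by apply: (le_trans (cabsB _ _)); lra.
have -> : I a b c d =
   (cint lo (fun x => F x c - F x d) a b - (A * (0 +i* (c - d))) * (b - a)%:C)
   + 'i * (cint lo (fun y => F b y - F a y) c d - (A * (b - a)%:C) * (d - c)%:C).
  have -> : (0 +i* (c - d)) = - ('i * (d - c)%:C) :> C.
    by apply: complex_eqP => /=; ring.
  by rewrite /I; ring.
apply: (le_trans (cabsD _ _)).
rewrite cabsM (_ : cabs 'i = 1) ?mul1r; last first.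
  by rewrite /cabs /= expr0n /= add0r expr1n sqrtr1.
by lra.
Qed.

(** The integral is the sum over the four quarters, so one of them carries at least a fourth of its
    modulus. *)
Let quarter a c h v : 0 <= h -> 0 <= v -> exists p : R * R,
  [/\ a <= p.1, p.1 <= a + h, c <= p.2, p.2 <= c + v &
   cabs (I a (a + 2 * h) c (c + 2 * v)) <= 4 * cabs (I p.1 (p.1 + h) p.2 (p.2 + v))].
Proof.
move=> h0 v0; apply: contrapT => np.
have lt4 x y : a <= x <= a + h -> c <= y <= c + v ->
    4 * cabs (I x (x + h) y (y + v)) < cabs (I a (a + 2 * h) c (c + 2 * v)).
  move=> /andP[? ?] /andP[? ?]; rewrite ltNge; apply/negP => ?.
  by apply: np; exists (x, y).
have e : I a (a + 2 * h) c (c + 2 * v) = I a (a + h) c (c + v)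
   + I a (a + h) (c + v) (c + v + v) + I (a + h) (a + h + h) c (c + v)
   + I (a + h) (a + h + h) (c + v) (c + v + v).
  have -> : a + 2 * h = a + h + h by ring.
  have -> : c + 2 * v = c + v + v by ring.
  by rewrite (I_splitx (a + h)) (I_splity (c + v) a) (I_splity (c + v) (a + h)) addrA.
have := lt4 a c ltac:(lra) ltac:(lra); have := lt4 a (c + v) ltac:(lra) ltac:(lra).
have := lt4 (a + h) c ltac:(lra) ltac:(lra).
have := lt4 (a + h) (c + v) ltac:(lra) ltac:(lra).
rewrite {}e {lt4 np}; move: (I a _ c _) (I a _ (c + v) _) => e1 e2.
move: (I _ _ c _) (I _ _ _ _) => e3 e4.
have := cabsD (e1 + e2 + e3) e4; have := cabsD (e1 + e2) e3; have := cabsD e1 e2.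
by lra.
Qed.

Lemma goursat a b c d : lo < a -> lo < c -> a <= b -> c <= d ->
  (forall x y, a <= x <= b -> c <= y <= d -> cdiff_at x y) ->
  cint lo (fun x => F x c - F x d) a b
  + 'i * cint lo (fun y => F b y - F a y) c d = 0.
Proof.
move=> loa loc ab cd Fd; rewrite -/(I a b c d).
pose s n : R := 2^-1 ^+ n.
have s_gt0 n : 0 < s n by rewrite exprn_gt0 // invr_gt0.
have sS n : s n = 2 * s n.+1 by rewrite /s exprS mulrA divff ?mul1r // pnatr_eq0.
set h := b - a; set v := d - c.
have h0 : 0 <= h by rewrite subr_ge0.
have v0 : 0 <= v by rewrite subr_ge0.
have /choice[f fP] : forall np : nat * (R * R), exists p : R * R,
    let: (n, q) := np in
    [/\ q.1 <= p.1, p.1 <= q.1 + h * s n.+1, q.2 <= p.2, p.2 <= q.2 + v * s n.+1 &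
    cabs (I q.1 (q.1 + h * s n) q.2 (q.2 + v * s n))
    <= 4 * cabs (I p.1 (p.1 + h * s n.+1) p.2 (p.2 + v * s n.+1))].
  move=> [n [x y]] /=.
  have hs : 0 <= h * s n.+1 by rewrite mulr_ge0 // ltW.
  have vs : 0 <= v * s n.+1 by rewrite mulr_ge0 // ltW.
  have [p [? ? ? ? p5]] := quarter x y hs vs.
  by exists p; split => //; move: p5; rewrite [s n]sS [h * (2 * _)]mulrCA [v * (2 * _)]mulrCA.
pose fix q n := if n is m.+1 then f (m, q m) else (a, c).
have qP n := fP (n, q n).
have q1_mono : {homo (fun n => (q n).1) : m n / (m <= n)%N >-> m <= n}.
  by apply: homo_leq => // [? ? ?|n]; [exact: le_trans|have [] := qP n].
have q2_mono : {homo (fun n => (q n).2) : m n / (m <= n)%N >-> m <= n}.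
  by apply: homo_leq => // [? ? ?|n]; [exact: le_trans|have [] := qP n].
have r1_mono : {homo (fun n => - ((q n).1 + h * s n)) : m n / (m <= n)%N >-> m <= n}.
  apply: homo_leq => // [? ? ?|n]; first exact: le_trans.
  by have [? ? _ _ _] := qP n; rewrite lerN2 [s n]sS /=; lra.
have r2_mono : {homo (fun n => - ((q n).2 + v * s n)) : m n / (m <= n)%N >-> m <= n}.
  apply: homo_leq => // [? ? ?|n]; first exact: le_trans.
  by have [_ _ ? ? _] := qP n; rewrite lerN2 [s n]sS /=; lra.
have s0 : s 0%N = 1 by rewrite /s expr0.
(* Every left end lies to the left of every right end: compare both at the common index [maxn m n].
   Hence the supremum of the left ends lies in all the rectangles. *)
have qr1 m n : (q m).1 <= (q n).1 + h * s n.
  have := q1_mono m (maxn m n) (leq_maxl _ _).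
  have := r1_mono n (maxn m n) (leq_maxr _ _); rewrite lerN2.
  by have := mulr_ge0 h0 (ltW (s_gt0 (maxn m n))); lra.
have qr2 m n : (q m).2 <= (q n).2 + v * s n.
  have := q2_mono m (maxn m n) (leq_maxl _ _).
  have := r2_mono n (maxn m n) (leq_maxr _ _); rewrite lerN2.
  by have := mulr_ge0 v0 (ltW (s_gt0 (maxn m n))); lra.
pose x0 := sup (range (fun n => (q n).1)).
pose y0 := sup (range (fun n => (q n).2)).
have x0P n : (q n).1 <= x0 <= (q n).1 + h * s n.
  apply/andP; split; last by apply: ge_sup; [exists a; exists 0%N|move=> _ [m _ <-]].
  apply: ub_le_sup; last by exists n.
  by exists ((q 0%N).1 + h * s 0%N) => _ [m _ <-].
have y0P n : (q n).2 <= y0 <= (q n).2 + v * s n.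
  apply/andP; split; last by apply: ge_sup; [exists c; exists 0%N|move=> _ [m _ <-]].
  apply: ub_le_sup; last by exists n.
  by exists ((q 0%N).2 + v * s 0%N) => _ [m _ <-].
have x0ab : a <= x0 <= b by have := x0P 0%N; rewrite s0 /h /=; lra.
have y0cd : c <= y0 <= d by have := y0P 0%N; rewrite s0 /v /=; lra.
have [A FA] := Fd x0 y0 x0ab y0cd.
have Iq n : cabs (I a b c d) * s n ^+ 2
    <= cabs (I (q n).1 ((q n).1 + h * s n) (q n).2 ((q n).2 + v * s n)).
  elim: n => [|n IH].
    by rewrite s0 expr1n !mulr1 /h /v /= [a + _]addrC subrK [c + _]addrC subrK.
  have [_ _ _ _] := qP n; move: IH; rewrite [in s n ^+ 2]sS exprMn.
  move=> /le_trans => H /H; rewrite mulrCA (_ : 2 ^+ 2 = 4) ?ler_pM2l //.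
  by rewrite -natrX.
apply/eqP; rewrite -cabs_eq0 eq_le cabs_ge0 andbT; apply/ler_addgt0Pr => e e0.
rewrite add0r.
(* On the [n]-th rectangle [I_small] gives [4 e' (h + v)^2 (s n)^2], and [(s n)^2] is exactly the
   factor lost by [n] quarterings. The summand 1 keeps the divisor positive for a degenerate
   rectangle. *)
have hv0 : 0 < 4 * (h + v + 1) ^+ 2.
  by rewrite mulr_gt0 // exprn_gt0 // ltr_wpDl // addr_ge0.
have [|dl dl0 FAdl] := FA (e / (4 * (h + v + 1) ^+ 2)); first exact: divr_gt0.
have [n sn] : exists n, (h + v + 1) * s n < dl.
  have half1 : `|2^-1 : R| < 1 by rewrite ger0_norm ?invr_ge0 //; lra.
  have /cvgrPdist_lt/(_ dl dl0)[n _ /(_ n (leqnn n)) /=] := cvg_geometric (h + v + 1) half1.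
  rewrite sub0r normrN ger0_norm => [|]; first by exists n.
  by rewrite /geometric /= mulr_ge0 ?(ltW (s_gt0 n)) //; lra.
have hs : 0 <= h * s n by rewrite mulr_ge0 // ltW.
have vs : 0 <= v * s n by rewrite mulr_ge0 // ltW.
have hvs : h * s n + v * s n < dl.
  apply: le_lt_trans sn; rewrite -mulrDl; apply: ler_wpM2r; first exact: ltW.
  by rewrite lerDl.
have loqa : lo < (q n).1 by apply: (lt_le_trans loa); exact: (q1_mono 0%N n).
have loqc : lo < (q n).2 by apply: (lt_le_trans loc); exact: (q2_mono 0%N n).
set e' := e / _ in FAdl.
have e'0 : 0 <= e' by rewrite divr_ge0 // ltW.
have xn := x0P n; have yn := y0P n.
have err x y : (q n).1 <= x <= (q n).1 + h * s n -> (q n).2 <= y <= (q n).2 + v * s n ->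
    cabs (F x y - F x0 y0 - A * ((x - x0) +i* (y - y0))) <= e' * (h * s n + v * s n).
  move=> xP yP.
  have dx : `|x - x0| <= h * s n by rewrite ler_norml; lra.
  have dy : `|y - y0| <= v * s n by rewrite ler_norml; lra.
  apply: le_trans (FAdl x y _ _) _; [lra|lra|].
  by rewrite ler_wpM2l // lerD.
have Is := le_trans (Iq n) (I_small loqa loqc xn yn err).
rewrite -(@ler_pM2r _ (s n ^+ 2)) ?exprn_gt0 //; apply: (le_trans Is).
rewrite [_ + h * _ - _]addrAC subrr add0r [_ + v * _ - _]addrAC subrr add0r -mulrDl.
rewrite (_ : 4 * _ * _ = (4 * (h + v) ^+ 2) * e' * s n ^+ 2); last by ring.
rewrite ler_pM2r ?exprn_gt0 // /e' mulrCA ger_pMr // ler_pdivrMr // mul1r ler_pM2l //.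
by apply: lerXn2r; rewrite ?nnegrE; lra.
Qed.

End Goursat.

(** * Derivatives of functions of one complex variable *)

Section ComplexDerivative.
Variable R : realType.
Local Notation C := (Cplx R).
Local Notation Re := (@complex.Re R).
Local Notation Im := (@complex.Im R).

Lemma nbhsC_cabs (z : C) (P : set C) :
  (\forall w \near z, P w) <-> exists2 e : R, 0 < e & forall w, cabs (w - z) < e -> P w.
Proof.
split.
  move=> /nbhs_normP[_ /posC[r r0 ->] rP]; exists r => // w wz.
  by apply: rP => /=; rewrite distrC normCabs ltcR.
by move=> [e e0 eP]; apply: filterS (near_cabs z e0) => w /eP.
Qed.

(** Linear approximation without division: the point [s' = s] is not an exception, and all
    inequalities are between real numbers. *)
Definition cder (g : C -> C) (s A : C) : Prop := forall e : R, 0 < e ->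
  exists2 dl : R, 0 < dl & forall s', cabs (s' - s) < dl ->
    cabs (g s' - g s - A * (s' - s)) <= e * cabs (s' - s).

Lemma cder_cvg (g : C -> C) (s A : C) : cder g s A <->
  h^-1 *: ((g \o shift s) (h *: 1) - g s) @[h --> 0^'] --> A.
Proof.
split.
  move=> gA; apply/cvgC_cabs => e e0.
  have [|dl dl0 gdl] := gA (e / 2); first by rewrite divr_gt0.
  rewrite near_withinE; apply/nbhsC_cabs; exists dl => // h; rewrite subr0 => hdl h0 /=.
  have := gdl (h + s); rewrite addrK => /(_ hdl) H.
  rewrite [h *: 1]mulr1 [_ *: _]mulrC.
  have -> : (g (h + s) - g s) / h - A = (g (h + s) - g s - A * h) / h.
    by rewrite [RHS]mulrBl mulfK.
  rewrite cabsM cabsV ltr_pdivrMr ?cabs_gt0 //; apply: (le_lt_trans H).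
  by rewrite ltr_pM2r ?cabs_gt0 //; lra.
move=> /cvgC_cabs gA e e0; have := gA e e0; rewrite near_withinE => /nbhsC_cabs[dl dl0 H].
exists dl => // s' s'dl; have [->|ss'] := eqVneq s' s.
  by rewrite !subrr mulr0 subr0 cabs0 mulr0.
have h0 : s' - s != 0 by rewrite subr_eq0.
have := H (s' - s); rewrite subr0 => /(_ s'dl h0) /=.
rewrite [_ *: 1]mulr1 [_ *: _]mulrC subrK.
have -> : (g s' - g s) / (s' - s) - A = (g s' - g s - A * (s' - s)) / (s' - s).
  by rewrite [RHS]mulrBl mulfK.
by rewrite cabsM cabsV ltr_pdivrMr ?cabs_gt0 // => /ltW.
Qed.

Lemma cderP (g : C -> C) (s A : C) : cder g s A <-> is_derive s 1 g A.
Proof.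
split=> [/cder_cvg gA|[gd <-]]; last by apply/cder_cvg.
by split; [apply/cvg_ex; exists A|apply/cvg_lim].
Qed.

Lemma cder_continuous (g : C -> C) (s A : C) : cder g s A -> {for s, continuous g}.
Proof.
move=> /cderP[gd _]; apply: differentiable_continuous.
by apply/derivable1_diffP.
Qed.

Lemma cder_comp (f g : C -> C) (s A B : C) :
  cder f s A -> cder g (f s) B -> cder (g \o f) s (B * A).
Proof.
move=> fA gB e e0.
(* [k] bounds both [|B|] and, near [s], the Lipschitz constant [1 + |A|] of [f]; each of the two
   error terms then gets [e / 2]. *)
set k := 1 + cabs A + cabs B.
have k0 : 0 < k by rewrite /k; have := cabs_ge0 A; have := cabs_ge0 B; lra.
have [|d1 d10 g1] := gB (e / 2 / k); first by rewrite !divr_gt0.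
have e20 : 0 < e / 2 / k by rewrite !divr_gt0.
have [|d2 d20 f2] := fA (Num.min 1 (e / 2 / k)); first by rewrite lt_min ltr01 e20.
exists (Num.min d2 (d1 / k)); first by rewrite lt_min d20 divr_gt0.
move=> s'; rewrite lt_min => /andP[/f2 H2 H1].
have fk : cabs (f s' - f s) <= k * cabs (s' - s).
  have -> : f s' - f s = (f s' - f s - A * (s' - s)) + A * (s' - s) by ring.
  apply: (le_trans (cabsD _ _)); rewrite cabsM.
  apply: (@le_trans _ _ (1 * cabs (s' - s) + cabs A * cabs (s' - s))).
    rewrite lerD2r; apply: (le_trans H2); apply: ler_wpM2r; first exact: cabs_ge0.
    by rewrite ge_min lexx.
  by rewrite -mulrDl; apply: ler_wpM2r; [exact: cabs_ge0|rewrite /k; have := cabs_ge0 B; lra].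
have {}H1 : cabs (f s' - f s) < d1.
  by apply: (le_lt_trans fk); rewrite mulrC -ltr_pdivlMr.
have /= H := g1 _ H1.
have -> : g (f s') - g (f s) - B * A * (s' - s) =
   (g (f s') - g (f s) - B * (f s' - f s)) + B * (f s' - f s - A * (s' - s)) by ring.
apply: (le_trans (cabsD _ _)); rewrite cabsM.
rewrite [e in _ <= e * _]splitr mulrDl; apply: lerD.
  apply: (le_trans H); rewrite -mulrA; apply: ler_wpM2l; first by rewrite divr_ge0 // ltW.
  by rewrite mulrC ler_pdivrMr // mulrC.
apply: (@le_trans _ _ (k * (e / 2 / k * cabs (s' - s)))).
  apply: ler_pM; rewrite ?cabs_ge0 //; first by rewrite /k; have := cabs_ge0 A; lra.
  apply: (le_trans H2); apply: ler_wpM2r; first exact: cabs_ge0.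
  by rewrite ge_min lexx orbT.
by rewrite mulrA [k * _]mulrC divfK ?gt_eqF.
Qed.

End ComplexDerivative.

(** * The complex exponential *)

Section ComplexExponential.
Variable R : realType.
Local Notation C := (Cplx R).
Local Notation Re := (@complex.Re R).
Local Notation Im := (@complex.Im R).
Implicit Types (z w : C) (x y a b : R).

Lemma cexpD z w : cexp (z + w) = cexp z * cexp w.
Proof.
apply: complex_eqP; rewrite ?ReM ?ImM /= !ReD !ImD expRD ?cosD ?sinD; ring.
Qed.

Lemma cexp0 : cexp 0 = 1 :> C.
Proof. by apply: complex_eqP => /=; rewrite expR0 ?cos0 ?sin0 mul1r. Qed.

Lemma cabs_cexp z : cabs (cexp z) = expR (Re z).
Proof.
apply/eqP; rewrite -(@eqrXn2 _ 2) ?cabs_ge0 ?expR_ge0 //.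
by rewrite sqr_cabs /= !exprMn -mulrDr cos2Dsin2 mulr1.
Qed.

Lemma cexp_neq0 z : cexp z != 0.
Proof. by rewrite -cabs_eq0 cabs_cexp expR_eq0. Qed.

Lemma cexpN z : cexp (- z) = (cexp z)^-1.
Proof.
apply: (mulfI (cexp_neq0 z)); rewrite -cexpD subrr cexp0 divff //.
exact: cexp_neq0.
Qed.

(** Used on [sin], then [cos], then [sin y - y]: each estimate bounds the derivative in the next one
    and gains a power of [|x|]. *)
Let abs_mvt (f df : R -> R) (M x : R) : (forall y, is_derive y 1 f (df y)) ->
  (forall y, `|y| <= `|x| -> `|df y| <= M) -> `|f x - f 0| <= M * `|x|.
Proof.
move=> fd dfM.
have fc : continuous f.
  by move=> y; apply/differentiable_continuous/derivable1_diffP; have [] := fd y.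
have [x0|x0] := leP 0 x.
  have [c + ->] := @MVT_segment R f df 0 x x0 (fun y _ => fd y) (continuous_subspaceT fc).
  rewrite in_itv /= => /andP[c0 cx]; rewrite subr0 normrM ler_wpM2r //.
  by apply: dfM; rewrite !ger0_norm.
have [c + E] := @MVT_segment R f df x 0 (ltW x0) (fun y _ => fd y) (continuous_subspaceT fc).
rewrite in_itv /= => /andP[cx c0]; rewrite distrC E sub0r normrM normrN ler_wpM2r //.
by apply: dfM; rewrite !ler0_norm ?lerN2 // ltW.
Qed.

Let sin_le x : `|sin x| <= `|x|.
Proof.
rewrite -[sin x]subr0 -[X in _ - X]sin0 -[leRHS]mul1r; apply: (@abs_mvt sin cos).
by move=> y _; exact: cos_max.
Qed.

Let cos_sub1 x : `|cos x - 1| <= `|x| ^+ 2.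
Proof.
rewrite -[X in _ - X]cos0 expr2; apply: (@abs_mvt cos (fun y => - sin y)).
by move=> y yx; rewrite normrN; apply: le_trans yx.
Qed.

Let sin_subx x : `|sin x - x| <= `|x| ^+ 3.
Proof.
have -> : sin x - x = (sin x - x) - (sin 0 - 0) by rewrite sin0 !subr0.
rewrite exprSr; apply: (@abs_mvt (fun y => sin y - y) (fun y => cos y - 1)).
by move=> y yx; apply: (le_trans (cos_sub1 y)); rewrite lerXn2r ?nnegrE.
Qed.

(** The inequality [1 + x <= e^x] at [a] and at [- a] puts [e^a] between [1 + a] and
    [1 / (1 - a)]. *)
Let exp_sub1x a : `|a| <= 1 / 2 -> `|expR a - 1 - a| <= 2 * `|a| ^+ 2.
Proof.
move=> a2; have := expR_ge1Dx a; have := expR_ge1Dx (- a).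
have a1 : 0 < 1 - a by move: a2; rewrite ler_norml; lra.
rewrite expRN => H1 H2; rewrite ger0_norm; last by lra.
have H3 : expR a <= (1 - a)^-1.
  by rewrite -[expR a]invrK lef_pV2 ?posrE ?invr_gt0 ?expR_gt0.
rewrite real_normK ?num_real //.
have : (1 - a)^-1 - 1 - a = a ^+ 2 / (1 - a) by field; rewrite gt_eqF.
have : a ^+ 2 / (1 - a) <= 2 * a ^+ 2.
  rewrite ler_pdivrMr //.
  have : 0 <= a ^+ 2 * (1 / 2 - a).
    by rewrite mulr_ge0 ?sqr_ge0 //; move: a2; rewrite ler_norml; lra.
  by lra.
by lra.
Qed.

(** [cexp] is assembled from real functions, so its complex derivative at 0 is obtained from real
    Taylor estimates of the two components; [cexpD] carries it to the other points. The constant is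
    crude. *)
Lemma cexp_taylor1 z : cabs z <= 1 / 2 -> cabs (cexp z - 1 - z) <= 12 * cabs z ^+ 2.
Proof.
move=> z2; set r := cabs z.
have [ra rb] : `|Re z| <= r /\ `|Im z| <= r by split; [exact: Re_le_cabs|exact: Im_le_cabs].
case: z @r z2 ra rb => a b r z2 ra rb; rewrite /= in ra rb.
have r0 : 0 <= r by exact: cabs_ge0.
have {}z2 : r <= 1 / 2 by [].
clearbody r.
have ea : expR a <= 2.
  have : `|expR a - 1 - a| <= 2 * `|a| ^+ 2 by apply: exp_sub1x; exact: le_trans ra z2.
  have : `|a| ^+ 2 <= `|a| * (1 / 2) by rewrite expr2 ler_wpM2l //; lra.
  rewrite ler_norml; have := ler_norm a; lra.
have ra2 : `|a| ^+ 2 <= r ^+ 2 by rewrite lerXn2r ?nnegrE.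
have rb2 : `|b| ^+ 2 <= r ^+ 2 by rewrite lerXn2r ?nnegrE.
have e1 := exp_sub1x (le_trans ra z2).
apply: (le_trans (cabs_le_ReIm _)) => /=.
have -> : expR a * cos b - 1 - a = (expR a - 1 - a) + expR a * (cos b - 1) by ring.
have -> : expR a * sin b - 0 - b = expR a * (sin b - b) + b * ((expR a - 1 - a) + a) by ring.
have h1 : `|expR a * (cos b - 1)| <= 2 * r ^+ 2.
  rewrite normrM ger0_norm ?expR_ge0 //; apply: ler_pM; rewrite ?expR_ge0 //.
  exact: le_trans (cos_sub1 b) rb2.
have h2 : `|expR a * (sin b - b)| <= 2 * r ^+ 2.
  rewrite normrM ger0_norm ?expR_ge0 //; apply: ler_pM; rewrite ?expR_ge0 //.
  apply: (le_trans (sin_subx b)); rewrite exprSr -[r ^+ 2]mulr1.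
  by apply: ler_pM; rewrite ?exprn_ge0 //; lra.
have h3 : `|b * ((expR a - 1 - a) + a)| <= 2 * r ^+ 2.
  rewrite normrM (_ : 2 * r ^+ 2 = r * (2 * r)); last by rewrite expr2; ring.
  apply: ler_pM => //; apply: (le_trans (ler_normD _ _)).
  have : `|a| ^+ 2 <= `|a| * (1 / 2) by rewrite expr2 ler_wpM2l //; lra.
  by lra.
have := ler_normD (expR a - 1 - a) (expR a * (cos b - 1)).
have := ler_normD (expR a * (sin b - b)) (b * ((expR a - 1 - a) + a)).
by have := sqr_ge0 r; lra.
Qed.

Lemma cexp_cder z : cder (@cexp R) z (cexp z).
Proof.
move=> e e0; set k := cabs (cexp z).
have k0 : 0 < k by rewrite cabs_gt0 cexp_neq0.
exists (Num.min (1 / 2) (e / (12 * k))).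
  by rewrite lt_min; apply/andP; split; [lra|rewrite divr_gt0 // mulr_gt0].
move=> s; rewrite lt_min => /andP[/ltW h1 h2].
have -> : cexp s - cexp z - cexp z * (s - z) = cexp z * (cexp (s - z) - 1 - (s - z)).
  by rewrite -{1}(subrK z s) cexpD; ring.
rewrite cabsM -/k; apply: (le_trans (ler_wpM2l (ltW k0) (cexp_taylor1 h1))).
move: h2; rewrite ltr_pdivlMr ?mulr_gt0 // => /ltW h2.
have := ler_wpM2r (cabs_ge0 (s - z)) h2; lra.
Qed.

End ComplexExponential.

(** * The mean value property and Cauchy's formula for the derivative *)

Section CauchyEstimates.
Variable R : realType.
Local Notation C := (Cplx R).
Local Notation Re := (@complex.Re R).
Local Notation Im := (@complex.Im R).

Definition cis (t : R) : C := cexp (0 +i* t).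

Lemma cabs_cis t : cabs (cis t) = 1.
Proof. by rewrite cabs_cexp expR0. Qed.

Lemma cis_neq0 t : cis t != 0.
Proof. exact: cexp_neq0. Qed.

Lemma cexp_polar (x t : R) : cexp (x +i* t) = (expR x)%:C * cis t.
Proof.
by apply: complex_eqP; rewrite ?ReM ?ImM /= expR0 !mul0r ?subr0 ?addr0 mul1r.
Qed.

Lemma cexp_continuous : continuous (@cexp R).
Proof. by move=> z; exact: cder_continuous (cexp_cder z). Qed.

Lemma continuous_cis : continuous cis.
Proof.
move=> t; apply: (@cvg_comp _ _ _ (fun t => 0 +i* t : C) (@cexp R) _ (nbhs (0 +i* t : C))).
  by apply: cvg_complex; [exact: cvg_cst|exact: cvg_id].
exact: cexp_continuous.
Qed.

Let twopi : R := pi *+ 2.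

Let twopi_gt0 : 0 < twopi.
Proof. by rewrite mulrn_wgt0 // pi_gt0. Qed.

(** The exponential wraps the rectangle [[a, b] x [0, 2 pi]] around an annulus with outer radius
    [rho]. By periodicity the horizontal sides cancel, so Goursat equates the integrals over the two
    circles, and the inner one tends to [2 pi u(0)] as [a] tends to minus infinity. The annulus
    avoids 0, where [u] is only continuous. *)
Lemma mean_value (u : C -> C) (rho rho1 : R) : 0 < rho -> rho < rho1 ->
  (forall s, s != 0 -> cabs s < rho1 -> exists A, cder u s A) ->
  {for 0, continuous u} ->
  cint (-1) (fun t => u (rho%:C * cis t)) 0 twopi = u 0 * twopi%:C.
Proof.
move=> rho0 rho01 ud u0.
pose rho' := (rho + rho1) / 2; pose s1 := ln rho'.
have rho'0 : 0 < rho' by rewrite /rho'; lra.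
have es1 : expR s1 = rho' by rewrite lnK // posrE.
pose U (s : C) := u (cexp s).
have Ud (s : C) : expR (Re s) < rho1 -> exists A, cder U s A.
  move=> sr; have [|A uA] := ud (cexp s) (cexp_neq0 s); first by rewrite cabs_cexp.
  by exists (A * cexp s); apply: cder_comp uA; exact: cexp_cder.
(* [goursat] wants continuity on the whole plane, but [u] is controlled only for [|s| < rho1].
   Truncating [x] at [s1], beyond the right side of the rectangle, provides it and changes nothing
   on the rectangle. *)
pose F x y := U (Num.min x s1 +i* y).
have Fr x : expR (Num.min x s1) < rho1.
  apply: (@le_lt_trans _ _ rho'); last by rewrite /rho'; lra.
  by rewrite -es1 ler_expR ge_min lexx orbT.
have Fc (x y : R) : {for (Num.min x s1 +i* y : C), continuous U}.
  by have [A /cder_continuous] := Ud (Num.min x s1 +i* y) (Fr x).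
have Fc1 x : continuous (F x).
  move=> y; apply: (@cvg_comp _ _ _ (fun y => Num.min x s1 +i* y : C) U _
    (nbhs (Num.min x s1 +i* y : C))); last exact: Fc.
  by apply: cvg_complex; [exact: cvg_cst|exact: cvg_id].
have Fc2 y : continuous (fun x => F x y).
  move=> x; apply: (@cvg_comp _ _ _ (fun x => Num.min x s1 +i* y : C) U _
    (nbhs (Num.min x s1 +i* y : C))); last exact: Fc.
  apply: cvg_complex; last exact: cvg_cst.
  by apply: (@continuous_min _ _ id (fun=> s1)); [exact: cvg_id|exact: cvg_cst].
have Fd x0 y0 : x0 < s1 -> cdiff_at F x0 y0.
  move=> x0s.
  have mx x : x < s1 -> Num.min x s1 = x by move=> xs; rewrite min_l // ltW.
  have [|A UA] := Ud (x0 +i* y0); first by have := Fr x0; rewrite mx.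
  exists A => e e0; have [dl dl0 Udl] := UA e e0.
  exists (Num.min (dl / 2) (s1 - x0)); first by rewrite lt_min subr_gt0 x0s divr_gt0.
  move=> x y; rewrite !lt_min => /andP[xd xs] /andP[yd ys].
  have xs1 : x < s1 by move: xs; rewrite ltr_norml; lra.
  rewrite /F !mx //.
  have E : (x +i* y : C) - (x0 +i* y0 : C) = (x - x0) +i* (y - y0) by [].
  have cE : cabs ((x - x0) +i* (y - y0) : C) <= `|x - x0| + `|y - y0|.
    exact: cabs_le_ReIm.
  have := Udl (x +i* y); rewrite E => /(_ ltac:(lra)) H.
  by apply: (le_trans H); rewrite ler_pM2l.
pose b := ln rho.
have eb : expR b = rho by rewrite lnK // posrE.
have bs1 : b < s1 by rewrite ltr_ln ?posrE // /rho'; lra.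
have Fb t : F b t = u (rho%:C * cis t).
  by rewrite /F min_l ?ltW // /U cexp_polar eb.
have -> : (fun t => u (rho%:C * cis t)) = F b by apply/funext => t; rewrite Fb.
apply/eqP; rewrite -subr_eq0 -cabs_eq0 eq_le cabs_ge0 andbT.
apply/ler_addgt0Pr => e e0; rewrite add0r.
set e' := e / (2 * twopi); have e'0 : 0 < e' by rewrite divr_gt0 // mulr_gt0.
have /cvgC_cabs/(_ e' e'0)/nbhsC_cabs[dl dl0 udl] := u0.
(* So far left that the inner circle has radius below [dl], where [u] is within [e'] of [u 0]. *)
pose a := Num.min (ln dl) (Num.min b 0) - 1.
have [al [ab a0]] : a < ln dl /\ a < b /\ a < 0.
  have : Num.min (ln dl) (Num.min b 0) <= ln dl by rewrite ge_min lexx.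
  have : Num.min (ln dl) (Num.min b 0) <= b by rewrite !ge_min lexx orbT.
  have : Num.min (ln dl) (Num.min b 0) <= 0 by rewrite !ge_min lexx !orbT.
  by rewrite /a; lra.
have loa : a - 1 < a by lra.
have lo0 : a - 1 < 0 by lra.
have Fd' x y : a <= x <= b -> 0 <= y <= twopi -> cdiff_at F x y.
  by move=> /andP[_ xb] _; apply: Fd; exact: le_lt_trans bs1.
have := goursat Fc1 Fc2 loa lo0 (ltW ab) (ltW twopi_gt0) Fd'.
have -> : (fun x => F x 0 - F x twopi) = (fun=> 0).
  apply/funext => x; rewrite /F /U.
  have -> : cexp (Num.min x s1 +i* 0) = cexp (Num.min x s1 +i* twopi).
    by apply: complex_eqP; rewrite /= ?cos0 ?sin0 ?cos2pi ?sin2pi.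
  by rewrite subrr.
have -> : cint (a - 1) (fun=> 0) a b = 0.
  apply/eqP; rewrite -cabs_eq0 eq_le cabs_ge0 andbT.
  have c0 : continuous (fun _ : R => 0 : C) by move=> ?; exact: cvg_cst.
  have := @cint_bound R (a - 1) (fun=> 0) a b 0 c0 loa (ltW ab).
  by rewrite mulr0 mul0r; apply=> ? _; rewrite cabs0.
rewrite add0r => /eqP; rewrite mulf_eq0 (_ : 'i == 0 = false); last first.
  by rewrite eq_complex /= oner_eq0 andbF.
rewrite orFb.
have -> : (fun y => F b y - F a y) = (fun y => (-1) * F a y + F b y).
  by apply/funext => y; rewrite mulN1r addrC.
rewrite (@cint_lin R (a - 1) (-1) (F a) (F b) 0 twopi (Fc1 a) (Fc1 b)).
rewrite mulN1r addrC subr_eq0 => /eqP E.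
have n10 : -1 <= 0 :> R by lra.
rewrite (cint_lo (Fc1 b) n10 (ltW lo0) (ltW twopi_gt0)) E.
have Fa t : cabs (F a t - u 0) <= e'.
  apply/ltW/udl; rewrite subr0 cabs_cexp /=.
  have dlE : expR (ln dl) = dl by apply: lnK; rewrite posrE.
  rewrite -[ltRHS]dlE ltr_expR; apply: le_lt_trans al.
  by rewrite ge_min lexx.
have := @cint_near R (a - 1) (F a) 0 twopi (u 0) e' (Fc1 a) lo0 (ltW twopi_gt0) (fun x _ => Fa x).
rewrite subr0 => /le_trans; apply.
have t0 : 2 * twopi != 0 by apply: lt0r_neq0; apply: mulr_gt0 twopi_gt0; rewrite ltr0n.
have -> : 2 * e' * twopi = e by rewrite /e' mulrAC mulrC divfK.
exact: lexx.
Qed.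

(** The contour integral of [phi(s) / s^2] over [|s| = rho], divided by [2 pi i], written in the
    angle [t]: there [ds = i s dt]. *)
Definition circ_int (rho : R) (phi : R -> C) : C :=
  cint (-1) (fun t => phi t / (rho%:C * cis t)) 0 twopi / twopi%:C.

Let circ_cont (rho : R) (phi : R -> C) : 0 < rho -> continuous phi ->
  continuous (fun t => phi t / (rho%:C * cis t)).
Proof.
move=> rho0 phic t; apply: cvgM; first exact: phic.
have n0 : rho%:C * cis t != 0.
  by rewrite mulf_neq0 ?cis_neq0 // -cabs_eq0 cabsR normr_eq0 gt_eqF.
apply: cvgV => //.
by apply: cvgM; [exact: cvg_cst|exact: continuous_cis].
Qed.

Lemma circ_int_lin (rho : R) (z : C) (f g : R -> C) : 0 < rho -> continuous f -> continuous g ->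
  circ_int rho (fun t => z * f t + g t) = z * circ_int rho f + circ_int rho g.
Proof.
move=> r0 fc gc; rewrite /circ_int mulrA -mulrDl -cint_lin; try exact: circ_cont.
by congr (cint _ _ _ _ / _); apply/funext => t; rewrite mulrDl mulrA.
Qed.

Lemma circ_int_bound (rho : R) (f : R -> C) (e : R) : 0 < rho -> continuous f ->
  (forall t, cabs (f t) <= e) -> cabs (circ_int rho f) <= 2 * (e / rho).
Proof.
move=> r0 fc fe.
rewrite /circ_int cabsM cabsV cabsR (gtr0_norm twopi_gt0) ler_pdivrMr //.
have := @cint_bound R (-1) (fun t => f t / (rho%:C * cis t)) 0 twopi (e / rho).
rewrite subr0; apply; [exact: circ_cont|lra|exact: ltW|].
move=> t _; rewrite cabsM cabsV cabsM cabsR cabs_cis mulr1 gtr0_norm //.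
by rewrite ler_pM2r ?invr_gt0.
Qed.

(** The mean value property of the difference quotient [(g s - g 0) / s], which extends continuously
    to 0 by the value [A]. *)
Lemma cauchy_derivative (g : C -> C) (rho rho1 : R) (A : C) : 0 < rho -> rho < rho1 ->
  (forall s, cabs s < rho1 -> exists B, cder g s B) -> cder g 0 A ->
  A = circ_int rho (fun t => g (rho%:C * cis t) - g 0).
Proof.
move=> r0 r1 gd gA.
pose u s := if s == 0 then A else (g s - g 0) / s.
have := @mean_value u rho rho1 r0 r1.
have us s : s != 0 -> u s = (g s - g 0) / s by rewrite /u => /negbTE ->.
have -> : (fun t => u (rho%:C * cis t)) =
    (fun t => (g (rho%:C * cis t) - g 0) / (rho%:C * cis t)).
  apply/funext => t; rewrite us // mulf_neq0 ?cis_neq0 //.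
  by rewrite -cabs_eq0 cabsR normr_eq0 gt_eqF.
have u0 : u 0 = A by rewrite /u eqxx.
rewrite u0 => H; rewrite /circ_int H ?mulfK //.
- by rewrite -cabs_eq0 cabsR normr_eq0 gt_eqF.
- move=> s s0 sr; have [B /cderP[gB _]] := gd s sr.
  pose v : C -> C := (g - cst (g 0)) * (fun y : C => (id y)^-1).
  have d1 : derivable v s 1.
    apply: derivableM; first by apply: derivableB; [exact: gB|exact: derivable_cst].
    by apply: derivableV; [exact: s0|exact: derivable_id].
  exists ('D_1 v s); apply/cderP/near_eq_is_derive; last exact: derivableP d1.
  apply/nbhsC_cabs; exists (cabs s); first by rewrite cabs_gt0.
  move=> w ws; rewrite us //; apply/eqP => w0.
  by move: ws; rewrite w0 sub0r cabsN ltxx.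
- apply/(@cvgC_cabs _ _ (nbhs (0 : C))) => e e0; apply/nbhsC_cabs.
  have [|dl dl0 H1] := gA (e / 2); first by rewrite divr_gt0.
  exists dl => // s sdl; rewrite u0 /u; case: eqP => [|/eqP s0].
    by rewrite subrr cabs0.
  have := H1 s sdl; rewrite subr0 => H2.
  have -> : (g s - g 0) / s - A = (g s - g 0 - A * s) / s by rewrite [RHS]mulrBl mulfK.
  rewrite cabsM cabsV ltr_pdivrMr ?cabs_gt0 //; apply: (le_lt_trans H2).
  by rewrite ltr_pM2r ?cabs_gt0 //; lra.
Qed.

End CauchyEstimates.

(** * Real-valued norms *)

Section RealNorm.
Variable R : realType.
Local Notation C := (Cplx R).
Variable V : normedModType C.
Implicit Types (v w : V).

(** The norm of a normed space over C has values in C; its real part lets the linear arithmetic of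
    the real field apply. *)
Definition nm v : R := complex.Re `|v|.

Lemma nmE v : `|v| = (nm v)%:C.
Proof. by rewrite /nm RRe_real // ger0_real. Qed.

Lemma nm_ge0 v : 0 <= nm v. Proof. by rewrite -lecR -nmE normr_ge0. Qed.

Lemma nmD v w : nm (v + w) <= nm v + nm w.
Proof. by rewrite -lecR -nmE rmorphD /= -!nmE ler_normD. Qed.

Lemma nmN v : nm (- v) = nm v. Proof. by rewrite /nm normrN. Qed.

Lemma nmB v w : nm (v - w) <= nm v + nm w.
Proof. by rewrite -(nmN w); exact: nmD. Qed.

Lemma nmBC v w : nm (v - w) = nm (w - v).
Proof. by rewrite -nmN opprB. Qed.

Lemma nmZ (a : C) v : nm (a *: v) = cabs a * nm v.
Proof. by apply: complexI; rewrite -nmE normrZ rmorphM /= -nmE normCabs. Qed.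

Lemma nm0 : nm 0 = 0. Proof. by rewrite /nm normr0. Qed.

Lemma nm_eq0 v : (nm v == 0) = (v == 0).
Proof. by rewrite -(inj_eq (@complexI R)) -nmE normr_eq0. Qed.

Lemma nm_gt0 v : (0 < nm v) = (v != 0).
Proof. by rewrite lt_def nm_eq0 nm_ge0 andbT. Qed.

Lemma near_nm (v : V) (P : set V) :
  (\forall w \near v, P w) <-> exists2 e : R, 0 < e & forall w, nm (w - v) < e -> P w.
Proof.
split.
  move=> /nbhs_normP[_ /posC[r r0 ->] rP]; exists r => // w wz.
  by apply: rP => /=; rewrite distrC nmE ltcR.
move=> [e e0 eP]; apply/nbhs_normP; exists e%:C; first by rewrite /= (ltcR 0 e).
by move=> w /=; rewrite distrC nmE ltcR; exact: eP.
Qed.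

End RealNorm.

(** * Criteria for differentiability, and restriction to complex lines *)

Section DifferentiableCriterion.
Variable R : realType.
Local Notation C := (Cplx R).
Variable V : normedModType C.

(** A quadratic remainder is what the Cauchy estimates produce, and it avoids little-o bookkeeping
    in the applications. *)
Lemma differentiable_quadratic (f : V -> C) (x : V) (df : {linear V -> C}) (K r : R) :
  0 < r -> (forall w, cabs (df w) <= K * nm w) ->
  (forall w, nm w < r -> cabs (f (w + x) - f x - df w) <= K * nm w ^+ 2) ->
  differentiable f x.
Proof.
move=> r0 dfK fK.
set k := `|K| + 1; have k0 : 0 < k by rewrite ltr_wpDl.
have Kk : K <= k by rewrite /k; have := ler_norm K; lra.
have dfc : continuous df.
  apply: bounded_linear_continuous; apply/linear_boundedP.
  exists k%:C; split; first by rewrite complex_real.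
  move=> y ky w; apply: (@le_trans _ _ (k%:C * `|w|)).
    rewrite normCabs nmE -rmorphM /= lecR; apply: (le_trans (dfK w)).
    by rewrite ler_wpM2r ?nm_ge0.
  by rewrite ler_wpM2r // ltW.
have E : f \o shift x = cst (f x) + df +o_ 0 id.
  apply/eqaddoP => _ /posC[e e0 ->].
  apply/near_nm; exists (Num.min r (e / k)); first by rewrite lt_min r0 divr_gt0.
  move=> w; rewrite subr0 lt_min => /andP[wr wk].
  rewrite !fctE /= normCabs nmE -rmorphM /= lecR opprD addrA.
  apply: (le_trans (fK w wr)); rewrite expr2 mulrA ler_wpM2r ?nm_ge0 //.
  apply: (@le_trans _ _ (k * nm w)); first by rewrite ler_wpM2r ?nm_ge0.
  by move: wk; rewrite ltr_pdivlMr // mulrC => /ltW.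
have D := diff_unique dfc E.
by apply/diff_locallyP; rewrite D; split.
Qed.

Lemma slice_cder (F : V -> C) (z w : V) (s : C) : differentiable F (z + s *: w) ->
  cder (fun s => F (z + s *: w)) s ('D_w F (z + s *: w)).
Proof.
move=> Fd; apply/cder_cvg.
have := @diff_derivable _ _ _ _ _ w Fd.
have -> : (fun h => h^-1 *: (((fun s => F (z + s *: w)) \o shift s) (h *: 1)
     - F (z + s *: w))) =
   (fun h : C => h^-1 *: ((F \o shift (z + s *: w)) (h *: w) - F (z + s *: w))).
  apply/funext => h /=; congr (_ *: (F _ - _)).
  by rewrite [h *: 1]mulr1 scalerDl addrCA.
by [].
Qed.

Let proj_derive (p : C -> R) (g : C -> C) (t : R) (A : C) :
  (forall z w, p (z - w) = p z - p w) -> (forall (x : R) z, p (z * x%:C) = p z * x) ->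
  (forall z, `|p z| <= cabs z) -> cder g t%:C A ->
  is_derive t (1 : R) (fun t : R => p (g t%:C)) (p A).
Proof.
move=> pB pZ ple gA.
have H : h^-1 *: (((fun t : R => p (g t%:C)) \o shift t) (h *: 1) - p (g t%:C))
   @[h --> (0 : R)^'] --> p A.
  apply/cvgrPdist_lt => e e0.
  have [|dl dl0 H] := gA (e / 2); first by rewrite divr_gt0.
  rewrite near_withinE; apply/nbhs_normP; exists dl => // h /=.
  rewrite sub0r normrN => hdl h0.
  have htE : (h + t)%:C - t%:C = h%:C :> C by apply: complex_eqP => /=; ring.
  have := H (h + t)%:C; rewrite htE cabsR => /(_ hdl) H1.
  rewrite [h *: 1]mulr1 [_ *: _]mulrC.
  have -> : p A - (p (g (h + t)%:C) - p (g t%:C)) / h =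
      - (p (g (h + t)%:C - g t%:C - A * h%:C) / h).
    by rewrite !pB pZ [X in _ = - X]mulrBl mulfK //; ring.
  rewrite normrN normrM normfV ltr_pdivrMr ?normr_gt0 //.
  apply: (le_lt_trans (le_trans (ple _) H1)).
  by rewrite ltr_pM2r ?normr_gt0 //; lra.
by split; [apply/cvg_ex; exists (p A)|apply/cvg_lim].
Qed.

(** The mean value theorem on [[0, 1]] for the real and the imaginary part of [g], whence the factor
    2. *)
Lemma cder_segment (g D : C -> C) (K : R) :
  (forall t : R, 0 <= t <= 1 -> cder g t%:C (D t%:C)) ->
  (forall t : R, 0 <= t <= 1 -> cabs (D t%:C) <= K) -> cabs (g 1 - g 0) <= 2 * K.
Proof.
move=> gD DK.
have pK (p : C -> R) : (forall z w, p (z - w) = p z - p w) ->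
    (forall (x : R) z, p (z * x%:C) = p z * x) ->
    (forall z, `|p z| <= cabs z) -> `|p (g 1 - g 0)| <= K.
  move=> pB pZ ple.
  have der (t : R) : 0 <= t <= 1 -> is_derive t (1 : R) (fun t : R => p (g t%:C)) (p (D t%:C)).
    by move=> /gD; exact: proj_derive.
  have [||c] := @MVT_segment R (fun t => p (g t%:C)) (fun t => p (D t%:C)) 0 1 ler01.
  - by move=> t; rewrite in_itv /= => /andP[t0 t1]; apply: der; rewrite !ltW.
  - apply: derivable_within_continuous => t; rewrite in_itv /= => /der[+ _].
    exact.
  rewrite in_itv /= => c01; rewrite subr0 mulr1 pB => ->.
  exact: (le_trans (ple _) (DK c c01)).
apply: (le_trans (cabs_le_ReIm _)); rewrite mulr_natl mulr2n; apply: lerD.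
  apply: pK => [z w|x z|z]; first by rewrite ReD ReN.
    by rewrite ReM /= mulr0 subr0.
  exact: Re_le_cabs.
apply: pK => [z w|x z|z]; first by rewrite ImD ImN.
  by rewrite ImM /= mulr0 add0r.
exact: Im_le_cabs.
Qed.

End DifferentiableCriterion.

(** * Directional derivatives of a holomorphic function are holomorphic *)

Section DerivativeHolomorphic.
Variable R : realType.
Local Notation C := (Cplx R).
Variable V : normedModType C.
Variables (F : V -> C) (z0 : V) (r M : R).
Hypothesis r0 : 0 < r.
Hypothesis Fd : forall z, nm (z - z0) < r -> differentiable F z.
Hypothesis FM : forall z, nm (z - z0) < r -> cabs (F z) <= M.

Local Ltac rlra := have := r0; lra.

Let shiftE z w (s : C) : nm (z + s *: w - z0) <= nm (z - z0) + cabs s * nm w.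
Proof. by rewrite addrAC -nmZ nmD. Qed.

Let curve_cont z (s : R -> C) w : continuous s ->
  (forall t, nm (z + s t *: w - z0) < r) ->
  continuous (fun t => F (z + s t *: w)).
Proof.
move=> sc sr t; apply: (@cvg_comp _ _ _ (fun t => z + s t *: w) F _ (nbhs (z + s t *: w))).
  by apply: cvgD; [exact: cvg_cst|apply: cvgZr_tmp; exact: sc].
exact/differentiable_continuous/Fd.
Qed.

Let rcis_cont (rho : R) : continuous (fun t => rho%:C * cis t : C).
Proof. by move=> t; apply: cvgM; [exact: cvg_cst|exact: continuous_cis]. Qed.

Let cabs_rcis (rho t : R) : 0 < rho -> cabs (rho%:C * cis t) = rho.
Proof. by move=> h; rewrite cabsM cabsR cabs_cis mulr1 gtr0_norm. Qed.

(** Cauchy's formula on the complex line through [z] in direction [w]. The doubled radius is the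
    larger disc that [cauchy_derivative] requires. *)
Let DE z w (rho : R) : 0 < rho -> nm (z - z0) + 2 * rho * nm w < r ->
  'D_w F z = circ_int rho (fun t => F (z + (rho%:C * cis t) *: w) - F z).
Proof.
move=> rho0 zr.
have := @cauchy_derivative R (fun s => F (z + s *: w)) rho (2 * rho) ('D_w F z) rho0.
rewrite /= scale0r addr0; apply; first rlra.
  move=> s sr; exists ('D_w F (z + s *: w)); apply: slice_cder; apply: Fd.
  apply: le_lt_trans (shiftE _ _ _) _; apply: le_lt_trans zr; rewrite lerD2l.
  by apply: ler_wpM2r; [exact: nm_ge0|exact: ltW].
have := @slice_cder R V F z w 0; rewrite scale0r addr0; apply; apply: Fd.
apply: le_lt_trans zr; rewrite lerDl !mulr_ge0 ?nm_ge0 //; exact: ltW.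
Qed.

Let D_scale z (a : C) w : nm (z - z0) < r -> 'D_(a *: w) F z = a * 'D_w F z.
Proof. by move=> /Fd Fz; rewrite !deriveE // linearZ. Qed.

(** For [|w| <= 1] and [|z - z0| < r / 2] the disc of radius [2 rho] in [DE] stays inside the ball
    of radius [r]. The estimates then lose room in turn: the bound of the derivative and the
    Lipschitz bound of [F] hold within [r / 2], the Lipschitz bound of the derivative within
    [r / 4], the Taylor bound within [r / 8]. *)
Let rho := r / 4.
Let rho_gt0 : 0 < rho. Proof. by rewrite divr_gt0. Qed.

Let homog z (K : R) w : nm (z - z0) < r ->
  (forall w', nm w' <= 1 -> cabs ('D_w' F z) <= K) -> cabs ('D_w F z) <= K * nm w.
Proof.
move=> zr H; have [->|w0] := eqVneq w 0.
  by rewrite nm0 mulr0 derive0 cabs0 lexx.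
have nw : 0 < nm w by rewrite nm_gt0.
have nwC : (nm w)%:C != 0 :> C by rewrite -cabs_eq0 cabsR normr_eq0 gt_eqF.
have -> : w = (nm w)%:C *: ((nm w)%:C^-1 *: w) by rewrite scalerA divff // scale1r.
rewrite D_scale // nmZ !cabsM cabsR mulrC (gtr0_norm nw).
have := H ((nm w)%:C^-1 *: w); rewrite nmZ cabsV cabsR (gtr0_norm nw) mulVf ?gt_eqF //.
by move=> /(_ (lexx 1)) ?; rewrite mulr1 ler_pM2r.
Qed.

Let L0 := 2 * (2 * M / rho).

Let D_bound z w : nm (z - z0) < r / 2 -> cabs ('D_w F z) <= L0 * nm w.
Proof.
move=> zr; have zr' : nm (z - z0) < r by rlra.
apply: homog => // w' w'1.
have cr t : nm (z + (rho%:C * cis t) *: w' - z0) < r.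
  apply: le_lt_trans (shiftE _ _ _) _; rewrite cabs_rcis //.
  have : rho * nm w' <= rho by rewrite ger_pMr.
  by rewrite /rho; rlra.
rewrite (@DE z w' rho) //; last first.
  have : rho * nm w' <= rho by rewrite ger_pMr.
  by rewrite /rho; rlra.
apply: circ_int_bound => //.
  move=> t; apply: cvgB; last exact: cvg_cst.
  exact: curve_cont.
by move=> t; apply: (le_trans (cabsB _ _)); have := FM (cr t); have := FM zr'; rlra.
Qed.

Let seg z z' (t : R) : 0 <= t <= 1 ->
  nm (z + t%:C *: (z' - z) - z0) <= Num.max (nm (z - z0)) (nm (z' - z0)).
Proof.
move=> /andP[t0 t1].
have -> : z + t%:C *: (z' - z) - z0 = (1 - t)%:C *: (z - z0) + t%:C *: (z' - z0).
  have -> : (1 - t)%:C = 1 - t%:C :> C by apply: complex_eqP => /=; ring.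
  rewrite scalerBl scale1r addrAC -[RHS]addrA [X in _ = _ + X]addrC -scalerBr opprB.
  by rewrite addrA subrK.
apply: (le_trans (nmD _ _)); rewrite !nmZ !cabsR !ger0_norm ?subr_ge0 //.
set m := Num.max _ _.
have h1 : nm (z - z0) <= m by rewrite le_max lexx.
have h2 : nm (z' - z0) <= m by rewrite le_max lexx orbT.
have := ler_wpM2l t0 h2; have t1' : 0 <= 1 - t by rewrite subr_ge0.
by have := ler_wpM2l t1' h1; rlra.
Qed.

Let F_lip z z' : nm (z - z0) < r / 2 -> nm (z' - z0) < r / 2 ->
  cabs (F z' - F z) <= 2 * (L0 * nm (z' - z)).
Proof.
move=> zr zr'.
have sg t : 0 <= t <= 1 -> nm (z + t%:C *: (z' - z) - z0) < r / 2.
  by move=> t01; apply: le_lt_trans (seg _ _ t01) _; rewrite gt_max zr zr'.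
have := @cder_segment R (fun s => F (z + s *: (z' - z)))
  (fun s => 'D_(z' - z) F (z + s *: (z' - z))) (L0 * nm (z' - z)).
rewrite scale1r scale0r addr0 [z + _]addrC subrK; apply.
  by move=> t t01; apply: slice_cder; apply: Fd; have := sg t t01; rlra.
by move=> t t01; apply: D_bound; exact: sg.
Qed.

(** The Cauchy estimate for the difference of [F] around [z'] and around [z], whose modulus on the
    circle is controlled by [F_lip]. *)
Let L1 := 2 * (2 * (2 * L0) / rho).

Let D_lip z z' w : nm (z - z0) < r / 4 -> nm (z' - z0) < r / 4 ->
  cabs ('D_w F z' - 'D_w F z) <= L1 * nm (z' - z) * nm w.
Proof.
move=> zr zr'.
have [zr1 zr1'] : nm (z - z0) < r /\ nm (z' - z0) < r by rlra.
have H w' : nm w' <= 1 -> cabs ('D_w' F z' - 'D_w' F z) <= L1 * nm (z' - z).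
  move=> w'1.
  have rw : rho * nm w' <= rho by rewrite ger_pMr.
  have cr y t : nm (y - z0) < r / 4 -> nm (y + (rho%:C * cis t) *: w' - z0) < r / 2.
    move=> yr; apply: le_lt_trans (shiftE _ _ _) _; rewrite cabs_rcis //.
    by move: rw; rewrite /rho; rlra.
  have cc y : nm (y - z0) < r / 4 ->
      continuous (fun t => F (y + (rho%:C * cis t) *: w') - F y).
    move=> yr t; apply: cvgB; last exact: cvg_cst.
    by apply: curve_cont => // t'; have := cr y t' yr; rlra.
  have DEy y : nm (y - z0) < r / 4 -> 'D_w' F y =
      circ_int rho (fun t => F (y + (rho%:C * cis t) *: w') - F y).
    by move=> yr; apply: DE => //; move: rw; rewrite /rho; rlra.
  rewrite !DEy // addrC -mulN1r -circ_int_lin //; try exact: cc.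
  rewrite (_ : L1 * nm (z' - z) = 2 * (2 * (2 * (L0 * nm (z' - z))) / rho)); last first.
    by rewrite /L1; ring.
  apply: circ_int_bound => //.
    move=> t; apply: cvgD; last exact: cc.
    by apply: cvgM; [exact: cvg_cst|exact: cc].
  move=> t; have h1 := F_lip (cr z t zr) (cr z' t zr').
  have h2 : cabs (F z' - F z) <= 2 * (L0 * nm (z' - z)) by apply: F_lip; rlra.
  have e1 : z' + (rho%:C * cis t) *: w' - (z + (rho%:C * cis t) *: w') = z' - z.
    by rewrite opprD addrACA subrr addr0.
  rewrite e1 in h1.
  rewrite mulN1r.
  set a := F (z' + _) in h1 *; set b := F (z + _) in h1 *.
  have -> : - (b - F z) + (a - F z') = (a - b) - (F z' - F z) by ring.
  by apply: (le_trans (cabsB _ _)); rlra.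
have [->|w0] := eqVneq w 0.
  by rewrite nm0 mulr0 !derive0 subrr cabs0 lexx.
have nw : 0 < nm w by rewrite nm_gt0.
have nwC : (nm w)%:C != 0 :> C by rewrite -cabs_eq0 cabsR normr_eq0 gt_eqF.
have [w1 w11 Ew] : exists2 w1, nm w1 <= 1 & w = (nm w)%:C *: w1.
  exists ((nm w)%:C^-1 *: w); last by rewrite scalerA divff // scale1r.
  by rewrite nmZ cabsV cabsR gtr0_norm // mulVf ?gt_eqF.
have E y : nm (y - z0) < r -> 'D_w F y = (nm w)%:C * 'D_w1 F y.
  by move=> yr; rewrite -(D_scale _ _ yr) -Ew.
rewrite (E z zr1) (E z' zr1') -mulrBr cabsM cabsR gtr0_norm // mulrC ler_pM2r //.
exact: H.
Qed.

Let L1_ge0 : 0 <= L1.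
Proof.
have M0 : 0 <= M by apply: (le_trans (cabs_ge0 (F z0))); apply: FM; rewrite subrr nm0 r0.
have rho_ge0 := ltW rho_gt0.
by rewrite /L1 /L0; do ?[apply: mulr_ge0 => //]; rewrite invr_ge0.
Qed.

(** Subtract the linear term along the segment: [g] has derivative ['D_w F (z + s w) - 'D_w F z],
    which is of order [|w|^2] by [D_lip]. *)
Let F_taylor z w : nm (z - z0) < r / 8 -> nm w < r / 8 ->
  cabs (F (z + w) - F z - 'D_w F z) <= 2 * (L1 * nm w ^+ 2).
Proof.
move=> zr wr.
pose g (s : C) := F (z + s *: w) - s * 'D_w F z.
pose D (s : C) := 'D_w F (z + s *: w) - 'D_w F z.
have sg (t : R) : 0 <= t <= 1 -> nm (z + t%:C *: w - z0) < r / 4.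
  move=> /andP[t0 t1]; apply: le_lt_trans (shiftE _ _ _) _; rewrite cabsR ger0_norm //.
  have : t * nm w <= nm w by rewrite ler_piMl ?nm_ge0.
  by rlra.
have -> : F (z + w) - F z - 'D_w F z = g 1 - g 0.
  by rewrite /g scale1r scale0r addr0 mul1r mul0r subr0; ring.
apply: (@cder_segment R g D) => t t01.
  have Fc : cder (fun s => F (z + s *: w)) t%:C ('D_w F (z + t%:C *: w)).
    by apply: slice_cder; apply: Fd; have := sg t t01; rlra.
  move=> e e0; have [dl dl0 H] := Fc e e0; exists dl => // s sdl.
  have -> : g s - g t%:C - D t%:C * (s - t%:C) =
      F (z + s *: w) - F (z + t%:C *: w) - 'D_w F (z + t%:C *: w) * (s - t%:C).
    rewrite /g /D; move: ('D_w F _) ('D_w F _) (F _) (F _) => a b c d.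
    by ring.
  exact: H.
have zr' : nm (z - z0) < r / 4 by rlra.
rewrite /D; apply: (le_trans (D_lip w zr' (sg t t01))).
rewrite addrAC subrr add0r nmZ cabsR expr2 [leRHS]mulrA.
apply: ler_wpM2r; first exact: nm_ge0.
apply: ler_wpM2l; first exact: L1_ge0.
have /andP[t0 t1] := t01.
by rewrite ger0_norm // ler_piMl ?nm_ge0.
Qed.

(** Differentiation under the integral sign in [DE]: the Taylor bound of [F] is uniform on the
    circle, so it passes to the integral as a quadratic remainder. *)
Lemma derive_differentiable v : differentiable ('D_v F) z0.
Proof.
have r16 : r / 16 < r by rlra.
(* Makes [rh |v| < r / 16], so that the circle around [z0], shifted by any [w] with [|w| < r / 16],
   stays where the estimates hold. The summand 1 covers [v = 0]. *)
pose rh := r / (16 * (nm v + 1)).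
have nv1 : 0 < nm v + 1 by rewrite ltr_wpDl ?nm_ge0.
have rh0 : 0 < rh by rewrite divr_gt0 // mulr_gt0.
have rhv : rh * nm v < r / 16.
  rewrite /rh invfM mulrA -mulrA mulrC -ltr_pdivlMr ?divr_gt0 // divff ?gt_eqF ?divr_gt0 //.
  by rewrite mulrC ltr_pdivrMr // mul1r ltrDl.
have zz : nm (z0 - z0) = 0 by rewrite subrr nm0.
pose pt t := z0 + (rh%:C * cis t) *: v.
have ptr t : nm (pt t - z0) < r / 16.
  by apply: le_lt_trans (shiftE _ _ _) _; rewrite zz add0r cabs_rcis.
have Bc w : continuous (fun t => 'D_w F (pt t) - 'D_w F z0).
  move=> t; apply: cvgB; last exact: cvg_cst.
  have ptc : pt t' @[t' --> t] --> pt t.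
    by apply: cvgD; [exact: cvg_cst|apply: cvgZr_tmp; exact: rcis_cont].
  apply/(@cvgC_cabs _ _ (nbhs t)) => e e0.
  set K := L1 * nm w + 1.
  have K0 : 0 < K by rewrite ltr_wpDl // mulr_ge0 ?nm_ge0.
  have near_pt : nbhs (pt t) [set y | nm (y - pt t) < e / K].
    by apply/near_nm; exists (e / K) => //; exact: divr_gt0.
  have : nbhs t (pt @^-1` [set y | nm (y - pt t) < e / K]) := ptc _ near_pt.
  apply: (@filterS _ (nbhs t)) => t' /= H.
  have : cabs ('D_w F (pt t') - 'D_w F (pt t)) <= L1 * nm (pt t' - pt t) * nm w.
    by apply: D_lip; [have := ptr t|have := ptr t']; rlra.
  move=> /le_lt_trans; apply; rewrite mulrAC.
  apply: (@le_lt_trans _ _ (K * nm (pt t' - pt t))).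
    by apply: ler_wpM2r; [exact: nm_ge0|rewrite /K; rlra].
  by rewrite mulrC -ltr_pdivlMr.
(* The candidate for the differential: the integrand of [DE] differentiated in direction [w]. *)
pose B w := circ_int rh (fun t => 'D_w F (pt t) - 'D_w F z0).
have Blin : linear B.
  move=> a w w'; rewrite -[a *: B w]/(a * B w) /B -circ_int_lin //.
  congr (circ_int _ _); apply/funext => t.
  have d1 : differentiable F (pt t) by apply: Fd; have := ptr t; rlra.
  have d0 : differentiable F z0 by apply: Fd; rewrite zz.
  rewrite !deriveE // !linearD !linearZ /=.
  move: ('d F _ _) ('d F _ _) ('d F _ _) ('d F _ _) => x1 x2 x3 x4.
  have sE (x : C) : a *: x = a * x by [].
  by rewrite !sE; ring.
pose Bl : {linear V -> C} := HB.pack B (GRing.isLinear.Build C V C *:%R B Blin).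
have L0_ge0 : 0 <= L0.
  have M0 : 0 <= M by apply: (le_trans (cabs_ge0 (F z0))); apply: FM; rewrite subrr nm0 r0.
  have rho_ge0 := ltW rho_gt0.
  by rewrite /L0; do ?[apply: mulr_ge0 => //]; rewrite invr_ge0.
(* [differentiable_quadratic] takes one constant: the first summand bounds the differential, the
   second the remainder. *)
pose K := 2 * (2 * L0 / rh) + 2 * (2 * (2 * L1) / rh).
apply: (@differentiable_quadratic R V _ _ Bl K (r / 16)).
- by rewrite divr_gt0.
- move=> w; rewrite /= /B; apply: (@le_trans _ _ (2 * (2 * (L0 * nm w) / rh))).
    apply: circ_int_bound => // t.
    have h1 : cabs ('D_w F z0) <= L0 * nm w by apply: D_bound; rewrite zz divr_gt0.
    have h2 : cabs ('D_w F (pt t)) <= L0 * nm w.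
      by apply: D_bound; have := ptr t; rlra.
    by apply: (le_trans (cabsB _ _)); rewrite [leRHS]mulr_natl mulr2n; exact: (lerD h2 h1).
  have -> : 2 * (2 * (L0 * nm w) / rh) = 2 * (2 * L0 / rh) * nm w by ring.
  apply: ler_wpM2r; first exact: nm_ge0.
  by rewrite /K lerDl; do ?[apply: mulr_ge0 => //]; rewrite invr_ge0 ltW.
move=> w wr; rewrite /= /B.
have cw : continuous (fun t => F (w + z0 + (rh%:C * cis t) *: v) - F (w + z0)).
  move=> t; apply: cvgB; last exact: cvg_cst.
  apply: curve_cont => // t'; apply: le_lt_trans (shiftE _ _ _) _.
  by rewrite addrK cabs_rcis //; rlra.
have c0 : continuous (fun t => F (z0 + (rh%:C * cis t) *: v) - F z0).
  move=> t; apply: cvgB; last exact: cvg_cst.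
  by apply: curve_cont; [exact: rcis_cont|move=> t'; exact: lt_trans (ptr t') r16].
rewrite (@DE (w + z0) v rh) //; last by rewrite addrK; rlra.
rewrite (@DE z0 v rh) //; last by rewrite zz; rlra.
set c1 := circ_int _ _; set c2 := circ_int _ _; set c3 := circ_int _ _.
have -> : c1 - c2 - c3 = (-1) * c3 + ((-1) * c2 + c1) by ring.
rewrite /c1 /c2 /c3 -(circ_int_lin (-1) rh0 c0 cw).
have cs : continuous (fun t => -1 * (F (z0 + (rh%:C * cis t) *: v) - F z0) +
   (F (w + z0 + (rh%:C * cis t) *: v) - F (w + z0))).
  by move=> t; apply: cvgD; [apply: cvgM; [exact: cvg_cst|exact: c0]|exact: cw].
rewrite -(circ_int_lin (-1) rh0 (Bc w) cs).
apply: (@le_trans _ _ (2 * (2 * (2 * (L1 * nm w ^+ 2)) / rh))).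
  apply: circ_int_bound; first exact: rh0.
    by move=> t; apply: cvgD; [apply: cvgM; [exact: cvg_cst|exact: Bc]|exact: cs].
  move=> t.
  have h1 : cabs (F (pt t + w) - F (pt t) - 'D_w F (pt t)) <= 2 * (L1 * nm w ^+ 2).
    by apply: F_taylor; have := ptr t; rlra.
  have h2 : cabs (F (z0 + w) - F z0 - 'D_w F z0) <= 2 * (L1 * nm w ^+ 2).
    by apply: F_taylor; rewrite ?zz; rlra.
  have -> : w + z0 + (rh%:C * cis t) *: v = pt t + w by rewrite /pt -addrA addrC.
  rewrite -/(pt t) [w + z0]addrC.
  have -> : -1 * ('D_w F (pt t) - 'D_w F z0) + (-1 * (F (pt t) - F z0) + (F (pt t + w) - F (z0 + w)))
    = (F (pt t + w) - F (pt t) - 'D_w F (pt t)) - (F (z0 + w) - F z0 - 'D_w F z0).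
    move: ('D_w F (pt t)) ('D_w F z0) (F (pt t + w)) (F (pt t)) (F (z0 + w)) (F z0).
    by move=> x1 x2 x3 x4 x5 x6; ring.
  by apply: (le_trans (cabsB _ _)); rewrite [leRHS]mulr_natl mulr2n; exact: (lerD h1 h2).
have -> : 2 * (2 * (2 * (L1 * nm w ^+ 2)) / rh) = 2 * (2 * (2 * L1) / rh) * nm w ^+ 2 by ring.
apply: ler_wpM2r; first exact: sqr_ge0.
by rewrite /K lerDr; do ?[apply: mulr_ge0 => //]; rewrite invr_ge0 ltW.
Qed.

End DerivativeHolomorphic.

(** * Differentiability depends only on germs; chain rule *)

Section Germs.
Variable R : realType.
Local Notation C := (Cplx R).
Variable V : normedModType C.

Lemma near_eq_differentiable (f g : V -> C) (x : V) :
  (\forall y \near x, f y = g y) -> differentiable f x -> differentiable g x.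
Proof.
move=> /near_nm[e e0 fg] fd.
have [dc E] := (diff_locallyP _ _).1 fd.
have fgx : f x = g x by apply: fg; rewrite subrr nm0.
have E' : g \o shift x = cst (g x) + 'd f x +o_ 0 id.
  apply/eqaddoP => eps eps0; have /eqaddoP/(_ eps eps0)/near_nm[e1 e10 H] := E.
  apply/near_nm; exists (Num.min e e1); first by rewrite lt_min e0.
  move=> w; rewrite subr0 lt_min => /andP[we we1].
  have := H w; rewrite subr0 => /(_ we1).
  by rewrite !fctE /= -fgx fg // addrK.
by have D := diff_unique dc E'; apply/diff_locallyP; rewrite D; split.
Qed.

Lemma cder_differentiable (g : C -> C) (s A : C) : cder g s A -> differentiable g s.
Proof. by move=> /cderP[gd _]; apply/derivable1_diffP. Qed.

Lemma derive_comp (F : V -> C) (g : C -> C) (z v : V) (A : C) :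
  differentiable F z -> cder g (F z) A -> 'D_v (g \o F) z = A * 'D_v F z.
Proof.
move=> Fd gA.
have := @slice_cder R V F z v 0; rewrite scale0r addr0 => /(_ Fd) Fs.
have gA' : cder g ((fun s : C => F (z + s *: v)) 0) A by rewrite scale0r addr0.
have /cder_cvg H := cder_comp Fs gA'.
apply: cvg_lim => //; move: H; apply: cvg_trans; apply: near_eq_cvg.
near=> h => /=.
by rewrite [h *: 1]mulr1 addr0 scale0r addr0 [z + _]addrC.
Unshelve. all: by end_near. Qed.

End Germs.

(* Locked, since comparing [Rd u x] with [Rd v x] would otherwise unfold the
   derivatives. *)
HB.lock Definition Rd (R : realType) (d : nat) (u : unit_ball R d -> Cplx R) :
    unit_ball R d -> Cplx R :=
  fun x => radial_derivative (extend0 u) (val x).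

(** * Holomorphic functions on the ball and the radial derivative *)

Section BallFunctions.
Variables (R : realType) (d : nat).
Local Notation C := (Cplx R).
Local Notation V := 'rV[C]_d.
Local Notation B := (unit_ball R d).
Implicit Types (u v : B -> C) (z : V).

Lemma extend0_val u (x : B) : extend0 u (val x) = u x.
Proof. by have := valLK 0 u; move=> /(congr1 (fun f => f x)). Qed.

Lemma ball_val z : B z -> exists x : B, val x = z.
Proof. by move=> /mem_set Bz; exists (SigSub Bz). Qed.

Lemma val_ball (x : B) : B (val x).
Proof. exact: set_valP. Qed.

Lemma unit_ballP z : B z <-> \sum_(j < d) cabs (z 0 j) ^+ 2 < 1.
Proof.
rewrite /unit_ball /=.
have -> : \sum_(j < d) `|z 0 j| ^+ 2 = (\sum_(j < d) cabs (z 0 j) ^+ 2)%:C.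
  rewrite rmorph_sum /=; apply: eq_bigr => j _.
  by rewrite normCabs rmorphXn.
by rewrite -(ltcR _ 1).
Qed.

Lemma cabs_continuous : continuous (@cabs R).
Proof.
have -> : @cabs R = @complex.Re R \o (fun y : C => `|y|).
  by apply/funext => y; rewrite /comp normCabs.
move=> x; apply: continuous_comp; first exact: (@norm_continuous C C).
exact: Re_continuous.
Qed.

Lemma sqnorm_continuous : continuous (fun z : V => \sum_(j < d) cabs (z 0 j) ^+ 2).
Proof.
have cvg_sumR (T : Type) (A : set_system T) (FA : Filter A) (f : 'I_d -> T -> R) (a : 'I_d -> R) :
    (forall j, f j t @[t --> A] --> a j) -> \sum_(j < d) f j t @[t --> A] --> \sum_(j < d) a j.
  by move=> fa; apply: cvg_big => //; exact: add_continuous.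
move=> z; apply: (cvg_sumR V (nbhs z)) => j.
have cj : cabs (y 0 j) @[y --> z] --> cabs (z 0 j).
  apply: (@continuous_comp _ _ _ (fun z : V => z 0 j) (@cabs R) z).
    exact: coord_continuous.
  exact: cabs_continuous.
by rewrite expr2; under eq_fun do rewrite expr2; exact: cvgM.
Qed.

Lemma open_unit_ball : open B.
Proof.
have -> : B = (fun z : V => \sum_(j < d) cabs (z 0 j) ^+ 2) @^-1` [set x | x < 1].
  by apply/seteqP; split => z /unit_ballP.
by apply: open_comp; [move=> z _; exact: sqnorm_continuous|exact: open_lt].
Qed.

Lemma near_ball z : B z -> \forall y \near z, B y.
Proof. by move=> Bz; exact: open_nbhs_nbhs (conj open_unit_ball Bz). Qed.

Lemma germ_differentiable (F : V -> C) u z :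
  (forall x : B, F (val x) = u x) -> B z -> differentiable F z ->
  differentiable (extend0 u) z.
Proof.
move=> Fu Bz; apply: near_eq_differentiable; apply: filterS (near_ball Bz) => y.
by move=> /ball_val[x <-]; rewrite extend0_val.
Qed.

Lemma germ_radial (F G : V -> C) z : (forall y, B y -> F y = G y) -> B z ->
  radial_derivative F z = radial_derivative G z.
Proof.
move=> FG Bz.
have H : \forall y \near z, F y = G y by apply: filterS (near_ball Bz) => y /FG.
by rewrite /radial_derivative; apply: eq_bigr => j _; rewrite (near_eq_derive _ H).
Qed.

(** [Rd] restricts to the ball after every step, whereas [radial_derivative] iterates on total
    functions. Inside the open ball they agree because derivatives are local. *)
Lemma iter_radial_Rd n u z : B z ->
  iter n (@radial_derivative R d) (extend0 u) z = extend0 (iter n (@Rd R d) u) z.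
Proof.
elim: n z => [//|n IH] z Bz; rewrite !iterS (germ_radial IH Bz).
by have [x <-] := ball_val Bz; rewrite extend0_val Rd.unlock.
Qed.

Lemma hol_val (F : V -> C) u : (forall x : B, F (val x) = u x) ->
  (forall z, B z -> differentiable F z) -> hol R d u.
Proof. by move=> Fu Fd z Bz; apply: germ_differentiable Fu Bz (Fd z Bz). Qed.

Lemma RdE (F : V -> C) u x : (forall x : B, F (val x) = u x) ->
  Rd u x = radial_derivative F (val x).
Proof.
move=> Fu; rewrite Rd.unlock; apply: germ_radial (val_ball x) => y /ball_val[x' <-].
by rewrite extend0_val Fu.
Qed.

Lemma hol_cst (c : C) : hol R d (fun=> c).
Proof. by apply: (@hol_val (cst c)) => // z _; exact: differentiable_cst. Qed.

Lemma holD u v : hol R d u -> hol R d v -> hol R d (fun x => u x + v x).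
Proof.
move=> hu hv; apply: (@hol_val (extend0 u + extend0 v)).
  by move=> x; rewrite fctE !extend0_val.
by move=> z Bz; apply: differentiableD; [exact: hu|exact: hv].
Qed.

Lemma holM u v : hol R d u -> hol R d v -> hol R d (fun x => u x * v x).
Proof.
move=> hu hv; apply: (@hol_val (extend0 u * extend0 v)).
  by move=> x; rewrite fctE !extend0_val.
by move=> z Bz; apply: differentiableM; [exact: hu|exact: hv].
Qed.

Lemma hol_comp u (g : C -> C) : hol R d u -> (forall x, exists A, cder g (u x) A) ->
  hol R d (fun x => g (u x)).
Proof.
move=> hu gd; apply: (@hol_val (g \o extend0 u)).
  by move=> x /=; rewrite extend0_val.
move=> z Bz; apply: differentiable_comp; first exact: hu.
have [x <-] := ball_val Bz; rewrite extend0_val.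
by have [A /cder_differentiable] := gd x.
Qed.

Lemma RdD u v x : hol R d u -> hol R d v ->
  Rd (fun x => u x + v x) x = Rd u x + Rd v x.
Proof.
move=> hu hv; rewrite (@RdE (extend0 u + extend0 v)); last first.
  by move=> y; rewrite fctE !extend0_val.
have [du dv] := (hu _ (val_ball x), hv _ (val_ball x)).
rewrite Rd.unlock -big_split /=; apply: eq_bigr => j _.
by rewrite deriveD ?mulrDr //; exact: diff_derivable.
Qed.

Lemma RdM u v x : hol R d u -> hol R d v ->
  Rd (fun x => u x * v x) x = Rd u x * v x + u x * Rd v x.
Proof.
move=> hu hv; rewrite (@RdE (extend0 u * extend0 v)); last first.
  by move=> y; rewrite fctE !extend0_val.
have [du dv] := (hu _ (val_ball x), hv _ (val_ball x)).
rewrite Rd.unlock /radial_derivative mulr_suml mulr_sumr -big_split /=; apply: eq_bigr => j _.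
rewrite deriveM; [|exact: diff_derivable..].
rewrite !extend0_val.
move: ('D_ _ (extend0 u) _) ('D_ _ (extend0 v) _) (val x 0 j) => a b c.
by rewrite -[_ *: b]/(_ * b) -[_ *: a]/(_ * a); ring.
Qed.

Lemma Rd_cst (c : C) (x : B) : Rd (fun=> c) x = 0.
Proof.
rewrite (@RdE (cst c)) // /radial_derivative big1 // => j _.
by rewrite derive_cst mulr0.
Qed.

Lemma Rd_comp u (g : C -> C) (A : C) x : hol R d u -> cder g (u x) A ->
  Rd (fun x => g (u x)) x = A * Rd u x.
Proof.
move=> hu gA; rewrite (@RdE (g \o extend0 u)); last first.
  by move=> y /=; rewrite extend0_val.
rewrite Rd.unlock /radial_derivative mulr_sumr; apply: eq_bigr => j _.
rewrite (@derive_comp _ _ _ _ _ _ A); first by rewrite mulrCA.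
  exact: (hu _ (val_ball x)).
by rewrite extend0_val.
Qed.

(** Continuity bounds [u] near [z], and a local bound is what the Cauchy estimates behind
    [derive_differentiable] start from. *)
Lemma hol_Rd u : hol R d u -> hol R d (Rd u).
Proof.
move=> hu; rewrite Rd.unlock.
apply: (@hol_val (radial_derivative (extend0 u))) => // z Bz.
have /near_nm[r1 r10 Br] := near_ball Bz.
have dz := hu z Bz.
have /near_nm[r2 r20 Fr] : \forall y \near z, cabs (extend0 u y) <= cabs (extend0 u z) + 1.
  have cc : cabs (extend0 u y) @[y --> z] --> cabs (extend0 u z).
    apply: (@continuous_comp _ _ _ (extend0 u) (@cabs R) z).
      exact: differentiable_continuous.
    exact: cabs_continuous.
  have /(@cvgrPdist_lt _ _ _ (nbhs z))/(_ 1 ltr01) H := cc.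
  apply: (@filterS _ (nbhs z)) H => y /=.
  by rewrite ltr_norml => /andP[? ?]; lra.
set r := Num.min r1 r2.
have r0 : 0 < r by rewrite lt_min r10.
have H1 y : nm (y - z) < r -> differentiable (extend0 u) y.
  by rewrite lt_min => /andP[/Br By _]; exact: hu.
have H2 y : nm (y - z) < r -> cabs (extend0 u y) <= cabs (extend0 u z) + 1.
  by rewrite lt_min => /andP[_ /Fr].
have Dj j : differentiable ('D_(delta_mx 0 j) (extend0 u)) z.
  exact: (derive_differentiable r0 H1 H2).
have -> : radial_derivative (extend0 u) =
    \sum_(j < d) ((fun z : V => z 0 j) * 'D_(delta_mx 0 j) (extend0 u)).
  by apply/funext => y; rewrite fct_sumE.
apply: differentiable_sum => j; apply: differentiableM; last exact: Dj.
exact: differentiable_coord.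
Qed.

End BallFunctions.

(** * The square norm in L^2(omega), including the Hardy term *)

Section IntegralBounds.
Context {dd : measure_display} {T : measurableType dd} {R : realType}.
Variables (nu : {measure set T -> \bar R}) (D : set T) (mD : measurable D).
Local Open Scope ereal_scope.

Lemma ge0_integral_scale_le (f g : T -> \bar R) (k : R) : (0 <= k)%R ->
  (forall x, 0 <= f x) -> (forall x, 0 <= g x) ->
  measurable_fun D f -> measurable_fun D g ->
  (forall x, D x -> f x <= k%:E * g x) ->
  \int[nu]_(x in D) f x <= k%:E * \int[nu]_(x in D) g x.
Proof.
move=> k0 f0 g0 mf mg fg.
rewrite -(@ge0_integralZl_EFin _ _ _ nu D mD g (fun x _ => g0 x) mg k k0).
by apply: ge0_le_integral => // ; exact: measurable_funeM.
Qed.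

Lemma ge0_integral_add_le (f g h : T -> \bar R) :
  (forall x, 0 <= f x) -> (forall x, 0 <= g x) -> (forall x, 0 <= h x) ->
  measurable_fun D f -> measurable_fun D g -> measurable_fun D h ->
  (forall x, D x -> f x <= 2%:E * g x + 2%:E * h x) ->
  \int[nu]_(x in D) f x <= 2%:E * \int[nu]_(x in D) g x + 2%:E * \int[nu]_(x in D) h x.
Proof.
move=> f0 g0 h0 mf mg mh fgh.
have mg2 : measurable_fun D (fun x => 2%:E * g x) by exact: measurable_funeM.
have mh2 : measurable_fun D (fun x => 2%:E * h x) by exact: measurable_funeM.
have g20 x : D x -> 0 <= 2%:E * g x by rewrite mule_ge0.
have h20 x : D x -> 0 <= 2%:E * h x by rewrite mule_ge0.
rewrite -(@ge0_integralZl_EFin _ _ _ nu D mD g (fun x _ => g0 x) mg 2%R) //.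
rewrite -(@ge0_integralZl_EFin _ _ _ nu D mD h (fun x _ => h0 x) mh 2%R) //.
rewrite -(@ge0_integralD _ _ _ nu D mD _ _ g20 mg2 h20 mh2).
by apply: ge0_le_integral => //; exact: emeasurable_funD.
Qed.

End IntegralBounds.

Section SquareIntegrable.
Variables (R : realType) (d : nat).
Local Notation C := (Cplx R).
Local Notation V := 'rV[C]_d.
Local Notation B := (unit_ball R d).
Variables (sigma : probability (borelCd R d) R)
  (mu : {finite_measure set R -> \bar R})
  (omega : {measure set (borelCd R d) -> \bar R}).
Hypothesis adm : admissible_radial sigma mu omega.
Implicit Types (u v : B -> C).

Lemma open_measurable_borelCd (U : set V) : open U -> measurable (U : set (borelCd R d)).
Proof. by move=> Uo; exact: sub_sigma_algebra. Qed.

Lemma continuous_measurable_borelCd (U : set V) (g : V -> R) : open U ->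
  (forall z, U z -> {for z, continuous g}) ->
  measurable_fun (U : set (borelCd R d)) (g : borelCd R d -> R).
Proof.
move=> Uo gc; apply: (measurability _ (RGenOInfty.measurableE R)).
move=> _ [_ [x ->] <-]; apply: open_measurable_borelCd.
rewrite openE => z [Uz gz]; rewrite /interior.
apply: (@filterS2 _ (nbhs z) _ U (g @^-1` `]x, +oo[%classic)) => //.
  exact: open_nbhs_nbhs (conj Uo Uz).
apply: (gc z Uz); apply: open_nbhs_nbhs; split => //.
Qed.

Lemma measurable_unit_ball : measurable (B : set (borelCd R d)).
Proof. by apply: open_measurable_borelCd; exact: open_unit_ball. Qed.

Lemma unit_sphereP (z : V) : unit_sphere R d z <-> \sum_(j < d) cabs (z 0 j) ^+ 2 = 1.
Proof.
rewrite /unit_sphere /=.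
have -> : \sum_(j < d) `|z 0 j| ^+ 2 = (\sum_(j < d) cabs (z 0 j) ^+ 2)%:C.
  rewrite rmorph_sum /=; apply: eq_bigr => j _.
  by rewrite normCabs rmorphXn.
by split => [/complexI|->].
Qed.

Lemma measurable_unit_sphere : measurable (unit_sphere R d : set (borelCd R d)).
Proof.
rewrite -[unit_sphere R d]setCK; apply: measurableC; apply: open_measurable_borelCd.
have -> : ~` unit_sphere R d =
   (fun z : V => \sum_(j < d) cabs (z 0 j) ^+ 2) @^-1` [set x | x != 1].
  apply/seteqP; split => z /=; first by move=> zs; apply/eqP => /unit_sphereP.
  by move=> /eqP z1 /unit_sphereP.
apply: open_comp; last exact: open_neq.
by move=> z _; exact: sqnorm_continuous.
Qed.

Lemma sphere_ball (r : R) (w : V) : 0 < r < 1 -> unit_sphere R d w -> B (r%:C *: w).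
Proof.
move=> /andP[r0 r1] /unit_sphereP ws; apply/unit_ballP.
rewrite (eq_bigr (fun j => r ^+ 2 * cabs (w 0 j) ^+ 2)); last first.
  by move=> j _; rewrite mxE cabsM cabsR exprMn real_normK ?num_real.
by rewrite -mulr_sumr ws mulr1 expr_lt1 // ltW.
Qed.

Let sq u (z : V) : R := cabs (extend0 u z) ^+ 2.

Let sq_cont u z : hol R d u -> B z -> {for z, continuous (sq u)}.
Proof.
move=> hu Bz.
have cc : cabs (extend0 u y) @[y --> z] --> cabs (extend0 u z).
  apply: (@continuous_comp _ _ _ (extend0 u) (@cabs R) z).
    exact/differentiable_continuous/hu.
  exact: cabs_continuous.
have -> : sq u = (fun y => cabs (extend0 u y) * cabs (extend0 u y)).
  by apply/funext => y; rewrite /sq expr2.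
exact: (cvgM cc cc).
Qed.

Let sq_meas u : hol R d u ->
  measurable_fun (B : set (borelCd R d)) (fun z : borelCd R d => (sq u z)%:E).
Proof.
move=> hu; apply/measurable_EFinP; apply: continuous_measurable_borelCd.
  exact: open_unit_ball.
by move=> z; exact: sq_cont.
Qed.

Let sq_meas_sphere u (r : R) : 0 < r < 1 -> hol R d u ->
  measurable_fun (unit_sphere R d : set (borelCd R d))
    (fun w : borelCd R d => (sq u (r%:C *: (w : V)))%:E).
Proof.
move=> r01 hu; apply/measurable_EFinP.
pose S (w : V) : V := (r%:C : C) *: w.
have sc : continuous S by exact: scaler_continuous.
have Uo : open (S @^-1` B).
  by apply: open_comp; [move=> w _; exact: sc|exact: open_unit_ball].
apply: (@measurable_funS _ _ _ _ (S @^-1` B : set (borelCd R d))).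
- exact: open_measurable_borelCd.
- by move=> w; exact: sphere_ball.
apply: continuous_measurable_borelCd => // w Bw.
apply: (@continuous_comp _ _ _ S (sq u) w); first exact: sc.
exact: sq_cont.
Qed.

Definition En u : \bar R := L2_normsq sigma mu omega (extend0 u).

Let sq_ge0 u z : (0 <= (sq u z)%:E)%E.
Proof. by rewrite lee_fin exprn_ge0 // cabs_ge0. Qed.

Let hardy_ge0 u : (0 <= hardy_normsq sigma (extend0 u))%E.
Proof.
have h : (1 / 2 : R) \in `]0%R, 1%R[ by rewrite in_itv /=; lra.
apply: (le_trans _ (ereal_sup_ubound _)); last by exists (1 / 2).
by apply: integral_ge0 => w _; exact: sq_ge0.
Qed.

Lemma En_ge0 u : (0 <= En u)%E.
Proof.
apply: adde_ge0; first by apply: integral_ge0 => z _; exact: sq_ge0.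
by rewrite mule_ge0 // hardy_ge0.
Qed.

(** Domination inside the ball also controls the Hardy term, which is a supremum over spheres of
    radius less than 1. *)
Lemma En_le u v (K : R) : hol R d u -> hol R d v -> 0 <= K ->
  (forall x, cabs (u x) <= K * cabs (v x)) -> (En u <= (K ^+ 2)%:E * En v)%E.
Proof.
move=> hu hv K0 uv.
have uvz z : B z -> ((sq u z)%:E <= (K ^+ 2)%:E * (sq v z)%:E)%E.
  move=> /ball_val[x <-]; rewrite -EFinM lee_fin /sq !extend0_val -exprMn.
  by rewrite lerXn2r ?nnegrE ?mulr_ge0 ?cabs_ge0.
have K2 : 0 <= K ^+ 2 by exact: exprn_ge0.
rewrite /En /L2_normsq ge0_muleDr; last 2 first.
- by apply: integral_ge0 => z _; exact: sq_ge0.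
- by rewrite mule_ge0 // hardy_ge0.
apply: leeD.
  apply: ge0_integral_scale_le; [exact: measurable_unit_ball|exact: K2| | | | |exact: uvz].
  - by move=> z; exact: sq_ge0.
  - by move=> z; exact: sq_ge0.
  - exact: sq_meas.
  - exact: sq_meas.
rewrite muleCA; apply: lee_wpmul2l => //.
apply: ge_ereal_sup => _ [r /= r01 <-].
have r01' : 0 < r < 1 by move: r01; rewrite in_itv.
apply: (@le_trans _ _ ((K ^+ 2)%:E * \int[sigma]_(w in unit_sphere R d)
   (sq v (r%:C *: (w : V)))%:E)%E); last first.
  apply: lee_wpmul2l => //.
  by apply: ereal_sup_ubound; exists r.
apply: ge0_integral_scale_le; [exact: measurable_unit_sphere|exact: K2| | | | |].
- by move=> w; exact: sq_ge0.
- by move=> w; exact: sq_ge0.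
- exact: sq_meas_sphere.
- exact: sq_meas_sphere.
by move=> w ws; apply: uvz; exact: sphere_ball.
Qed.

(** The pointwise inequality [(a + b)^2 <= 2 a^2 + 2 b^2] replaces Minkowski's, so no square roots
    of extended reals occur. *)
Lemma En_add u v : hol R d u -> hol R d v ->
  (En (fun x => (u x + v x)%R) <= 2%:E * En u + 2%:E * En v)%E.
Proof.
move=> hu hv; have huv := holD hu hv.
have uvz z : B z -> ((sq (fun x => u x + v x)%R z)%:E <= 2%:E * (sq u z)%:E + 2%:E * (sq v z)%:E)%E.
  move=> /ball_val[x <-]; rewrite -!EFinM -EFinD lee_fin /sq !extend0_val.
  have := cabsD (u x) (v x); have := cabs_ge0 (u x + v x).
  have := cabs_ge0 (u x); have := cabs_ge0 (v x).
  move: (cabs (u x + v x)) (cabs (u x)) (cabs (v x)) => c a b b0 a0 c0 cab.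
  apply: (@le_trans _ _ ((a + b) ^+ 2)); first by apply: lerXn2r; rewrite ?nnegrE //; lra.
  have := sqr_ge0 (a - b); rewrite !expr2; lra.
have i0 w : (0 <= \int[omega]_(z in B) (sq w z)%:E)%E by apply: integral_ge0 => z _; exact: sq_ge0.
have h0 w : (0 <= mu [set 1%R] * hardy_normsq sigma (extend0 w))%E by rewrite mule_ge0 // hardy_ge0.
rewrite /En /L2_normsq.
rewrite (@ge0_muleDr _ 2%:E _ _ (i0 u) (h0 u)) (@ge0_muleDr _ 2%:E _ _ (i0 v) (h0 v)).
rewrite addeACA; apply: leeD.
  apply: ge0_integral_add_le; [exact: measurable_unit_ball| | | | | | |exact: uvz].
  - by move=> z; exact: sq_ge0.
  - by move=> z; exact: sq_ge0.
  - by move=> z; exact: sq_ge0.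
  - exact: sq_meas.
  - exact: sq_meas.
  - exact: sq_meas.
rewrite !(muleCA 2%:E) -ge0_muleDr ?mule_ge0 ?hardy_ge0 //; apply: lee_wpmul2l => //.
apply: ge_ereal_sup => _ [r /= r01 <-].
have r01' : 0 < r < 1 by move: r01; rewrite in_itv.
apply: (@le_trans _ _ (2%:E * \int[sigma]_(w in unit_sphere R d) (sq u (r%:C *: (w : V)))%:E
   + 2%:E * \int[sigma]_(w in unit_sphere R d) (sq v (r%:C *: (w : V)))%:E)%E); last first.
  by apply: leeD; apply: lee_wpmul2l => //; apply: ereal_sup_ubound; exists r.
apply: ge0_integral_add_le; [exact: measurable_unit_sphere| | | | | | |].
- by move=> w; exact: sq_ge0.
- by move=> w; exact: sq_ge0.
- by move=> w; exact: sq_ge0.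
- exact: sq_meas_sphere.
- exact: sq_meas_sphere.
- exact: sq_meas_sphere.
by move=> w ws; apply: uvz; exact: sphere_ball.
Qed.

Lemma omega_fin (A : set (borelCd R d)) : measurable A -> (omega A < +oo)%E.
Proof.
move=> mA; apply: (@le_lt_trans _ _ (omega setT)).
  by apply: le_measure; rewrite ?inE //; exact: measurableT.
have [_ _ om] := adm; rewrite om; last exact: measurableT.
under eq_integral do rewrite probability_setT.
rewrite integral_cst //= mul1e.
apply: (@le_lt_trans _ _ (mu setT)); first by apply: le_measure; rewrite ?inE.
by rewrite -ge0_fin_numE // fin_num_measure.
Qed.

Lemma En_cst (c : C) : (En (fun=> c) < +oo)%E.
Proof.
have cz z : B z -> (cabs (extend0 (fun=> c) z) ^+ 2 = cabs c ^+ 2)%R.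
  by move=> /ball_val[x <-]; rewrite extend0_val.
apply: lte_add_pinfty.
  rewrite (eq_integral (cst (cabs c ^+ 2)%:E)); last first.
    by move=> z; rewrite inE => Bz; rewrite cz.
  rewrite integral_cst; last exact: measurable_unit_ball.
  by apply: lte_mul_pinfty => //; [rewrite lee_fin exprn_ge0 ?cabs_ge0|by apply: omega_fin; exact: measurable_unit_ball].
apply: lte_mul_pinfty => //.
  by rewrite fin_num_measure.
apply: (@le_lt_trans _ _ (cabs c ^+ 2)%:E); last exact: ltry.
apply: ge_ereal_sup => _ [r /= r01 <-].
have r01' : 0 < r < 1 by move: r01; rewrite in_itv.
rewrite (eq_integral (cst (cabs c ^+ 2)%:E)); last first.
  by move=> z; rewrite inE => sz; rewrite cz //; exact: sphere_ball.
rewrite integral_cst; last exact: measurable_unit_sphere.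
rewrite -[leRHS]mule1; apply: lee_wpmul2l; first by rewrite lee_fin exprn_ge0 ?cabs_ge0.
by apply: probability_le1; exact: measurable_unit_sphere.
Qed.

End SquareIntegrable.

(** * Radial derivatives of [F(p, q) h] *)

Section Leibniz.
Variables (R : realType) (d : nat).
Local Notation C := (Cplx R).
Local Notation B := (unit_ball R d).
Implicit Types (u v : B -> C).

Lemma hol_ext u v : u =1 v -> hol R d u -> hol R d v.
Proof. by move=> /funext ->. Qed.

Lemma Rd_ext u v x : u =1 v -> Rd u x = Rd v x.
Proof. by move=> /funext ->. Qed.

Lemma holZ (c : C) u : hol R d u -> hol R d (fun x => c * u x).
Proof. by move=> hu; apply: holM => //; exact: hol_cst. Qed.

Lemma holN u : hol R d u -> hol R d (fun x => - u x).
Proof. by move=> /(holZ (-1)); apply: hol_ext => x; rewrite mulN1r. Qed.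

Lemma holB u v : hol R d u -> hol R d v -> hol R d (fun x => u x - v x).
Proof. by move=> hu hv; apply: holD => //; exact: holN. Qed.

Lemma RdZ (c : C) u x : hol R d u -> Rd (fun x => c * u x) x = c * Rd u x.
Proof. by move=> hu; rewrite RdM ?Rd_cst ?mul0r ?add0r //; exact: hol_cst. Qed.

Lemma RdN u x : hol R d u -> Rd (fun x => - u x) x = - Rd u x.
Proof.
move=> hu; rewrite -[RHS]mulN1r -(RdZ (-1) x hu).
by apply: Rd_ext => y; rewrite mulN1r.
Qed.

Lemma RdB u v x : hol R d u -> hol R d v ->
  Rd (fun x => u x - v x) x = Rd u x - Rd v x.
Proof. by move=> hu hv; rewrite RdD ?RdN //; exact: holN. Qed.

Lemma holX u n : hol R d u -> hol R d (fun x => u x ^+ n).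
Proof.
move=> hu; elim: n => [|n IH].
  by apply: hol_ext (hol_cst 1) => x; rewrite expr0.
by apply: hol_ext (holM hu IH) => x; rewrite exprS.
Qed.

Lemma RdX u n x : hol R d u -> Rd (fun x => u x ^+ n) x = n%:R * u x ^+ n.-1 * Rd u x.
Proof.
move=> hu; elim: n => [|n IH].
  by rewrite (@Rd_ext _ (fun=> 1)) ?Rd_cst ?mul0r // => y; rewrite expr0.
rewrite (@Rd_ext _ (fun x => u x * u x ^+ n)); last by move=> y; rewrite exprS.
rewrite RdM //; last exact: holX.
rewrite IH; case: n {IH} => [|n]; first by rewrite expr0 mul0r mul0r mulr0 addr0 mulr1 mul1r mul1r.
by rewrite /= -[n.+2%:R]natr1 exprS; ring.
Qed.

Lemma hol_sum (I : Type) (s : seq I) (P : pred I) (F : I -> B -> C) :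
  (forall i, P i -> hol R d (F i)) -> hol R d (fun x => \sum_(i <- s | P i) F i x).
Proof.
move=> hF; elim: s => [|i s IH].
  by apply: hol_ext (hol_cst 0) => x; rewrite big_nil.
case Pi: (P i).
  by apply: hol_ext (holD (hF i Pi) IH) => x; rewrite big_cons Pi.
by apply: hol_ext IH => x; rewrite big_cons Pi.
Qed.

Lemma Rd_sum (I : Type) (s : seq I) (F : I -> B -> C) x :
  (forall i, hol R d (F i)) ->
  Rd (fun x => \sum_(i <- s) F i x) x = \sum_(i <- s) Rd (F i) x.
Proof.
move=> hF; elim: s => [|i s IH].
  by rewrite (@Rd_ext _ (fun=> 0)) ?Rd_cst ?big_nil // => y; rewrite big_nil.
rewrite (@Rd_ext _ (fun x => F i x + \sum_(i <- s) F i x)); last first.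
  by move=> y; rewrite big_cons.
by rewrite RdD // ?big_cons ?IH //; exact: hol_sum.
Qed.

Lemma hol_iter_Rd n u : hol R d u -> hol R d (iter n (@Rd R d) u).
Proof. by move=> hu; elim: n => [//|n IH]; rewrite iterS; exact: hol_Rd. Qed.

Section Expansion.
Variables (p q h : B -> C).
Hypotheses (hp : hol R d p) (hq : hol R d q) (hh : hol R d h).

(* [Ex n k l] is the coefficient of the (k, l)-th partial derivative of F in
   the n-th radial derivative of F(p, q) h. *)
Fixpoint Ex (n k l : nat) : B -> C :=
  if n is n'.+1 then
    fun x => Rd (Ex n' k l) x + (if k is k'.+1 then Rd p x * Ex n' k' l x else 0)
             + (if l is l'.+1 then Rd q x * Ex n' k l' x else 0)
  else if (k == 0%N) && (l == 0%N) then h else (fun=> 0).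

Lemma ExS n k l x : Ex n.+1 k l x =
  Rd (Ex n k l) x + (if k is k'.+1 then Rd p x * Ex n k' l x else 0)
  + (if l is l'.+1 then Rd q x * Ex n k l' x else 0).
Proof. by []. Qed.

Lemma Ex0 k l x : Ex 0 k l x = if (k == 0%N) && (l == 0%N) then h x else 0.
Proof. by rewrite /=; case: ifP. Qed.

Lemma hol_Ex n k l : hol R d (Ex n k l).
Proof.
elim: n k l => [|n IH] k l /=.
  by case: ifP => _; [exact: hh|exact: hol_cst].
apply: holD; first apply: holD.
- exact: hol_Rd.
- by case: k => [|k]; [exact: hol_cst|apply: holM => //; exact: hol_Rd].
- by case: l => [|l]; [exact: hol_cst|apply: holM => //; exact: hol_Rd].
Qed.

Local Opaque Ex.

Lemma Ex_eq0 n k l x : (n < k + l)%N -> Ex n k l x = 0.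
Proof.
elim: n k l x => [|n IH] k l x nkl.
  by rewrite Ex0; case: k l nkl => [|k] [|l].
rewrite ExS (@Rd_ext _ (fun=> 0)); last by move=> y; apply: IH; exact: ltnW.
rewrite Rd_cst add0r; case: k nkl => [|k] nkl; case: l nkl => [|l] nkl //.
- by rewrite add0r IH ?mulr0.
- by rewrite addr0 IH ?mulr0.
- have e1 : Ex n k l.+1 x = 0 by apply: IH; move: nkl; rewrite addSn ltnS.
  have e2 : Ex n k.+1 l x = 0 by apply: IH; move: nkl; rewrite addnS ltnS.
  by rewrite e1 e2 !mulr0 addr0.
Qed.

(** [a k l] plays the part of the [(k, l)]-th partial derivative of some [F] at [(p, q)]; the
    hypothesis on [Rd (a k l)] is the chain rule. The coefficients [Ex] are the same for every such
    family, which is what makes them computable from special ones. *)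
Lemma leibniz_expansion (M n : nat) (a : nat -> nat -> B -> C) : (n <= M)%N ->
  (forall k l, hol R d (a k l)) ->
  (forall k l x, (k <= M)%N -> (l <= M)%N ->
     Rd (a k l) x = a k.+1 l x * Rd p x + a k l.+1 x * Rd q x) ->
  forall x, iter n (@Rd R d) (fun x => a 0%N 0%N x * h x) x =
    \sum_(k < M.+1) \sum_(l < M.+1) a k l x * Ex n k l x.
Proof.
move=> nM ha Ra; elim: n nM => [|n IH] nM x.
  rewrite big_ord_recl big_ord_recl big1 => [|l _]; last by rewrite Ex0 mulr0.
  rewrite addr0 big1 ?addr0 ?Ex0 // => k _; rewrite big1 // => l _.
  by rewrite Ex0 mulr0.
rewrite iterS (@Rd_ext _ (fun x => \sum_(k < M.+1) \sum_(l < M.+1) a k l x * Ex n k l x)); last first.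
  by move=> y; apply: IH; exact: ltnW.
rewrite Rd_sum; last by move=> k; apply: hol_sum => l _; apply: holM => //; exact: hol_Ex.
have -> : \sum_(k < M.+1) Rd (fun x => \sum_(l < M.+1) a k l x * Ex n k l x) x
  = \sum_(k < M.+1) \sum_(l < M.+1) (a k l x * Rd (Ex n k l) x)
  + \sum_(k < M.+1) \sum_(l < M.+1) (a k.+1 l x * (Rd p x * Ex n k l x))
  + \sum_(k < M.+1) \sum_(l < M.+1) (a k l.+1 x * (Rd q x * Ex n k l x)).
  rewrite -!big_split /=; apply: eq_bigr => k _.
  rewrite Rd_sum; last by move=> l; apply: holM => //; exact: hol_Ex.
  rewrite -!big_split /=; apply: eq_bigr => l _.
  rewrite RdM //; last exact: hol_Ex.
  rewrite Ra; [|by rewrite -ltnS..].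
  move: (Rd p x) (Rd q x) (Rd (Ex n k l) x) (Ex n k l x) (a k.+1 l x) (a k l.+1 x) (a k l x).
  by move=> x1 x2 x3 x4 x5 x6 x7; ring.
have -> : \sum_(k < M.+1) \sum_(l < M.+1) a k l x * Ex n.+1 k l x
  = \sum_(k < M.+1) \sum_(l < M.+1) (a k l x * Rd (Ex n k l) x)
  + \sum_(k < M.+1) \sum_(l < M.+1)
     (a k l x * (if val k is k'.+1 then Rd p x * Ex n k' l x else 0))
  + \sum_(k < M.+1) \sum_(l < M.+1)
     (a k l x * (if val l is l'.+1 then Rd q x * Ex n k l' x else 0)).
  rewrite -!big_split /=; apply: eq_bigr => k _.
  rewrite -!big_split /=; apply: eq_bigr => l _.
  by rewrite ExS !mulrDr.
(* In both remaining sums the index is shifted by one. The top term that falls out contains an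
   [Ex n] of total order above [n], hence vanishes; the new bottom term is the default 0. *)
congr (_ + _ + _).
  rewrite [LHS]big_ord_recr /= [X in _ + X]big1 ?addr0; last first.
    by move=> l _; rewrite Ex_eq0 ?mulr0 ?mulr0 // ltn_addr.
  rewrite [RHS]big_ord_recl /= [X in _ = X + _]big1 ?add0r //.
  by move=> l _; rewrite mulr0.
apply: eq_bigr => k _.
rewrite [LHS]big_ord_recr /= Ex_eq0 ?mulr0 ?mulr0 ?addr0; last by rewrite ltn_addl.
by rewrite [RHS]big_ord_recl /= mulr0 add0r.
Qed.

End Expansion.

End Leibniz.

(** * Square integrability of the coefficients *)

Section BesovCalculus.
Variables (R : realType) (d : nat).
Local Notation C := (Cplx R).
Local Notation B := (unit_ball R d).
Variables (sigma : probability (borelCd R d) R)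
  (mu : {finite_measure set R -> \bar R})
  (omega : {measure set (borelCd R d) -> \bar R}) (N : nat).
Hypothesis adm : admissible_radial sigma mu omega.
Implicit Types (u v p q h : B -> C).
Local Notation En := (@En R d sigma mu omega).

Lemma L2_normsq_extend0 u :
  L2_normsq sigma mu omega (iter N (@radial_derivative R d) (extend0 u)) =
  En (iter N (@Rd R d) u).
Proof.
congr (_ + _ * _)%E.
  by apply: eq_integral => z; rewrite inE => Bz; rewrite iter_radial_Rd.
congr (ereal_sup _); apply: eq_imagel => r /=; rewrite in_itv /= => r01.
by apply: eq_integral => z; rewrite inE => sz; rewrite iter_radial_Rd //; exact: sphere_ball.
Qed.

Definition inB u := hol R d u /\ (En (iter N (@Rd R d) u) < +oo)%E.

Lemma besovP u : besov sigma mu omega N u <-> inB u.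
Proof. by rewrite /besov /= L2_normsq_extend0. Qed.

Let memL u := hol R d u /\ (En u < +oo)%E.

Let memL_fin u : memL u -> exists2 r : R, 0 <= r & En u = r%:E.
Proof.
move=> [_ Eu]; have u0 := En_ge0 sigma mu omega u.
have ufin : En u \is a fin_num by rewrite ge0_fin_numE.
exists (fine (En u)); first by rewrite fine_ge0.
by rewrite fineK.
Qed.

Let En0 : (En (fun=> 0%R) <= 0)%E.
Proof.
have := @En_le R d sigma mu omega (fun=> 0) (fun=> 0) 0 (hol_cst 0) (hol_cst 0) (lexx 0).
have -> : 0 ^+ 2 = 0 :> R by rewrite expr0n.
by rewrite mul0e; apply => x; rewrite mul0r cabs0.
Qed.

(** The order of the quantifiers matters: [K] depends on the functions [e] only, so the bound tends
    to 0 with the coefficients. *)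
Let bound_lin (I : Type) (s : seq I) (e : I -> B -> C) : (forall i, memL (e i)) ->
  exists2 K : R, 0 <= K & forall (c : I -> B -> C) (k : R), 0 <= k ->
    (forall i, hol R d (c i)) -> (forall i x, cabs (c i x) <= k) ->
    (En (fun x => (\sum_(i <- s) c i x * e i x)%R) <= (K * k ^+ 2)%:E)%E.
Proof.
move=> eL; elim: s => [|i s [K K0 IH]].
  exists 0 => // c k k0 hc ck; rewrite mul0r.
  have -> : (fun x => \sum_(i <- [::]) c i x * e i x) = (fun=> 0).
    by apply/funext => x; rewrite big_nil.
  exact: En0.
have [r r0 Er] := memL_fin (eL i).
exists (2 * r + 2 * K); first by rewrite addr_ge0 // mulr_ge0.
move=> c k k0 hc ck.
have he j : hol R d (e j) by have [] := eL j.
have -> : (fun x => \sum_(j <- i :: s) c j x * e j x) =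
   (fun x => c i x * e i x + \sum_(j <- s) c j x * e j x).
  by apply/funext => x; rewrite big_cons.
have hce : hol R d (fun x => c i x * e i x) by exact: holM.
have hs : hol R d (fun x => \sum_(j <- s) c j x * e j x).
  by apply: hol_sum => j _; exact: holM.
apply: (le_trans (En_add sigma mu omega hce hs)).
have h1 : (En (fun x => (c i x * e i x)%R) <= (k ^+ 2 * r)%:E)%E.
  rewrite EFinM -Er; apply: En_le => // x; rewrite cabsM.
  by apply: ler_wpM2r; [exact: cabs_ge0|exact: ck].
have h2 := IH c k k0 hc ck.
apply: (@le_trans _ _ (2%:E * (k ^+ 2 * r)%:E + 2%:E * (K * k ^+ 2)%:E)%E).
  by apply: leeD; apply: lee_wpmul2l.
by rewrite -!EFinM -EFinD lee_fin; lra.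
Qed.

Let memL_lin (I : Type) (s : seq I) (e : I -> B -> C) (c : I -> B -> C) (k : R) :
  0 <= k -> (forall i, memL (e i)) ->
  (forall i, hol R d (c i)) -> (forall i x, cabs (c i x) <= k) ->
  memL (fun x => \sum_(i <- s) c i x * e i x).
Proof.
move=> k0 eL hc ck; split.
  by apply: hol_sum => i _; apply: holM => //; have [] := eL i.
have [K K0 H] := bound_lin s eL.
exact: le_lt_trans (H c k k0 hc ck) (ltry _).
Qed.

Let memL_ext u v : u =1 v -> memL u -> memL v.
Proof. by move=> /funext ->. Qed.

Let memL0 : memL (fun=> 0).
Proof. by split; [exact: hol_cst|exact: le_lt_trans En0 (ltry _)]. Qed.

Section Coefficients.
Variables (p q h : B -> C) (Q : R).
Hypotheses (Q1 : 1 <= Q) (pQ : forall x, cabs (p x) <= Q) (qQ : forall x, cabs (q x) <= Q).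
Hypotheses (hp : hol R d p) (hq : hol R d q).
Hypothesis pqh : forall i j, inB (fun x => p x ^+ i * q x ^+ j * h x).

Let hh : hol R d h.
Proof.
by have [+ _] := pqh 0 0; apply: hol_ext => x; rewrite !expr0 !mul1r.
Qed.

(** The [(k, l)]-th partial derivative of [s^i t^j] at [s = p], [t = q]. *)
Let mono i j k l x : C := ((i ^_ k) * (j ^_ l))%:R * (p x ^+ (i - k) * q x ^+ (j - l)).

Let hol_mono i j k l : hol R d (mono i j k l).
Proof. by apply: holZ; apply: holM; exact: holX. Qed.

Let Rd_mono i j k l x :
  Rd (mono i j k l) x = mono i j k.+1 l x * Rd p x + mono i j k l.+1 x * Rd q x.
Proof.
rewrite /mono RdZ; last by apply: holM; exact: holX.
rewrite RdM; [|exact: holX..].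
rewrite !RdX // !ffactnSr !subnS !natrM.
move: (i ^_ k)%:R (j ^_ l)%:R (i - k)%:R (j - l)%:R => a b c e.
move: (p x ^+ (i - k).-1) (q x ^+ (j - l).-1) (p x ^+ (i - k)) (q x ^+ (j - l)).
by move: (Rd p x) (Rd q x) => x1 x2 x3 x4 x5 x6; ring.
Qed.

Let mono_bound i j k l x :
  cabs (mono i j k l x) <= ((i ^_ k) * (j ^_ l))%:R * (Q ^+ i * Q ^+ j).
Proof.
rewrite /mono cabsM cabs_nat; apply: ler_wpM2l => //.
have Q0 : 0 <= Q by apply: le_trans Q1.
have bX (y : C) n m : (n <= m)%N -> cabs y <= Q -> cabs (y ^+ n) <= Q ^+ m.
  move=> nm yQ; rewrite cabsX; apply: (@le_trans _ _ (Q ^+ n)).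
    by apply: lerXn2r; rewrite ?nnegrE ?cabs_ge0.
  exact: ler_weXn2l.
by rewrite cabsM; apply: ler_pM; rewrite ?cabs_ge0 //; apply: bX => //; exact: leq_subr.
Qed.

(** Expand the [N]-th radial derivative of [p^i q^j h], which is square integrable by [pqh]. The
    coefficient of [Ex N i j] is the constant [i! j!], and all other nonzero terms have [k <= i],
    [l <= j], hence smaller [k + l]. So [Ex N i j] can be solved for by induction on [i + j]. *)
Let Ex_memL k l : memL (Ex p q h N k l).
Proof.
suff main s : forall i j, (i + j < s)%N -> memL (Ex p q h N i j).
  exact: (main (k + l).+1 k l (ltnSn _)).
clear k l; elim: s => [|s IH] i j ijs.
  by exfalso; move: ijs; rewrite ltn0.
rewrite ltnS in ijs.
have [ijN|Nij] := leqP (i + j) N; last first.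
  by apply: memL_ext memL0 => x; rewrite Ex_eq0.
have [iN jN] : (i < N.+1)%N /\ (j < N.+1)%N.
  by split; rewrite ltnS; apply: leq_trans ijN; rewrite ?leq_addr ?leq_addl.
pose c0 : C := ((i ^_ i) * (j ^_ j))%:R.
have c00 : c0 != 0 by rewrite pnatr_eq0 muln_eq0 !ffactnn negb_or -!lt0n !fact_gt0.
have E x := leibniz_expansion hp hq hh (leqnn N) (hol_mono i j) (fun k l x _ _ => Rd_mono i j k l x) x.
pose I := ('I_N.+1 * 'I_N.+1)%type.
(* Zero at the term being solved for and wherever the falling factorials vanish, so that the
   induction hypothesis covers every index. *)
pose e (kl : I) : B -> C := if (kl.1 == i :> nat) && (kl.2 == j :> nat) then (fun=> 0)
  else if (kl.1 <= i)%N && (kl.2 <= j)%N then Ex p q h N kl.1 kl.2 else (fun=> 0).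
have eL kl : memL (e kl).
  rewrite /e; case: ifP => [_|]; first exact: memL0.
  case: ifP => [/andP[k1 k2] kl0|_ _]; last exact: memL0.
  have kls : (kl.1 + kl.2 < s)%N.
    by move: (nat_of_ord kl.1) (nat_of_ord kl.2) k1 k2 kl0 ijs => k l; clear; lia.
  exact: (IH _ _ kls).
pose c (kl : I) : B -> C := mono i j kl.1 kl.2.
pose kk : R := \sum_(kl : I) ((i ^_ kl.1) * (j ^_ kl.2))%:R * (Q ^+ i * Q ^+ j).
have Q0 : 0 <= Q by apply: le_trans Q1.
have ck kl x : cabs (c kl x) <= kk.
  apply: (le_trans (mono_bound _ _ _ _ _)); rewrite /kk (bigD1 kl) //= lerDl.
  by apply: sumr_ge0 => *; rewrite !mulr_ge0 ?exprn_ge0.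
have kk0 : 0 <= kk by apply: sumr_ge0 => *; rewrite !mulr_ge0 ?exprn_ge0.
have sL := memL_lin (index_enum I) kk0 eL (fun kl => hol_mono i j kl.1 kl.2) ck.
have E' x : c0 * Ex p q h N i j x =
   iter N (@Rd R d) (fun x => mono i j 0 0 x * h x) x - \sum_(kl : I) c kl x * e kl x.
  rewrite E pair_big /=; apply/eqP; rewrite eq_sym subr_eq; apply/eqP.
  rewrite (bigD1 (Ordinal iN, Ordinal jN)) //= [in RHS](bigD1 (Ordinal iN, Ordinal jN)) //=.
  rewrite /e /= !eqxx mulr0 add0r; congr (_ + _).
    by rewrite /mono /c0 !subnn !expr0 !mulr1.
  apply: eq_bigr => -[k l] /= kl.
  have -> : (k == i :> nat) && (l == j :> nat) = false.
    by apply/negbTE; move: kl; rewrite xpair_eqE -!val_eqE.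
  case: ifP => // /negbT; rewrite negb_and -!ltnNge => klt.
  rewrite mulr0 /c /mono (_ : (i ^_ k * j ^_ l = 0)%N) ?mul0r //.
  by case/orP: klt => /ffact_small ->; rewrite ?muln0.
have iterL : memL (iter N (@Rd R d) (fun x => mono i j 0 0 x * h x)).
  have -> : (fun x => mono i j 0 0 x * h x) = (fun x => p x ^+ i * q x ^+ j * h x).
    by apply/funext => x; rewrite /mono !ffactn0 !subn0 mul1r.
  by have [h1 h2] := pqh i j; split => //; exact: hol_iter_Rd.
(* The difference of the two known functions, divided by [c0], is written as a sum over two booleans
   so that [memL_lin] applies. *)
pose es (b : bool) := if b then iter N (@Rd R d) (fun x => mono i j 0 0 x * h x)
   else (fun x => \sum_(kl : I) c kl x * e kl x).
pose cs (b : bool) (x : B) : C := if b then c0^-1 else - c0^-1.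
have esL b : memL (es b) by case: b; [exact: iterL|exact: sL].
have hcs b : hol R d (cs b) by case: b; exact: hol_cst.
have csk b x : cabs (cs b x) <= cabs c0^-1 by case: b; rewrite /cs ?cabsN.
apply: memL_ext (memL_lin [:: true; false] (cabs_ge0 _) esL hcs csk) => x.
rewrite !big_cons big_nil addr0 /cs /es mulNr -mulrBr -E' mulrA mulVf ?mul1r //.
Qed.

(** [K] is chosen before the family [a]: the same statement serves for membership and for norm
    convergence. *)
Lemma besov_calculus : exists2 K : R, 0 <= K &
  forall (a : nat -> nat -> B -> C) (k : R), 0 <= k -> (forall i j, hol R d (a i j)) ->
    (forall i j x, (i <= N)%N -> (j <= N)%N ->
       Rd (a i j) x = a i.+1 j x * Rd p x + a i j.+1 x * Rd q x) ->
    (forall i j x, (i + j <= N)%N -> cabs (a i j x) <= k) ->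
    (En (iter N (@Rd R d) (fun x => (a 0%N 0%N x * h x)%R)) <= (K * k ^+ 2)%:E)%E.
Proof.
pose I := ('I_N.+1 * 'I_N.+1)%type.
have [K K0 H] := @bound_lin I (index_enum I) (fun kl => Ex p q h N kl.1 kl.2)
  (fun kl => Ex_memL kl.1 kl.2).
exists K => // a k k0 ha Ra ak.
(* For [k + l > N] the coefficient [Ex] is 0, so [a] may be replaced by 0 there and needs its bound
   only for [i + j <= N]. *)
pose c (kl : I) : B -> C := if (kl.1 + kl.2 <= N)%N then a kl.1 kl.2 else (fun=> 0).
have -> : iter N (@Rd R d) (fun x => a 0%N 0%N x * h x) =
    (fun x => \sum_(kl : I) c kl x * Ex p q h N kl.1 kl.2 x).
  apply/funext => x; rewrite (leibniz_expansion hp hq hh (leqnn N) ha Ra) pair_big /=.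
  apply: eq_bigr => kl _; rewrite /c; case: leqP => // Nkl.
  by rewrite Ex_eq0 // !mulr0.
apply: H => //.
  by move=> kl; rewrite /c; case: ifP => _; [exact: ha|exact: hol_cst].
by move=> kl x; rewrite /c; case: ifP => [|_]; [exact: ak|rewrite cabs0].
Qed.

End Coefficients.

End BesovCalculus.

(** * Polynomial growth of the derivatives of [e^S] *)

Section PolynomialGrowth.
Variable R : realType.
Local Notation C := (Cplx R).

Lemma poly_growth (P : {poly C}) n : (size P <= n)%N ->
  exists2 A : R, 0 <= A & forall x, cabs P.[x] <= A * (1 + cabs x) ^+ n.
Proof.
move=> sP; exists (\sum_(i < size P) cabs P`_i); first by apply: sumr_ge0 => *; exact: cabs_ge0.
move=> x; rewrite horner_coef mulr_suml.
have cs (I : Type) (s : seq I) (F : I -> C) (G : I -> R) :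
    (forall i, cabs (F i) <= G i) -> cabs (\sum_(i <- s) F i) <= \sum_(i <- s) G i.
  move=> FG; elim: s => [|i s IH]; first by rewrite !big_nil cabs0.
  by rewrite !big_cons; apply: (le_trans (cabsD _ _)); apply: lerD.
apply: cs => i; rewrite cabsM cabsX; apply: ler_wpM2l; first exact: cabs_ge0.
apply: (@le_trans _ _ ((1 + cabs x) ^+ i)).
  by apply: lerXn2r; rewrite ?nnegrE ?cabs_ge0 // ?lerDr // addr_ge0 ?cabs_ge0.
by apply: ler_weXn2l; [rewrite lerDl cabs_ge0|exact: leq_trans (ltnW (ltn_ord i)) sP].
Qed.

(** Mean value estimate along the segment from 0 to [w], on which the modulus of the exponential is
    at most the larger of 1 and [e^(Re w)]. *)
Lemma cexp_sub1 (w : C) (M : R) : 1 <= M -> expR (complex.Re w) <= M ->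
  cabs (cexp w - 1) <= 2 * (cabs w * M).
Proof.
move=> M1 wM.
have := @cder_segment R (fun s => cexp (s * w)) (fun s => cexp (s * w) * w) (cabs w * M).
rewrite mul1r mul0r cexp0; apply.
  move=> t _; apply: (@cder_comp R (fun s => s * w) (@cexp R)); last exact: cexp_cder.
  by move=> e e0; exists 1 => // s _; rewrite -mulrBl mulrC subrr cabs0 mulr_ge0 ?cabs_ge0 ?ltW.
move=> t /andP[t0 t1]; rewrite cabsM mulrC; apply: ler_wpM2l; first exact: cabs_ge0.
rewrite cabs_cexp ReM /= mul0r subr0.
have [w0|w0] := leP 0 (complex.Re w).
  by apply: le_trans wM; rewrite ler_expR ler_piMl.
by apply: le_trans M1; rewrite expR_le1 nmulr_lle0.
Qed.

(** The polynomial factor in the [r]-th derivative of [e^S]. For [S] of degree at most 2 its degree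
    is at most [r]. *)
Fixpoint exp_coef (S : {poly C}) (r : nat) : {poly C} :=
  if r is r'.+1 then (exp_coef S r')^`() + exp_coef S r' * S^`() else 1.

Lemma size_exp_coef (S : {poly C}) r : (size S <= 3)%N -> (size (exp_coef S r) <= r.+1)%N.
Proof.
have size_d (P : {poly C}) : (size P^`() <= (size P).-1)%N.
  have [->|P0] := eqVneq P 0; first by rewrite deriv0 size_poly0.
  by have := lt_size_deriv P0; case: (size P) => [|n] //; rewrite ltnS.
move=> S3; elim: r => [|r IH] /=; first by rewrite size_poly1.
apply: (leq_trans (size_polyD _ _)); rewrite geq_max; apply/andP; split.
  exact: leq_trans (size_d _) (leq_trans (leq_pred _) (leqW IH)).
apply: (leq_trans (size_polyMleq _ _)).
move: IH (size_d S) S3; move: (size (exp_coef S r)) (size S^`()) (size S) => a b c.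
by clear; lia.
Qed.

End PolynomialGrowth.

(** * The calculus for [q^m G(p / q)] *)

Section QuotientCalculus.
Variables (R : realType) (d : nat).
Local Notation C := (Cplx R).
Local Notation Re := (@complex.Re R).
Local Notation Im := (@complex.Im R).
Local Notation B := (unit_ball R d).
Variables (sigma : probability (borelCd R d) R)
  (mu : {finite_measure set R -> \bar R})
  (omega : {measure set (borelCd R d) -> \bar R}) (N : nat).
Hypothesis adm : admissible_radial sigma mu omega.
Local Notation En := (@En R d sigma mu omega).
Local Notation inB := (@inB R d sigma mu omega N).

Lemma inB_cst (c : C) : inB (fun=> c).
Proof.
split; first exact: hol_cst.
case: N => [|n]; first exact: En_cst.
have -> : iter n.+1 (@Rd R d) (fun=> c) = (fun=> 0).
  elim: n => [|n IH]; first by apply/funext => x /=; rewrite Rd_cst.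
  by rewrite iterS IH; apply/funext => x; rewrite Rd_cst.
exact: En_cst.
Qed.

(** What the calculus uses of a multiplier. Multipliers of the Pick space turn out to have all three
    properties, but here no Hilbert space is involved. *)
Definition bmult (q : B -> C) : Prop :=
  [/\ hol R d q, exists Q : R, forall x, cabs (q x) <= Q &
      forall h, inB h -> inB (fun x => q x * h x)].

Lemma bmult_pow q i h : bmult q -> inB h -> inB (fun x => q x ^+ i * h x).
Proof.
move=> [_ _ qB] hB; elim: i => [|i IH].
  by have -> : (fun x => q x ^+ 0 * h x) = h by apply/funext => x; rewrite expr0 mul1r.
have -> : (fun x => q x ^+ i.+1 * h x) = (fun x => q x * (q x ^+ i * h x)).
  by apply/funext => x; rewrite exprS mulrA.
exact: qB.
Qed.

Section TwoMultipliers.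
Variables (p q : B -> C).
Hypotheses (pm : bmult p) (qm : bmult q).

Lemma mult_calculus h : inB h -> exists2 K : R, 0 <= K &
  forall (a : nat -> nat -> B -> C) (k : R), 0 <= k -> (forall i j, hol R d (a i j)) ->
    (forall i j x, (i <= N)%N -> (j <= N)%N ->
       Rd (a i j) x = a i.+1 j x * Rd p x + a i j.+1 x * Rd q x) ->
    (forall i j x, (i + j <= N)%N -> cabs (a i j x) <= k) ->
    (En (iter N (@Rd R d) (fun x => (a 0%N 0%N x * h x)%R)) <= (K * k ^+ 2)%:E)%E.
Proof.
move=> hB.
have [hp [P pP] _] := pm; have [hq [Q qQ] _] := qm.
set T := Num.max 1 (Num.max P Q).
have T1 : 1 <= T by rewrite le_max lexx.
have pT x : cabs (p x) <= T by rewrite !le_max pP orbT.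
have qT x : cabs (q x) <= T by rewrite !le_max qQ !orbT.
have pqh i j : inB (fun x => p x ^+ i * q x ^+ j * h x).
  have -> : (fun x => p x ^+ i * q x ^+ j * h x) = (fun x => p x ^+ i * (q x ^+ j * h x)).
    by apply/funext => x; rewrite mulrA.
  by apply: (bmult_pow i pm); exact: (bmult_pow j qm hB).
exact: (besov_calculus T1 pT qT hp hq pqh).
Qed.

Lemma mult_calculus_mem (a : nat -> nat -> B -> C) (k : R) h : inB h ->
  (forall i j, hol R d (a i j)) ->
  (forall i j x, (i <= N)%N -> (j <= N)%N ->
     Rd (a i j) x = a i.+1 j x * Rd p x + a i j.+1 x * Rd q x) ->
  (forall i j x, (i + j <= N)%N -> cabs (a i j x) <= k) ->
  inB (fun x => a 0%N 0%N x * h x).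
Proof.
move=> hB ha Ra ak; split; first by apply: holM => //; have [] := hB.
have [K K0 H] := mult_calculus hB.
have ak' i j x : (i + j <= N)%N -> cabs (a i j x) <= `|k|.
  by move=> /ak /le_trans; apply; exact: ler_norm.
exact: le_lt_trans (H a `|k| (normr_ge0 _) ha Ra ak') (ltry _).
Qed.

Variable K : B -> C.
Hypotheses (hK : hol R d K) (qK : forall x, q x * K x = p x).

Let W x := Rd p x - K x * Rd q x.

Let RdK x : q x * Rd K x = W x.
Proof.
have [hq _ _] := qm.
have E : Rd p x = Rd (fun x => q x * K x) x by apply: Rd_ext => y; rewrite qK.
by rewrite /W E RdM //; ring.
Qed.

(* Up to N derivatives of G (p / q) cost at most a factor (1 + |p / q|)^(2N + 2), which
   q^(m - N) absorbs. *)
Definition expo := (3 * N + 3)%N.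
Local Notation m := expo.

(** [G r] stands for the [r]-th derivative of a function of one variable, evaluated at [K]. *)
Definition chain (G : nat -> B -> C) := [/\ forall r, hol R d (G r) &
  forall r x, Rd (G r) x = G r.+1 x * Rd K x].

Let Q_ex : exists2 Q : R, 1 <= Q & forall x, cabs (q x) * (1 + cabs (K x)) <= Q.
Proof.
have [_ [P pP] _] := pm; have [_ [Q qQ] _] := qm.
exists (Num.max 1 (Q + P)); first by rewrite le_max lexx.
move=> x; rewrite mulrDr mulr1 -cabsM qK le_max; apply/orP; right.
by apply: lerD.
Qed.

(* [q^(m - k - l) * fam G l k] is the (k, l)-th partial derivative of t^m G_0 (s / t) at
   s = p, t = q, where G_r is the r-th derivative of G_0. *)
Fixpoint fam (G : nat -> B -> C) (l k : nat) : B -> C := if l is l'.+1 then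
   (fun x => (m%:R - k%:R - l'%:R) * fam G l' k x - K x * fam G l' k.+1 x) else G k.

Section Family.
Variable G : nat -> B -> C.
Hypothesis Gc : chain G.

Let hG r : hol R d (G r). Proof. by case: Gc. Qed.
Let RG r x : q x * Rd (G r) x = G r.+1 x * W x.
Proof. by case: Gc => _ ->; rewrite mulrCA RdK. Qed.

Let g := fam G.

Let gS l k : g l.+1 k = (fun x => (m%:R - k%:R - l%:R) * g l k x - K x * g l k.+1 x).
Proof. by []. Qed.

Let hg l k : hol R d (g l k).
Proof.
elim: l k => [|l IH] k; first exact: hG.
by rewrite gS; apply: holB; [exact: holZ|exact: holM].
Qed.

Let Rg l k x : q x * Rd (g l k) x = g l k.+1 x * W x.
Proof.
elim: l k => [|l IH] k; first exact: RG.
rewrite !gS (RdB x (holZ (m%:R - k%:R - l%:R) (hg l k)) (holM hK (hg l k.+1))).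
rewrite (RdZ _ x (hg l k)) (RdM x hK (hg l k.+1)).
have -> : q x * ((m%:R - k%:R - l%:R) * Rd (g l k) x
     - (Rd K x * g l k.+1 x + K x * Rd (g l k.+1) x)) =
   (m%:R - k%:R - l%:R) * (q x * Rd (g l k) x) - ((q x * Rd K x) * g l k.+1 x
     + K x * (q x * Rd (g l k.+1) x)) by ring.
rewrite RdK !IH -[k.+1%:R]natr1.
move: (g l k.+1 x) (g l k.+2 x) (W x) (K x) => x1 x2 x3 x4.
by ring.
Qed.

Let a k l x := q x ^+ (m - (k + l)) * g l k x.

Let ha k l : hol R d (a k l).
Proof. by have [hq _ _] := qm; apply: holM; [exact: holX|exact: hg]. Qed.

Let Ra k l x : (k <= N)%N -> (l <= N)%N ->
  Rd (a k l) x = a k.+1 l x * Rd p x + a k l.+1 x * Rd q x.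
Proof.
move=> kN lN; have [hq _ _] := qm.
rewrite /a RdM; [|exact: holX|exact: hg].
rewrite RdX //.
have [i Ei] : exists i, (m - (k + l) = i.+1)%N by exists (m - (k + l)).-1; rewrite /expo; lia.
have -> : (m - (k.+1 + l) = i)%N by lia.
have -> : (m - (k + l.+1) = i)%N by lia.
have im : i.+1%:R = m%:R - k%:R - l%:R :> C.
  by rewrite -Ei -addrA -opprD -natrD -natrB // /expo; lia.
rewrite Ei /= exprS im.
have -> : q x * q x ^+ i * Rd (g l k) x = q x ^+ i * (q x * Rd (g l k) x) by ring.
rewrite Rg (gS l k) /W.
move: (g l k x) (g l k.+1 x) (Rd p x) (Rd q x) (K x) (q x ^+ i) => x1 x2 x3 x4 x5 x6.
by ring.
Qed.

Let a_bound (A Q : R) : 0 <= A -> 1 <= Q -> (forall x, cabs (q x) * (1 + cabs (K x)) <= Q) ->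
  (forall r x, (r <= N)%N -> cabs (G r x) <= A * (1 + cabs (K x)) ^+ N.+2) ->
  forall k l x, (k + l <= N)%N -> cabs (a k l x) <= A * (m%:R + 1) ^+ m * Q ^+ m.
Proof.
move=> A0 Q1 qQ GA k l x klN.
set t := 1 + cabs (K x); have t1 : 1 <= t by rewrite lerDl cabs_ge0.
have t0 : 0 <= t by apply: le_trans t1.
have Kt : cabs (K x) <= t by rewrite /t lerDr.
have m0 : 0 <= m%:R + 1 :> R by rewrite addr_ge0.
(* Each step of the recurrence in [l] costs a constant and one power of [1 + |K|]. *)
have gb l' k' : (k' + l' <= N)%N ->
    cabs (g l' k' x) <= A * (m%:R + 1) ^+ l' * t ^+ (N.+2 + l').
  elim: l' k' => [|l' IH] k' kl'N.
    by rewrite expr0 mulr1 addn0; apply: GA; move: kl'N; rewrite addn0.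
  rewrite gS; apply: (le_trans (cabsB _ _)); rewrite !cabsM.
  set X := A * (m%:R + 1) ^+ l' * t ^+ (N.+2 + l').
  have X0 : 0 <= X by apply: mulr_ge0; [apply: mulr_ge0|]; rewrite ?exprn_ge0.
  have h1 : cabs (g l' k' x) <= X by apply: IH; lia.
  have h2 : cabs (g l' k'.+1 x) <= X by apply: IH; lia.
  have h3 : cabs (m%:R - k'%:R - l'%:R : C) <= m%:R.
    rewrite -addrA -opprD -natrD -natrB; last by rewrite /expo; lia.
    by rewrite cabs_nat ler_nat leq_subr.
  have -> : A * (m%:R + 1) ^+ l'.+1 * t ^+ (N.+2 + l'.+1) = m%:R * (X * t) + X * t.
    by rewrite /X addnS !exprS; ring.
  apply: lerD.
    apply: ler_pM; rewrite ?cabs_ge0 //; apply: (le_trans h1).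
    by rewrite ler_peMr.
  rewrite [X * t]mulrC; apply: ler_pM; rewrite ?cabs_ge0 //.
(* This is where the size of [m] is used: as [k + l <= N], at least [2N + 3 >= N + 2 + l] powers of
   [q] are left, one for each power of [1 + |K|] in [gb]. *)
have [i Ei] : exists i, (m - (k + l) = (N.+2 + l) + i)%N.
  by exists (m - (k + l) - (N.+2 + l))%N; rewrite /expo; lia.
rewrite /a cabsM cabsX Ei exprD.
have q0 := cabs_ge0 (q x).
have qQ1 : cabs (q x) <= Q by apply: le_trans (qQ x); rewrite ler_peMr.
apply: (@le_trans _ _ (cabs (q x) ^+ (N.+2 + l) * cabs (q x) ^+ i *
    (A * (m%:R + 1) ^+ l * t ^+ (N.+2 + l)))).
  by apply: ler_wpM2l; [rewrite mulr_ge0 ?exprn_ge0|exact: gb].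
have -> : cabs (q x) ^+ (N.+2 + l) * cabs (q x) ^+ i * (A * (m%:R + 1) ^+ l * t ^+ (N.+2 + l))
  = A * (m%:R + 1) ^+ l * ((cabs (q x) * t) ^+ (N.+2 + l) * cabs (q x) ^+ i).
  by rewrite exprMn; ring.
have lm : (l <= m)%N by rewrite /expo; lia.
have Q0 : 0 <= Q by apply: le_trans Q1.
have hA : A * (m%:R + 1) ^+ l <= A * (m%:R + 1) ^+ m.
  by apply: ler_wpM2l => //; apply: ler_weXn2l => //; rewrite lerDr.
have qt0 : 0 <= cabs (q x) * t by apply: mulr_ge0.
have hB : (cabs (q x) * t) ^+ (N.+2 + l) * cabs (q x) ^+ i <= Q ^+ m.
  apply: (@le_trans _ _ (Q ^+ (N.+2 + l) * Q ^+ i)).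
    have h1 : (cabs (q x) * t) ^+ (N.+2 + l) <= Q ^+ (N.+2 + l).
      by apply: lerXn2r; rewrite ?nnegrE //; exact: (qQ x).
    have h2 : cabs (q x) ^+ i <= Q ^+ i by apply: lerXn2r; rewrite ?nnegrE.
    by apply: ler_pM => //; rewrite exprn_ge0.
  by rewrite -exprD -Ei; apply: ler_weXn2l => //; exact: leq_subr.
apply: ler_pM => //; first by apply: mulr_ge0; rewrite ?exprn_ge0.
by apply: mulr_ge0; rewrite exprn_ge0.
Qed.

Lemma quotient_mult A h : 0 <= A -> inB h ->
  (forall r x, (r <= N)%N -> cabs (G r x) <= A * (1 + cabs (K x)) ^+ N.+2) ->
  inB (fun x => q x ^+ m * G 0%N x * h x).
Proof.
move=> A0 hB GA; have [Q Q1 qQ] := Q_ex.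
have -> : (fun x => q x ^+ m * G 0%N x * h x) = (fun x => a 0%N 0%N x * h x).
  by apply/funext => x; rewrite /a /= subn0.
exact: (mult_calculus_mem hB ha Ra (a_bound A0 Q1 qQ GA)).
Qed.

Lemma quotient_En (K1 A Q : R) :
  (forall (a : nat -> nat -> B -> C) (k : R), 0 <= k -> (forall i j, hol R d (a i j)) ->
    (forall i j x, (i <= N)%N -> (j <= N)%N ->
       Rd (a i j) x = a i.+1 j x * Rd p x + a i j.+1 x * Rd q x) ->
    (forall i j x, (i + j <= N)%N -> cabs (a i j x) <= k) ->
    (En (iter N (@Rd R d) (fun x => (a 0%N 0%N x * 1)%R)) <= (K1 * k ^+ 2)%:E)%E) ->
  0 <= A -> 1 <= Q -> (forall x, cabs (q x) * (1 + cabs (K x)) <= Q) ->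
  (forall r x, (r <= N)%N -> cabs (G r x) <= A * (1 + cabs (K x)) ^+ N.+2) ->
  (En (iter N (@Rd R d) (fun x => (q x ^+ m * G 0%N x)%R))
   <= (K1 * (A * (m%:R + 1) ^+ m * Q ^+ m) ^+ 2)%:E)%E.
Proof.
move=> H A0 Q1 qQ GA.
have -> : (fun x => q x ^+ m * G 0%N x) = (fun x => a 0%N 0%N x * 1).
  by apply/funext => x; rewrite /a /= subn0 mulr1.
have Q0 : 0 <= Q by apply: le_trans Q1.
have k0 : 0 <= A * (m%:R + 1) ^+ m * Q ^+ m.
  by rewrite !mulr_ge0 ?exprn_ge0 // addr_ge0.
exact: (H a _ k0 ha Ra (a_bound A0 Q1 qQ GA)).
Qed.

End Family.

(** [K0] is fixed before [G] and [A], so a family of functions [G] with [A] tending to 0 tends to 0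
    in the seminorm. *)
Lemma quotient_bound : exists2 K0 : R, 0 <= K0 & forall G A, chain G -> 0 <= A ->
  (forall r x, (r <= N)%N -> cabs (G r x) <= A * (1 + cabs (K x)) ^+ N.+2) ->
  (En (iter N (@Rd R d) (fun x => (q x ^+ m * G 0%N x)%R)) <= (K0 * A ^+ 2)%:E)%E.
Proof.
have [K1 K10 H] := mult_calculus (inB_cst 1).
have [Q Q1 qQ] := Q_ex.
exists (K1 * ((m%:R + 1) ^+ m * Q ^+ m) ^+ 2); first by rewrite mulr_ge0 // sqr_ge0.
move=> G A Gc A0 GA; apply: (le_trans (quotient_En Gc H A0 Q1 qQ GA)).
rewrite lee_fin; set X := (_ + 1) ^+ _; set Y := Q ^+ _.
by rewrite (_ : K1 * (A * X * Y) ^+ 2 = K1 * (X * Y) ^+ 2 * A ^+ 2) //; ring.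
Qed.

End TwoMultipliers.

End QuotientCalculus.

(** * The principal logarithm on the right half-plane *)

Section Logarithm.
Variable R : realType.
Local Notation C := (Cplx R).
Local Notation Re := (@complex.Re R).
Local Notation Im := (@complex.Im R).
Implicit Types (z : C).

Let cosrange z : z != 0 -> -1 <= Re z / cabs z <= 1.
Proof.
move=> z0; rewrite -ler_norml normrM normfV (ger0_norm (cabs_ge0 z)).
by rewrite ler_pdivrMr ?cabs_gt0 // mul1r Re_le_cabs.
Qed.

Let cos_carg z : z != 0 -> cos (carg z) = Re z / cabs z.
Proof.
move=> z0; have H : cos (acos (Re z / cabs z)) = Re z / cabs z.
  by apply: acosK; rewrite in_itv /= cosrange.
by rewrite /carg; case: ifP => _; rewrite ?cosN.
Qed.

Let sin_carg z : z != 0 -> sin (carg z) = Im z / cabs z.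
Proof.
move=> z0; have cz : 0 < cabs z by rewrite cabs_gt0.
have H : sin (acos (Re z / cabs z)) = `|Im z| / cabs z.
  rewrite sin_acos ?cosrange // -[RHS]ger0_norm ?divr_ge0 ?cabs_ge0 // -sqrtr_sqr.
  congr Num.sqrt; rewrite !exprMn !exprVn real_normK ?num_real // sqr_cabs.
  have : Re z ^+ 2 + Im z ^+ 2 != 0 by rewrite -sqr_cabs expf_neq0 ?gt_eqF.
  by move=> ?; field.
rewrite /carg; case: ifP => [I0|/negbT]; first by rewrite H ger0_norm.
by rewrite -ltNge => I0; rewrite sinN H ltr0_norm // mulNr opprK.
Qed.

Lemma clogK z : z != 0 -> cexp (clog z) = z.
Proof.
move=> z0; have cz : 0 < cabs z by rewrite cabs_gt0.
apply: complex_eqP; rewrite /= lnK ?posrE // ?cos_carg ?sin_carg // mulrC divfK ?gt_eqF //.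
Qed.

Let carg_range z : 0 < Re z -> - (pi / 2) <= carg z <= pi / 2.
Proof.
move=> z0; have zn : z != 0 by apply: contraTneq z0 => ->; rewrite ltxx.
have cz : 0 < cabs z by rewrite cabs_gt0.
have c0 : 0 < Re z / cabs z by rewrite divr_gt0.
have [c1 c2] := andP (cosrange zn).
have a0 : 0 <= acos (Re z / cabs z) by apply: acos_ge0; rewrite cosrange.
have ap : acos (Re z / cabs z) <= pi by apply: acos_lepi; rewrite cosrange.
have p0 := pi_gt0 R.
have ah : acos (Re z / cabs z) <= pi / 2.
  rewrite leNgt; apply/negP => ha.
  have : cos (acos (Re z / cabs z)) < cos (pi / 2).
    by rewrite ltr_cos // in_itv /=; lra.
  rewrite cos_pihalf acosK ?in_itv /= ?cosrange //; lra.
by rewrite /carg; case: ifP => _; lra.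
Qed.

Lemma Im_clog z : 0 < Re z -> `|Im (clog z)| <= pi / 2.
Proof. by move=> /carg_range; rewrite ler_norml. Qed.

(** On the right half-plane the case distinction in [carg] disappears: there [carg] is the arcsine
    of [Im z / |z|]. *)
Let clog_cont z : 0 < Re z -> {for z, continuous (@clog R)}.
Proof.
move=> z0; have zn : z != 0 by apply: contraTneq z0 => ->; rewrite ltxx.
have E y : 0 < Re y -> carg y = asin (Im y / cabs y).
  move=> y0; have yn : y != 0 by apply: contraTneq y0 => ->; rewrite ltxx.
  by rewrite -sin_carg // sinK // in_itv /= carg_range.
have cz : 0 < cabs z by rewrite cabs_gt0.
have zr : -1 < Im z / cabs z < 1.
  rewrite -ltr_norml normrM normfV (gtr0_norm cz) ltr_pdivrMr // mul1r.
  rewrite -(@ltr_pXn2r _ 2) ?nnegrE ?cabs_ge0 // sqr_cabs real_normK ?num_real //.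
  by rewrite ltrDr exprn_gt0.
have Rnear : \forall y \near z, 0 < Re y.
  have := @Re_continuous R z => /(@cvgrPdist_lt _ _ _ (nbhs z))/(_ _ z0).
  by apply: (@filterS _ (nbhs z)) => y; rewrite ltr_norml => /andP[? ?]; lra.
have l1 : {for z, continuous ((@ln R) \o (@cabs R))}.
  apply: continuous_comp; first exact: cabs_continuous.
  exact: continuous_ln.
have l2 : {for z, continuous (@asin R \o (fun y : C => Im y / cabs y))}.
  apply: continuous_comp; last exact: continuous_asin.
  have cV : (cabs y)^-1 @[y --> z] --> (cabs z)^-1.
    by apply: (@cvgV _ _ (nbhs z)); [rewrite gt_eqF|exact: cabs_continuous].
  exact: (@cvgM _ _ (nbhs z) _ _ _ _ _ (@Im_continuous R z) cV).
have H := @cvg_complex _ _ (nbhs z) (nbhs_filter z) _ _ _ _ l1 l2.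
apply/(@cvgC_cabs _ _ (nbhs z)) => e e0.
have {}H := (@cvgC_cabs _ _ (nbhs z) (nbhs_filter z) _ _).1 H e e0.
apply: (@filterS2 _ (nbhs z) (nbhs_filter z) _ _ _ _ Rnear H) => y y0.
by rewrite /clog !E.
Qed.

(** The derivative of an inverse function: [cexp] has derivative [z] at [clog z], and [clog] is
    continuous. *)
Lemma clog_cder z : 0 < Re z -> cder (@clog R) z z^-1.
Proof.
move=> z0 e e0; have zn : z != 0 by apply: contraTneq z0 => ->; rewrite ltxx.
set k := cabs z; have k0 : 0 < k by rewrite cabs_gt0.
(* The first bound absorbs the error into [k |w|] and yields [|w| <= (2 / k) |y - z|]; with this,
   the second bound gives the final error [e |y - z|]. *)
set e' := Num.min (k / 2) (e * k ^+ 2 / 2).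
have e'0 : 0 < e' by rewrite lt_min !divr_gt0 ?mulr_gt0 ?exprn_gt0.
have [d1 d10 H1] := @cexp_cder R (clog z) e' e'0.
have := clog_cont z0 => /(@cvgC_cabs _ _ (nbhs z))/(_ d1 d10)/nbhsC_cabs[d2 d20 H2].
have := @Re_continuous R z => /(@cvgrPdist_lt _ _ _ (nbhs z))/(_ _ z0)/nbhsC_cabs[d3 d30 H3].
exists (Num.min d2 d3); first by rewrite lt_min d20.
move=> y; rewrite lt_min => /andP[/H2 y2 /H3 y3].
have y0 : 0 < Re y by move: y3; rewrite ltr_norml => /andP[? ?]; lra.
have yn : y != 0 by apply: contraTneq y0 => ->; rewrite ltxx.
have := H1 _ y2; rewrite !clogK //.
set w := clog y - clog z => H.
have ek : e' <= k / 2 by rewrite ge_min lexx.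
have ee : e' <= e * k ^+ 2 / 2 by rewrite ge_min lexx orbT.
have w0 := cabs_ge0 w.
have wk : cabs w <= 2 / k * cabs (y - z).
  have : k * cabs w <= cabs (y - z) + e' * cabs w.
    rewrite -cabsM; have -> : z * w = (y - z) - (y - z - z * w) by ring.
    by apply: (le_trans (cabsB _ _)); rewrite lerD2l.
  have := ler_wpM2r w0 ek.
  move=> h1 h2; rewrite mulrAC ler_pdivlMr //; lra.
have -> : w - z^-1 * (y - z) = - (z^-1 * (y - z - z * w)).
  by rewrite [X in _ = - X]mulrBr mulKf // opprB.
rewrite cabsN cabsM cabsV -/k mulrC ler_pdivrMr //; apply: (le_trans H).
apply: (@le_trans _ _ (e * k ^+ 2 / 2 * (2 / k * cabs (y - z)))).
  by apply: ler_pM => //; exact: ltW.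
have -> : e * k ^+ 2 / 2 * (2 / k * cabs (y - z)) = e * cabs (y - z) * k; last by [].
by field; rewrite gt_eqF.
Qed.

Lemma cabs_clog z : 1 <= Re z -> cabs (clog z) <= cabs z + pi / 2.
Proof.
move=> z1; have z0 : 0 < Re z by lra.
have c1 : 1 <= cabs z by apply: le_trans z1 _; apply: le_trans (Re_le_cabs z); exact: ler_norm.
apply: (le_trans (cabs_le_ReIm _)); apply: lerD; last exact: Im_clog.
rewrite /= ger0_norm ?ln_ge0 //; apply/ltW/ln_sublinear; lra.
Qed.

End Logarithm.

(** * Radial derivatives of inverses, exponentials, logarithms and polynomials *)

Section HolomorphicFunctions.
Variables (R : realType) (d : nat).
Local Notation C := (Cplx R).
Local Notation B := (unit_ball R d).
Implicit Types (u : B -> C).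

Lemma hol_inv u : hol R d u -> (forall x, u x != 0) -> hol R d (fun x => (u x)^-1).
Proof.
move=> hu u0; apply: (@hol_val _ _ (fun z => (extend0 u z)^-1)).
  by move=> x; rewrite extend0_val.
move=> z Bz; apply: differentiableV; first exact: hu.
by have [x <-] := ball_val Bz; rewrite extend0_val.
Qed.

Lemma Rd_inv u x : hol R d u -> (forall x, u x != 0) ->
  Rd (fun x => (u x)^-1) x = - (u x)^-2 * Rd u x.
Proof.
move=> hu u0; have hv := hol_inv hu u0.
have : Rd (fun x => u x * (u x)^-1) x = 0.
  by rewrite (@Rd_ext _ _ _ (fun=> 1)) ?Rd_cst // => y; rewrite divff.
rewrite RdM // => E; apply: (mulfI (u0 x)); apply/eqP; rewrite -subr_eq0.
rewrite -E; apply/eqP; field; exact: u0.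
Qed.

Lemma hol_cexp u : hol R d u -> hol R d (fun x => cexp (u x)).
Proof. by move=> hu; apply: hol_comp => // x; exists (cexp (u x)); exact: cexp_cder. Qed.

Lemma Rd_cexp u x : hol R d u -> Rd (fun x => cexp (u x)) x = cexp (u x) * Rd u x.
Proof. by move=> hu; apply: Rd_comp => //; exact: cexp_cder. Qed.

Lemma hol_clog u : hol R d u -> (forall x, 0 < complex.Re (u x)) ->
  hol R d (fun x => clog (u x)).
Proof.
by move=> hu u0; apply: hol_comp => // x; exists (u x)^-1; exact: clog_cder.
Qed.

Lemma Rd_clog u x : hol R d u -> (forall x, 0 < complex.Re (u x)) ->
  Rd (fun x => clog (u x)) x = (u x)^-1 * Rd u x.
Proof. by move=> hu u0; apply: Rd_comp => //; exact: clog_cder. Qed.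

Lemma hol_horner (P : {poly C}) u : hol R d u -> hol R d (fun x => P.[u x]).
Proof.
move=> hu; elim/poly_ind: P => [|P c IH].
  by apply: hol_ext (hol_cst 0) => x; rewrite horner0.
apply: hol_ext (holD (holM IH hu) (hol_cst c)) => x.
by rewrite !hornerE.
Qed.

Lemma Rd_horner (P : {poly C}) u x : hol R d u ->
  Rd (fun x => P.[u x]) x = P^`().[u x] * Rd u x.
Proof.
move=> hu; elim/poly_ind: P => [|P c IH].
  rewrite (@Rd_ext _ _ _ (fun=> 0)) ?Rd_cst; last by move=> y; rewrite horner0.
  by rewrite deriv0 horner0 mul0r.
rewrite (@Rd_ext _ _ _ (fun x => P.[u x] * u x + c)); last by move=> y; rewrite !hornerE.
have hP := hol_horner P hu.
rewrite (RdD x (holM hP hu) (hol_cst c)) (RdM x hP hu) Rd_cst IH.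
rewrite derivD derivM derivX derivC addr0 mulr1 !hornerE.
by move: (Rd u x) (P^`().[u x]) (P.[u x]) => a b e; ring.
Qed.

End HolomorphicFunctions.

(** * Multipliers built from exponentials and logarithms of quotients *)

Section Multipliers.
Variables (R : realType) (d : nat).
Local Notation C := (Cplx R).
Local Notation Re := (@complex.Re R).
Local Notation Im := (@complex.Im R).
Local Notation B := (unit_ball R d).
Variables (sigma : probability (borelCd R d) R)
  (mu : {finite_measure set R -> \bar R})
  (omega : {measure set (borelCd R d) -> \bar R}) (N : nat).
Hypothesis adm : admissible_radial sigma mu omega.
Local Notation En := (@En R d sigma mu omega).
Local Notation inB := (@inB R d sigma mu omega N).
Local Notation bmult := (@bmult R d sigma mu omega N).
Local Notation m := (expo N).

Let le_max_seq (A : nat -> R) : exists2 M : R, 0 <= M & forall r, (r <= N)%N -> A r <= M.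
Proof.
exists (\sum_(r < N.+1) `|A r|); first by apply: sumr_ge0.
move=> r rN; have rN' : (r < N.+1)%N by [].
apply: (le_trans (ler_norm _)); rewrite (bigD1 (Ordinal rN')) //= lerDl.
by apply: sumr_ge0.
Qed.

Section Quotient.
Variables (p q K : B -> C).
Hypotheses (pm : bmult p) (qm : bmult q) (hK : hol R d K).
Hypotheses (qK : forall x, q x * K x = p x).

Let chain_exp (S : {poly C}) :
  chain K (fun r x => (exp_coef S r).[K x] * cexp S.[K x]).
Proof.
have hS := hol_horner S hK; have hE := hol_cexp hS.
split=> [r|r x]; first by apply: holM => //; exact: hol_horner.
have hP := hol_horner (exp_coef S r) hK.
rewrite (RdM x hP hE) (Rd_horner _ x hK) (Rd_cexp x hS) (Rd_horner _ x hK) /= hornerD hornerM.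
move: (Rd K x) (exp_coef S r)^`().[K x] (exp_coef S r).[K x] (cexp _) S^`().[K x].
by move=> x1 x2 x3 x4 x5; ring.
Qed.

(** The bounded factor [e^S] is harmless, and [exp_coef S r] has degree at most [r <= N], so the
    growth condition of [quotient_mult] holds. *)
Lemma mult_exp (S : {poly C}) (E : R) h : (size S <= 3)%N ->
  (forall x, cabs (cexp S.[K x]) <= E) -> inB h ->
  inB (fun x => q x ^+ m * cexp S.[K x] * h x).
Proof.
move=> S3 SE hB.
have /choice[A HA] : forall r, exists A : R, (r <= N)%N ->
    0 <= A /\ forall x, cabs (exp_coef S r).[x] <= A * (1 + cabs x) ^+ N.+2.
  move=> r; have [rN|] := leqP r N; last by exists 0.
  have sz : (size (exp_coef S r) <= N.+2)%N.
    by apply: (leq_trans (size_exp_coef r S3)); lia.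
  by have [A A0 PA] := poly_growth sz; exists A.
have [M M0 AM] := le_max_seq A.
set E' := `|E|.
have ME0 : 0 <= M * E' by apply: mulr_ge0 => //; exact: normr_ge0.
have := quotient_mult pm qm hK qK (chain_exp S) ME0 hB.
have -> : (fun x => q x ^+ m * ((exp_coef S 0).[K x] * cexp S.[K x]) * h x) =
    (fun x => q x ^+ m * cexp S.[K x] * h x).
  by apply/funext => x; rewrite (_ : exp_coef S 0 = 1%:P) // hornerC mul1r.
apply => r x rN; have [A0 PA] := HA r rN.
rewrite cabsM mulrAC; apply: ler_pM; rewrite ?cabs_ge0 //.
  apply: (le_trans (PA (K x))); apply: ler_wpM2r; last exact: AM.
  by rewrite exprn_ge0 // addr_ge0 ?cabs_ge0.
by apply: (le_trans (SE x)); exact: ler_norm.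
Qed.

(** The derivatives of [e^(S(dl K)) - 1]; the subtracted constant is seen only by [r = 0]. *)
Let chain_gauss (dl : C) (S : {poly C}) : chain K (fun r x =>
   dl ^+ r * ((exp_coef S r).[dl * K x] * cexp S.[dl * K x]) - (r == 0%N)%:R).
Proof.
have hdK : hol R d (fun x => dl * K x) by exact: holZ.
have hS := hol_horner S hdK; have hE := hol_cexp hS.
have hT r : hol R d (fun x => (exp_coef S r).[dl * K x] * cexp S.[dl * K x]).
  by apply: holM => //; exact: hol_horner.
split=> [r|r x]; first by apply: holB; [exact: holZ|exact: hol_cst].
have hP := hol_horner (exp_coef S r) hdK.
rewrite (RdB x (holZ _ (hT r)) (hol_cst _)) Rd_cst subr0 (RdZ _ x (hT r)).
rewrite (RdM x hP hE) (Rd_horner _ x hdK) (Rd_cexp x hS) (Rd_horner _ x hdK) (RdZ _ x hK).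
rewrite /= hornerD hornerM subr0 exprS.
move: (Rd K x) (exp_coef S r)^`().[_] (exp_coef S r).[_] (cexp _) S^`().[_].
by move=> x1 x2 x3 x4 x5; ring.
Qed.

(** Every term of the chain is of order [dl]: a derivative brings out a factor [dl], and [e^S - 1]
    itself is of the size of [S = - (dl K)^2]. *)
Lemma gauss_cvg (M : R) : (forall x, `|Im (K x)| <= M) ->
  exists2 K0 : R, 0 <= K0 & forall dl : R, 0 < dl <= 1 ->
    (En (iter N (@Rd R d) (fun x => (q x ^+ m * (cexp (- (dl%:C * K x) ^+ 2) - 1))%R))
     <= (K0 * dl ^+ 2)%:E)%E.
Proof.
move=> KM.
pose S : {poly C} := - 'X^2.
have S3 : (size S <= 3)%N by rewrite size_polyN size_polyXn.
have /choice[A HA] : forall r, exists A : R, (r <= N)%N ->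
    0 <= A /\ forall x, cabs (exp_coef S r).[x] <= A * (1 + cabs x) ^+ N.+2.
  move=> r; have [rN|] := leqP r N; last by exists 0.
  have sz : (size (exp_coef S r) <= N.+2)%N.
    by apply: (leq_trans (size_exp_coef r S3)); lia.
  by have [A A0 PA] := poly_growth sz; exists A.
have [MA MA0 AM] := le_max_seq A.
set E := expR (M ^+ 2).
have E1 : 1 <= E by rewrite -expR0 ler_expR sqr_ge0.
have [K0 K00 H] := quotient_bound adm pm qm hK qK.
set A0 := MA * E + 2 * E.
have MAE : 0 <= MA * E by rewrite mulr_ge0 // (le_trans _ E1).
have A00 : 0 <= A0 by rewrite addr_ge0 // mulr_ge0 // (le_trans _ E1).
exists (K0 * A0 ^+ 2); first by rewrite mulr_ge0 // sqr_ge0.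
move=> dl /andP[dl0 dl1].
have Adl : 0 <= A0 * dl by rewrite mulr_ge0 // ltW.
have := H _ _ (chain_gauss dl%:C S) Adl.
have -> : (fun x => q x ^+ m * (dl%:C ^+ 0 * ((exp_coef S 0).[dl%:C * K x]
     * cexp S.[dl%:C * K x]) - (0%N == 0%N)%:R)) =
   (fun x => q x ^+ m * (cexp (- (dl%:C * K x) ^+ 2) - 1)).
  by apply/funext => x; rewrite (_ : exp_coef S 0 = 1%:P) // hornerC expr0 !mul1r hornerN hornerXn.
rewrite -mulrA -exprMn; apply => r x rN.
have SE : S.[dl%:C * K x] = - (dl%:C * K x) ^+ 2 by rewrite hornerN hornerXn.
have ReS : expR (Re S.[dl%:C * K x]) <= E.
  rewrite ler_expR SE expr2 ReN ReM [Re (_ * _)]ReM [Im (_ * _)]ImM /= !mul0r subr0 addr0.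
  have Md : (dl * Im (K x)) ^+ 2 <= M ^+ 2.
    rewrite -[(_ * _) ^+ 2]real_normK ?num_real //; apply: lerXn2r; rewrite ?nnegrE //.
      exact: le_trans (KM x).
    rewrite normrM (gtr0_norm dl0); apply: le_trans (KM x).
    by rewrite ler_piMl.
  have := sqr_ge0 (dl * Re (K x)); move: Md; rewrite !expr2; lra.
set t := 1 + cabs (K x); have t1 : 1 <= t by rewrite lerDl cabs_ge0.
have t0 : 0 <= t by apply: le_trans t1.
have cdK : cabs (dl%:C * K x) = dl * cabs (K x) by rewrite cabsM cabsR gtr0_norm.
have dKt : 1 + cabs (dl%:C * K x) <= t by rewrite cdK lerD2l ler_piMl ?cabs_ge0.
have tN : 0 <= t ^+ N.+2 by rewrite exprn_ge0.
(* For [r = 0] the estimate contains [|K|^2] whatever [N] is; the exponent [N.+2] in the growth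
   condition leaves room for it. *)
case: r rN => [_|r rN].
  rewrite (_ : exp_coef S 0 = 1%:P) // hornerC expr0 !mul1r.
  apply: (le_trans (cexp_sub1 E1 ReS)); rewrite SE cabsN cabsX cdK.
  apply: (@le_trans _ _ (2 * E * dl * t ^+ N.+2)).
    have h1 : (dl * cabs (K x)) ^+ 2 <= dl * t ^+ N.+2.
      rewrite exprMn; apply: ler_pM; rewrite ?exprn_ge0 ?cabs_ge0 //; first exact: ltW.
        by rewrite expr2 ler_piMl // ltW.
      apply: (@le_trans _ _ (t ^+ 2)).
        by apply: lerXn2r; rewrite ?nnegrE ?cabs_ge0 // lerDr.
      by apply: ler_weXn2l.
    have E0 : 0 <= E by apply: le_trans E1.
    by have := ler_wpM2r E0 h1; lra.
  apply: ler_wpM2r => //; apply: ler_wpM2r; first exact: ltW.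
  by rewrite /A0 lerDr.
have -> : dl%:C ^+ r.+1 * ((exp_coef S r.+1).[dl%:C * K x] * cexp S.[dl%:C * K x])
   - (r.+1 == 0%N)%:R = dl%:C ^+ r.+1 * ((exp_coef S r.+1).[dl%:C * K x] * cexp S.[dl%:C * K x]).
  by rewrite /= subr0.
have [Ar0 PA] := HA r.+1 rN.
rewrite cabsM cabsX cabsR (gtr0_norm dl0) cabsM cabs_cexp.
have h1 : cabs (exp_coef S r.+1).[dl%:C * K x] <= MA * t ^+ N.+2.
  apply: (le_trans (PA _)); apply: ler_pM => //; last 2 first.
  - exact: AM.
  - by apply: lerXn2r; rewrite ?nnegrE // addr_ge0 ?cabs_ge0.
  by rewrite exprn_ge0 // addr_ge0 ?cabs_ge0.
have h2 : dl ^+ r.+1 <= dl by rewrite exprS ler_piMr ?(ltW dl0) // exprn_ile1 // ltW.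
apply: (@le_trans _ _ (dl * (MA * t ^+ N.+2 * E))).
  apply: ler_pM; rewrite ?exprn_ge0 ?mulr_ge0 ?cabs_ge0 ?expR_ge0 //; first exact: ltW.
  by apply: ler_pM; rewrite ?cabs_ge0 ?expR_ge0.
rewrite (_ : dl * _ = MA * E * (dl * t ^+ N.+2)); last by ring.
rewrite -[A0 * _ * _]mulrA; apply: ler_wpM2r; first by rewrite mulr_ge0 // ltW.
by rewrite /A0 lerDl mulr_ge0 // (le_trans _ E1).
Qed.

(** As [|1 + K| >= 1], all derivatives of [log (1 + K)] are bounded, and the logarithm itself grows
    at most linearly in [|K|]. *)
Lemma mult_log h : (forall x, 0 <= Re (K x)) -> inB h ->
  inB (fun x => q x ^+ m * clog (1 + K x) * h x).
Proof.
move=> K0 hB.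
have h1K : hol R d (fun x => 1 + K x) by apply: holD => //; exact: hol_cst.
have R1K x : 1 <= Re (1 + K x) by rewrite ReD /= lerDl.
have R0K x : 0 < Re (1 + K x) by apply: lt_le_trans (R1K x).
have n1K x : 1 + K x != 0 by apply: contraTneq (R0K x) => ->; rewrite ltxx.
pose Y x := (1 + K x)^-1.
have hY : hol R d Y by exact: hol_inv.
have Rd1K x : Rd (fun x => 1 + K x) x = Rd K x.
  by rewrite (RdD x (hol_cst 1) hK) Rd_cst add0r.
have RdY x : Rd Y x = - Y x ^+ 2 * Rd K x by rewrite (Rd_inv x h1K n1K) Rd1K /Y exprVn.
pose c r : C := (-1) ^+ r * (r`!)%:R.
pose G r x := if r is r'.+1 then c r' * Y x ^+ r else clog (1 + K x).
have GcK : chain K G.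
  split=> [[|r]|[|r] x].
  - exact: hol_clog.
  - by apply: holZ; exact: holX.
  - rewrite (Rd_clog x h1K R0K) Rd1K /G /c expr0 fact0 /Y expr1.
    by rewrite !mul1r.
  rewrite /G (RdZ _ x (holX _ hY)) (RdX _ x hY) RdY /c !exprS factS natrM /=.
  move: ((-1) ^+ r) (r`!)%:R (Y x) (Rd K x) (Y x ^+ r) (r.+1)%:R => x1 x2 x3 x4 x5 x6.
  by ring.
set A : R := 1 + pi / 2 + (N`!)%:R.
have p0 := pi_gt0 R.
have A0 : 0 <= A by rewrite !addr_ge0 // divr_ge0 // ltW.
apply: (quotient_mult pm qm hK qK GcK A0 hB) => r x rN.
set t := 1 + cabs (K x); have t1 : 1 <= t by rewrite lerDl cabs_ge0.
have tN : 1 <= t ^+ N.+2 by exact: exprn_ege1.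
case: r rN => [_|r rN].
  apply: (le_trans (cabs_clog (R1K x))).
  have h1 : cabs (1 + K x) <= t by apply: (le_trans (cabsD _ _)); rewrite cabs1.
  have h2 : t <= t ^+ N.+2 by rewrite exprS ler_peMr ?exprn_ege1 //; lra.
  apply: (@le_trans _ _ ((1 + pi / 2) * t ^+ N.+2)).
    have h3 : pi / 2 <= pi / 2 * t ^+ N.+2 by apply: ler_peMr tN; lra.
    by move: h1 h2 h3; rewrite [(1 + _) * _]mulrDl; lra.
  by apply: ler_wpM2r; [lra|rewrite /A lerDl].
have Y1 : cabs (Y x) <= 1.
  rewrite cabsV invf_le1; last by rewrite cabs_gt0.
  by apply: (le_trans (R1K x)); apply: le_trans (Re_le_cabs _); exact: ler_norm.
rewrite /G /c !cabsM cabsX cabsN cabs1 expr1n mul1r cabs_nat cabsX.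
apply: (@le_trans _ _ ((N`!)%:R * 1)).
  apply: ler_pM => //; rewrite ?exprn_ge0 ?cabs_ge0 //; last by rewrite exprn_ile1 ?cabs_ge0.
  by rewrite ler_nat leq_fact // ltnW.
by apply: ler_pM => //; rewrite /A lerDr addr_ge0 // divr_ge0 // ltW.
Qed.

End Quotient.

Section LogQuotient.
Variables (p q L : B -> C).
Hypotheses (pm : bmult p) (qm : bmult q) (hL : hol R d L).
Hypothesis Lpq : forall x, p x = q x * cexp (L x).

Let RdL x : p x * q x * Rd L x = q x * Rd p x - p x * Rd q x.
Proof.
have [hq _ _] := qm.
have E : Rd p x = Rd (fun x => q x * cexp (L x)) x by apply: Rd_ext.
rewrite E (RdM x hq (hol_cexp hL)) (Rd_cexp x hL) Lpq.
by move: (q x) (cexp (L x)) (Rd L x) (Rd q x) => x1 x2 x3 x4; ring.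
Qed.

(** The [k]-th derivative of [s^m log s] is [m^_k s^(m - k) (log s + Hs k)]. *)
Let Hs k : C := \sum_(i < k) (m - i)%:R^-1.
Let HsS k : Hs k.+1 = Hs k + (m - k)%:R^-1.
Proof. by rewrite /Hs big_ord_recr. Qed.

(* The (k, l)-th partial derivative of (s t)^m log (s / t) at s = p, t = q. *)
Let a k l x : C := ((m ^_ k) * (m ^_ l))%:R *
  (p x ^+ (m - k) * q x ^+ (m - l) * (L x + (Hs k - Hs l))).

Let hA k l : hol R d (fun x => L x + (Hs k - Hs l)).
Proof. by apply: holD => //; exact: hol_cst. Qed.

Let hpq k l : hol R d (fun x => p x ^+ k * q x ^+ l).
Proof. by have [hp _ _] := pm; have [hq _ _] := qm; apply: holM; exact: holX. Qed.

Let ha k l : hol R d (a k l).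
Proof. by apply: holZ; apply: holM. Qed.

Let Ra k l x : (k <= N)%N -> (l <= N)%N ->
  Rd (a k l) x = a k.+1 l x * Rd p x + a k l.+1 x * Rd q x.
Proof.
move=> kN lN; have [hp _ _] := pm; have [hq _ _] := qm.
rewrite /a (RdZ _ x (holM (hpq (m - k) (m - l)) (hA k l))).
rewrite (RdM x (hpq (m - k) (m - l)) (hA k l)).
rewrite (RdM x (holX (m - k) hp) (holX (m - l) hq)) (RdX _ x hp) (RdX _ x hq).
rewrite (RdD x hL (hol_cst (Hs k - Hs l))) Rd_cst addr0.
have [i Ei] : exists i, (m - k = i.+1)%N by exists (m - k).-1; rewrite /expo; lia.
have [j Ej] : exists j, (m - l = j.+1)%N by exists (m - l).-1; rewrite /expo; lia.
have -> : (m - k.+1 = i)%N by lia.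
have -> : (m - l.+1 = j)%N by lia.
rewrite !ffactnSr !HsS Ei Ej !natrM !exprS /=.
have i0 : i.+1%:R != 0 :> C by rewrite pnatr_eq0.
have j0 : j.+1%:R != 0 :> C by rewrite pnatr_eq0.
have F (c e x1 x2 x3 x4 y1 y2 y3 y4 y5 y6 u v : C) : u != 0 -> v != 0 ->
   x3 * x4 * y2 = x4 * y3 - x3 * y4 ->
   c * e * ((u * x1 * y3 * (x4 * x2) + x3 * x1 * (v * x2 * y4)) * (y1 + (y5 - y6))
     + x3 * x1 * (x4 * x2) * y2) =
   c * u * e * (x1 * (x4 * x2) * (y1 + (y5 + u^-1 - y6))) * y3 +
   c * (e * v) * (x3 * x1 * x2 * (y1 + (y5 - (y6 + v^-1)))) * y4.
  move=> u0 v0 E.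
  have -> : x3 * x1 * (x4 * x2) * y2 = x1 * x2 * (x3 * x4 * y2) by ring.
  by rewrite E; field; apply/andP.
exact: (F _ _ _ _ _ _ _ _ _ _ _ _ _ _ i0 j0 (RdL x)).
Qed.

(** The logarithm of [p / q] is large where either function is small, hence powers of both. For
    [k, l <= N < m] every partial derivative keeps a factor [p q], and [p q L] is bounded. *)
Lemma mult_log_quotient (M : R) h : (forall x, `|Im (L x)| <= M) -> inB h ->
  inB (fun x => (p x * q x) ^+ m * L x * h x).
Proof.
move=> LM hB; have [hp [P pP] _] := pm; have [hq [Q qQ] _] := qm.
set T := 1 + `|P| + `|Q| + `|M|.
have T1 : 1 <= T by rewrite /T -!addrA lerDl !addr_ge0.
have T0 : 0 <= T by apply: le_trans T1.
have pT x : cabs (p x) <= T.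
  apply: (le_trans (pP x)); rewrite /T.
  by have := ler_norm P; have := normr_ge0 Q; have := normr_ge0 M; lra.
have qT x : cabs (q x) <= T.
  apply: (le_trans (qQ x)); rewrite /T.
  by have := ler_norm Q; have := normr_ge0 P; have := normr_ge0 M; lra.
have MT : M <= T.
  by have := ler_norm M; rewrite /T; have := normr_ge0 P; have := normr_ge0 Q; lra.
(* [|Re L| <= e^(Re L) + e^(- Re L)], that is [|p / q| + |q / p|]; multiplied by [|p q|] this
   becomes [|p|^2 + |q|^2]. *)
have pqL x : cabs (p x) * cabs (q x) * cabs (L x) <= 3 * T ^+ 3.
  have p0 := cabs_ge0 (p x); have q0 := cabs_ge0 (q x).
  have pE : cabs (p x) = cabs (q x) * expR (Re (L x)) by rewrite Lpq cabsM cabs_cexp.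
  have qE : cabs (q x) = cabs (p x) * expR (- Re (L x)).
    by rewrite pE -mulrA -expRD subrr expR0 mulr1.
  have l1 : cabs (L x) <= expR (Re (L x)) + expR (- Re (L x)) + T.
    apply: (le_trans (cabs_le_ReIm _)); apply: lerD; last exact: le_trans (LM x) MT.
    have := expR_ge1Dx (Re (L x)); have := expR_ge1Dx (- Re (L x)).
    have := expR_ge0 (Re (L x)); have := expR_ge0 (- Re (L x)).
    rewrite ler_norml; lra.
  apply: (@le_trans _ _ (cabs (p x) ^+ 2 + cabs (q x) ^+ 2 + cabs (p x) * cabs (q x) * T)).
    apply: (@le_trans _ _ (cabs (p x) * (cabs (q x) * expR (Re (L x)))
        + cabs (q x) * (cabs (p x) * expR (- Re (L x))) + cabs (p x) * cabs (q x) * T)).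
      have := ler_wpM2l (mulr_ge0 p0 q0) l1; lra.
    by rewrite -pE -qE !expr2.
  have T23 : T ^+ 2 <= T ^+ 3 by rewrite [in leRHS]exprS ler_peMl // exprn_ge0.
  have a1 : cabs (p x) ^+ 2 <= T ^+ 2 by apply: lerXn2r; rewrite ?nnegrE.
  have a2 : cabs (q x) ^+ 2 <= T ^+ 2 by apply: lerXn2r; rewrite ?nnegrE.
  have a3 : cabs (p x) * cabs (q x) * T <= T ^+ 3.
    have -> : T ^+ 3 = T * T * T by rewrite !exprS expr0 mulr1 mulrA.
    by apply: ler_wpM2r => //; apply: ler_pM.
  by lra.
pose b k l : R := ((m ^_ k) * (m ^_ l))%:R *
  (T ^+ m * T ^+ m * (3 * T ^+ 3 + T ^+ 2 * cabs (Hs k - Hs l))).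
have b0 k l : 0 <= b k l.
  by rewrite /b !mulr_ge0 ?addr_ge0 ?mulr_ge0 ?exprn_ge0 ?cabs_ge0.
have ab k l x : (k + l <= N)%N -> cabs (a k l x) <= b k l.
  move=> klN; rewrite /a cabsM cabs_nat /b; apply: ler_wpM2l => //.
  have [i Ei] : exists i, (m - k = i.+1)%N by exists (m - k).-1; rewrite /expo; lia.
  have [j Ej] : exists j, (m - l = j.+1)%N by exists (m - l).-1; rewrite /expo; lia.
  have im : (i <= m)%N by lia.
  have jm : (j <= m)%N by lia.
  rewrite Ei Ej (exprS _ i) (exprS _ j) !cabsM !cabsX.
  have -> : cabs (p x) * cabs (p x) ^+ i * (cabs (q x) * cabs (q x) ^+ j)
      * cabs (L x + (Hs k - Hs l)) =
    cabs (p x) ^+ i * cabs (q x) ^+ j * (cabs (p x) * cabs (q x) * cabs (L x + (Hs k - Hs l))).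
    by ring.
  have p0 := cabs_ge0 (p x); have q0 := cabs_ge0 (q x).
  have Xb (y : R) n : 0 <= y -> y <= T -> (n <= m)%N -> y ^+ n <= T ^+ m.
    move=> y0 yT nm; apply: (@le_trans _ _ (T ^+ n)); first by apply: lerXn2r; rewrite ?nnegrE.
    exact: ler_weXn2l.
  apply: ler_pM; rewrite ?mulr_ge0 ?exprn_ge0 ?cabs_ge0 //.
    by apply: ler_pM; rewrite ?exprn_ge0 //; exact: Xb.
  have := ler_wpM2l (mulr_ge0 p0 q0) (cabsD (L x) (Hs k - Hs l)).
  move=> /le_trans; apply; rewrite [leLHS]mulrDr; apply: lerD; first exact: pqL.
  by rewrite expr2; apply: ler_wpM2r; [exact: cabs_ge0|apply: ler_pM].
pose bb : R := \sum_(k < N.+1) \sum_(l < N.+1) b k l.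
have abb k l x : (k + l <= N)%N -> cabs (a k l x) <= bb.
  move=> klN; apply: (le_trans (ab k l x klN)).
  have kN : (k < N.+1)%N by lia.
  have lN : (l < N.+1)%N by lia.
  rewrite /bb (bigD1 (Ordinal kN)) //= (bigD1 (Ordinal lN)) //= -addrA lerDl.
  by rewrite addr_ge0 //; apply: sumr_ge0 => // *; exact: sumr_ge0.
have -> : (fun x => (p x * q x) ^+ m * L x * h x) = (fun x => a 0%N 0%N x * h x).
  by apply/funext => x; rewrite /a !ffactn0 muln1 mul1r !subn0 subrr addr0 exprMn.
exact: (mult_calculus_mem pm qm hB ha Ra abb).
Qed.

End LogQuotient.


End Multipliers.

(** * Hilbert spaces: Riesz representation and the Schur product theorem *)

Section Hilbert.
Variable R : realType.
Local Notation C := (Cplx R).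
Local Notation Re := (@complex.Re R).
Local Notation Im := (@complex.Im R).
Local Notation "z ^*" := (@Num.conj C z) : complex_scope.

Lemma Re_conj (z : C) : Re z^* = Re z. Proof. by case: z. Qed.
Lemma Im_conj (z : C) : Im z^* = - Im z. Proof. by case: z. Qed.

Lemma conjD (z w : C) : (z + w)^* = z^* + w^*. Proof. exact: rmorphD. Qed.
Lemma conjB (z w : C) : (z - w)^* = z^* - w^*. Proof. exact: rmorphB. Qed.
Lemma conjM (z w : C) : (z * w)^* = z^* * w^*. Proof. exact: rmorphM. Qed.
Lemma conjV (z : C) : z^-1^* = z^*^-1. Proof. exact: fmorphV. Qed.
Lemma conj_sum (I : Type) (s : seq I) (F : I -> C) :
  (\sum_(i <- s) F i)^* = \sum_(i <- s) (F i)^*.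
Proof. exact: rmorph_sum. Qed.

Lemma cabs_conj (z : C) : cabs z^* = cabs z.
Proof. by apply: (@complexI R); rewrite -!normCabs norm_conjC. Qed.

Lemma mulC_conj (z : C) : z * z^* = (cabs z ^+ 2)%:C.
Proof. by rewrite -normCK normCabs rmorphXn. Qed.

Lemma conjR (r : R) : (r%:C : C)^* = r%:C.
Proof. by apply: complex_eqP; rewrite ?Re_conj ?Im_conj /= ?oppr0. Qed.

(** Put [t = - s c^*] with [s] real. For [d > 0] the minimum is at [s = 1 / d]; for [d = 0] an
    affine function of [s] that stays nonnegative has slope 0. *)
Lemma discriminant_le (a d : R) (c : C) : 0 <= d ->
  (forall t : C, 0 <= a + 2 * Re (t * c) + cabs t ^+ 2 * d) -> cabs c ^+ 2 <= a * d.
Proof.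
move=> d_ge0 H.
have X2 : 0 <= cabs c ^+ 2 by rewrite exprn_ge0 // cabs_ge0.
have K (s : R) : 0 <= a - 2 * s * cabs c ^+ 2 + s ^+ 2 * cabs c ^+ 2 * d.
  have := H (- s%:C * c^*).
  have -> : - s%:C * c^* * c = (- (s * cabs c ^+ 2))%:C :> C.
    by rewrite -mulrA [c^* * c]mulrC mulC_conj mulNr -rmorphM rmorphN.
  rewrite cabsM cabsN cabsR cabs_conj exprMn real_normK ?num_real //= .
  by move: (cabs c ^+ 2) => X; lra.
have a0 : 0 <= a by have := K 0; rewrite expr0n /=; lra.
move: X2 K; set X := cabs c ^+ 2 => X2 K.
have [d0|dn0] := eqVneq d 0.
  rewrite d0 mulr0 leNgt; apply/negP => Xp.
  have := K ((a + 1) / X).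
  have -> : 2 * ((a + 1) / X) * X = 2 * (a + 1) by field; lra.
  by rewrite d0 mulr0; lra.
have d0 : 0 < d by rewrite lt_def dn0.
have := K d^-1.
have -> : a - 2 * d^-1 * X + d^-1 ^+ 2 * X * d = (a * d - X) / d by field; lra.
by rewrite pmulr_lge0 ?invr_gt0 // subr_ge0.
Qed.

Section Space.
Variable E : hilbertSpace R.
Implicit Types (u v w : E).
Local Notation "'[ u , v ]" := (hs_dot E u v).

Lemma dotDl u v w : '[u + v, w] = '[u, w] + '[v, w]. Proof. exact: linearDl. Qed.
Lemma dotBl u v w : '[u - v, w] = '[u, w] - '[v, w]. Proof. exact: linearBl. Qed.
Lemma dotDr u v w : '[w, u + v] = '[w, u] + '[w, v]. Proof. exact: linearDr. Qed.
Lemma dotBr u v w : '[w, u - v] = '[w, u] - '[w, v]. Proof. exact: linearBr. Qed.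
Lemma dotZl a u v : '[a *: u, v] = a * '[u, v]. Proof. exact: linearZl_LR. Qed.
Lemma dotZr a u v : '[u, a *: v] = a^* * '[u, v]. Proof. exact: linearZr_LR. Qed.
Lemma dot0l u : '[0, u] = 0. Proof. exact: linear0l. Qed.
Lemma dot0r u : '[u, 0] = 0. Proof. exact: linear0r. Qed.
Lemma dotC u v : '[u, v] = '[v, u]^*. Proof. by rewrite hermC expr0 mul1r. Qed.

Lemma dot_suml (I : Type) (s : seq I) (F : I -> E) v :
  '[\sum_(i <- s) F i, v] = \sum_(i <- s) '[F i, v].
Proof. exact: linear_sumlz. Qed.

Lemma dot_sumr (I : Type) (s : seq I) (F : I -> E) v :
  '[v, \sum_(i <- s) F i] = \sum_(i <- s) '[v, F i].
Proof. exact: linear_sumr. Qed.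

Lemma dot_nm u : '[u, u] = (nm u ^+ 2)%:C.
Proof. by rewrite -hs_normE nmE rmorphXn. Qed.

Lemma nm_sqrD u v : nm (u + v) ^+ 2 = nm u ^+ 2 + 2 * Re '[u, v] + nm v ^+ 2.
Proof.
apply: (@complexI R); rewrite -dot_nm dotDl !dotDr !dot_nm (dotC v u).
by apply: complex_eqP; rewrite !(ReD, ImD) ?Re_conj ?Im_conj /=; lra.
Qed.

Lemma nm_sqrB u v : nm (u - v) ^+ 2 = nm u ^+ 2 - 2 * Re '[u, v] + nm v ^+ 2.
Proof. by rewrite nm_sqrD nmN linearNr /= ReN mulrN. Qed.

Lemma cauchy_schwarz u v : cabs '[u, v] <= nm u * nm v.
Proof.
rewrite -(@ler_pXn2r _ 2) ?nnegrE ?cabs_ge0 ?mulr_ge0 ?nm_ge0 // exprMn.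
apply: discriminant_le; first by rewrite exprn_ge0 // nm_ge0.
move=> t.
have := exprn_ge0 2 (nm_ge0 (u + t^* *: v)).
by rewrite nm_sqrD dotZr conjCK nmZ cabs_conj exprMn.
Qed.

Lemma complete_seq (u : nat -> E) (e : nat -> R) :
  (forall r : R, 0 < r -> exists n, e n < r) ->
  (forall n m, (n <= m)%N -> nm (u m - u n) <= e n) ->
  exists l, forall n, nm (l - u n) <= e n.
Proof.
move=> e0 ue.
have Cu : cauchy (u @ \oo).
  apply: cauchy_exP => _ /posC[r r0 ->]; have [n enr] := e0 r r0.
  exists (u n); exists n => // m /= nm; rewrite -ball_normE /= distrC nmE ltcR.
  exact: le_lt_trans (ue n m nm) enr.
have Pu : ProperFilter (u @ \oo) by exact: fmap_proper_filter.
have [l ul] := (cvg_ex (u @ \oo)).1 (@cauchy_cvg (hs_sort E) (u @ \oo) Pu Cu).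
exists l => n; apply/ler_addgt0Pr => r r0.
have : \forall w \near l, nm (w - l) < r by apply/near_nm; exists r.
move=> /ul[m _ mP].
have := mP (maxn m n) (leq_maxl _ _); rewrite /= nmBC => h1.
have h2 := ue n (maxn m n) (leq_maxr _ _).
rewrite -(subrK (u (maxn m n)) l) -addrA.
by apply: (le_trans (nmD _ _)); lra.
Qed.

Lemma geometric_seq (u : nat -> E) (c r : R) : 0 <= c -> 0 <= r < 1 ->
  (forall n, nm (u n.+1 - u n) <= c * r ^+ n) ->
  exists l, forall n, nm (l - u n) <= c / (1 - r) * r ^+ n.
Proof.
move=> c0 /andP[r0 r1] uc.
have d0 : 0 <= c / (1 - r) by rewrite divr_ge0 // subr_ge0 ltW.
apply: complete_seq => [e e0|n m /subnK <-].
  have : (fun n => c / (1 - r) * r ^+ n) @ \oo --> (c / (1 - r) * 0 : R).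
    by apply: cvgM; [exact: cvg_cst|apply: cvg_expr; rewrite ger0_norm].
  rewrite mulr0 => /cvgrPdist_lt/(_ e e0)[n _ nP]; exists n.
  have := nP n (leqnn n); rewrite /= sub0r normrN; exact: le_lt_trans (ler_norm _).
have IH k : nm (u (k + n)%N - u n) <= c / (1 - r) * (r ^+ n - r ^+ (k + n)).
  elim: k => [|k IH]; first by rewrite add0n !subrr nm0 mulr0.
  rewrite addSn -(subrK (u (k + n)%N) (u _.+1)) -addrA.
  apply: (le_trans (nmD _ _)); have := uc (k + n)%N; move: IH; rewrite exprS.
  have -> : c / (1 - r) * (r ^+ n - r * r ^+ (k + n)) =
    c / (1 - r) * (r ^+ n - r ^+ (k + n)) + c * r ^+ (k + n) by field; lra.
  lra.
apply: (le_trans (IH _)); apply: ler_wpM2l => //.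
by rewrite gerBl exprn_ge0.
Qed.

(* The functional [l] on the subspace [exists l, D v l] is represented by the limit of
   a sequence minimising [|v|^2 - 2 Re l]. *)
Lemma riesz (D : E -> C -> Prop) (M : R) : 0 <= M -> D 0 0 ->
  (forall a u v k l, D u k -> D v l -> D (a *: u + v) (a * k + l)) ->
  (forall v l, D v l -> cabs l <= M * nm v) ->
  exists y, [/\ forall v l, D v l -> '[v, y] = l, nm y <= M &
    forall e : R, 0 < e -> exists v l, D v l /\ nm (y - v) < e].
Proof.
move=> M0 D0 Dlin DM.
pose J (v : E) (l : C) : R := nm v ^+ 2 - 2 * Re l.
pose S := [set x : R | exists v l, D v l /\ x = J v l].
have JM v l : D v l -> - M ^+ 2 <= J v l.
  move=> Dvl; have h1 := DM v l Dvl; have h2 := Re_le_cabs l; have h3 := ler_norm (Re l).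
  rewrite /J; have : 0 <= (nm v - M) ^+ 2 by exact: sqr_ge0.
  rewrite sqrrB; move: (nm v ^+ 2) (M ^+ 2) => a b.
  rewrite mulr2n [nm v * M]mulrC; lra.
have hS : has_inf S.
  split; first by exists (J 0 0), 0, 0.
  by exists (- M ^+ 2) => _ [v [l [Dvl ->]]]; exact: JM.
set I := inf S.
have IJ v l : D v l -> I <= J v l.
  by move=> Dvl; apply: ge_inf; [exact: hS.2|exists v, l].
have /choice[vl Hvl] : forall n, exists vl : E * C, D vl.1 vl.2 /\ J vl.1 vl.2 <= I + n.+1%:R^-1.
  move=> n; have n0 : 0 < n.+1%:R^-1 :> R by rewrite invr_gt0.
  have [_ [v [l [Dvl ->]]] lt] := inf_adherent n0 hS.
  by exists (v, l); split=> //; exact: ltW.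
pose u n := (vl n).1; pose l n := (vl n).2.
have Du n : D (u n) (l n) by case: (Hvl n).
have Ju n : J (u n) (l n) <= I + n.+1%:R^-1 by case: (Hvl n).
pose e (n : nat) : R := 2 * Num.sqrt n.+1%:R^-1.
have e_lt (r : R) : 0 < r -> exists n, e n < r.
  move=> r0; have r2 : 0 < (r / 2) ^+ 2 by rewrite exprn_gt0 // divr_gt0.
  have [n nP] := @ltr_add_invr _ 0 _ r2; exists n.
  rewrite /e -ltr_pdivlMl // [_^-1 * r]mulrC.
  rewrite -[ltRHS]ger0_norm; last by rewrite divr_ge0 // ltW.
  by rewrite -sqrtr_sqr ltr_sqrt // -[ltLHS]add0r.
have sqe n : e n ^+ 2 = 4 * n.+1%:R^-1.
  by rewrite /e exprMn sqr_sqrtr ?invr_ge0 //; ring.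
have e0 n : 0 <= e n by rewrite mulr_ge0 // sqrtr_ge0.
have [y yP] : exists y, forall n, nm (y - u n) <= e n.
  apply: complete_seq => // n m nm_.
  rewrite -(@ler_pXn2r _ 2) ?nnegrE ?nm_ge0 // sqe.
  have inv_le : m.+1%:R^-1 <= n.+1%:R^-1 :> R by rewrite lef_pV2 ?posrE // ler_nat.
  (* Parallelogram law: the midpoint of two near-minimisers cannot go below the infimum, which
     forces them to be close. *)
  have Dmid := Dlin (2^-1) _ _ _ _ (Dlin 1 _ _ _ _ (Du m) (Du n)) D0.
  have := IJ _ _ Dmid; have := Ju n; have := Ju m; rewrite /J !addr0 scale1r mul1r.
  have half : cabs (2^-1 : C) = 2^-1 by rewrite cabsV cabs_nat.
  rewrite nmZ half.
  have -> : Re (2^-1 * (l m + l n)) = 2^-1 * (Re (l m) + Re (l n)).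
    have -> : (2^-1 : C) = (2^-1 : R)%:C by rewrite fmorphV rmorph_nat.
    by rewrite ReM ReD /=; ring.
  rewrite exprMn (nm_sqrD (u m)) nm_sqrB.
  have -> : (2^-1 : R) ^+ 2 = 4^-1 by field.
  move: inv_le; move: (n.+1%:R^-1) (m.+1%:R^-1) => x y.
  move: (nm (u m) ^+ 2) (nm (u n) ^+ 2) (Re '[u m, u n]) (Re (l m)) (Re (l n)) => a b c f g.
  lra.
have lim (a b : R) : 0 <= b -> (forall n, a <= e n * b) -> a <= 0.
  move=> b0 H; apply/ler_addgt0Pr => r r0; rewrite add0r.
  have b1 : 0 < b + 1 by lra.
  have [n nP] := e_lt (r / (b + 1)) (divr_gt0 r0 b1).
  apply: (le_trans (H n)); move: nP; rewrite ltr_pdivlMr // => nP.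
  have := e0 n; lra.
have yl v k : D v k -> '[v, y] = k.
  move=> Dvk; apply/eqP; rewrite -subr_eq0 -cabs_eq0 eq_le cabs_ge0 andbT.
  apply: (@lim _ (2 * nm v)); first by rewrite mulr_ge0 // nm_ge0.
  move=> n.
  (* First variation: moving the near-minimiser [u n] by [t v] lowers the functional by at most
     [1 / (n + 1)], for all complex [t]; the discriminant gives the bound. *)
  have h1 : cabs ('[v, u n] - k) <= e n * nm v.
    rewrite -(@ler_pXn2r _ 2) ?nnegrE ?cabs_ge0 ?mulr_ge0 ?nm_ge0 // exprMn.
    have s0 : 0 <= n.+1%:R^-1 :> R by rewrite invr_ge0.
    apply: (@le_trans _ _ (n.+1%:R^-1 * nm v ^+ 2)); last first.
      by apply: ler_wpM2r; [rewrite exprn_ge0 // nm_ge0|rewrite sqe ler_peMl //; lra].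
    apply: discriminant_le; first by rewrite exprn_ge0 // nm_ge0.
    move=> t.
    have := IJ _ _ (Dlin t _ _ _ _ Dvk (Du n)); have := Ju n.
    have -> : Re (t * ('[v, u n] - k)) = Re (t * '[v, u n]) - Re (t * k).
      by rewrite mulrBr ReD ReN.
    rewrite /J nm_sqrD nmZ exprMn dotZl [Re (_ + l n)]ReD.
    move: (Re (t * '[v, u n])) (Re (t * k)) (Re (l n)) (nm v ^+ 2) (nm (u n) ^+ 2).
    move: (n.+1%:R^-1) (cabs t ^+ 2) => x6 x7 x1 x2 x3 x4 x5; lra.
  have h2 : cabs '[v, y - u n] <= nm v * e n.
    apply: (le_trans (cauchy_schwarz _ _)); apply: ler_wpM2l; [exact: nm_ge0|exact: yP].
  have -> : '[v, y] - k = '[v, y - u n] + ('[v, u n] - k).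
    by rewrite dotBr addrA subrK.
  by apply: (le_trans (cabsD _ _)); lra.
exists y; split=> //.
  have [->|yn0] := eqVneq y 0; first by rewrite nm0.
  have y0 : 0 < nm y by rewrite nm_gt0.
  rewrite -(ler_pM2r y0) -subr_le0; apply: (@lim _ (M + nm y)); first by rewrite addr_ge0 // ltW.
  move=> n.
  have h1 : cabs '[u n, y] <= M * nm (u n) by rewrite (yl _ _ (Du n)); exact: DM.
  have h2 : cabs '[y - u n, y] <= e n * nm y.
    apply: (le_trans (cauchy_schwarz _ _)); apply: ler_wpM2r; [exact: ltW|exact: yP].
  have h3 : nm y * nm y <= cabs '[u n, y] + cabs '[y - u n, y].
    have -> : nm y * nm y = cabs '[y, y] by rewrite dot_nm cabsR ger0_norm ?exprn_ge0 ?nm_ge0.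
    have -> : '[y, y] = '[u n, y] + '[y - u n, y] by rewrite dotBl addrC subrK.
    exact: cabsD.
  have h4 : nm (u n) <= nm y + e n.
    have -> : u n = y - (y - u n) by rewrite opprB addrC subrK.
    by apply: (le_trans (nmB _ _)); rewrite lerD2l yP.
  have := ler_wpM2l M0 h4; lra.
move=> r r0; have [n nP] := e_lt r r0.
by exists (u n), (l n); split => //; exact: le_lt_trans (yP n) nP.
Qed.

End Space.

Local Notation "'[ u , v ]" := (hs_dot _ u v).

(** The Gram matrix is peeled into rank-one pieces [a_i a_j^*], on each of which the assumption on
    [N] applies; the induction is on the indices whose vector may be nonzero. *)
Lemma schur_product (I : finType) (N : I -> I -> C) (E : hilbertSpace R) (h : I -> E) :
  (forall c : I -> C, 0 <= \sum_i \sum_j N i j * (c i * (c j)^*)) ->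
  0 <= \sum_i \sum_j N i j * '[h i, h j].
Proof.
move=> psdN.
suff main (s : seq I) : forall h : I -> E, (forall i, i \notin s -> h i = 0) ->
    0 <= \sum_i \sum_j N i j * '[h i, h j].
  by apply: (main (enum I)) => i; rewrite mem_enum.
elim: s => [|n s IH] {}h hs.
  rewrite big1 // => i _; rewrite big1 // => j _.
  by rewrite (hs i) // dot0l mulr0.
have [hn0|hn] := eqVneq (h n) 0.
  apply: IH => i iNs; have [->//|inn] := eqVneq i n.
  by apply: hs; rewrite in_cons negb_or inn.
(* Gram-Schmidt step: remove from every vector its component along [h n]. *)
pose x : C := (nm (h n))%:C.
pose a i : C := '[h i, h n] / x.
pose g i : E := h i - (a i / x) *: h n.
have n0 : x != 0 by rewrite (inj_eq (@complexI R) _ 0) nm_eq0.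
have xC : x^* = x by exact: conjR.
have cx : x^-1^* = x^-1 by rewrite conjV xC.
have xx : '[h n, h n] = x * x by rewrite dot_nm rmorphXn expr2.
have aC j : (a j)^* = '[h n, h j] / x by rewrite /a conjM cx -dotC.
have E1 i j : '[h i, h j] = a i * (a j)^* + '[g i, g j].
  have -> : '[g i, g j] = '[h i, h j] - (a j)^* / x * '[h i, h n]
     - a i / x * ('[h n, h j] - (a j)^* / x * (x * x)).
    rewrite /g dotBl !dotBr !dotZl !dotZr xx [(a j / _)^*]conjM cx.
    by ring.
  by rewrite aC /a; field; exact: n0.
under eq_bigr do under eq_bigr do rewrite E1 mulrDr.
under eq_bigr do rewrite big_split /=.
rewrite big_split /= addr_ge0 //.
apply: IH => i iNs; have [->|inn] := eqVneq i n.
  by rewrite /g /a xx mulfK // divff // scale1r subrr.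
have hi0 : h i = 0 by apply: hs; rewrite in_cons negb_or inn.
by rewrite /g /a hi0 dot0l !mul0r scale0r subrr.
Qed.

End Hilbert.

(** * Kernels, membership and multipliers *)

Section ReproducingKernel.
Variables (R : realType) (X : Type) (H : hilbertFunctionSpace R X).
Local Notation C := (Cplx R).
Local Notation Re := (@complex.Re R).
Local Notation Im := (@complex.Im R).
Local Notation "z ^*" := (@Num.conj C z) : complex_scope.
Local Notation "'[ u , v ]" := (hs_dot _ u v).
Local Notation ev := (@hfs_fun R X H).
Implicit Types (u v g : H).

Lemma denseP (E : hilbertSpace R) (S : set E) :
  dense S <-> forall (g : E) (e : R), 0 < e -> exists2 v, S v & nm (v - g) < e.
Proof.
split=> [dS g e e0|HS O [g Og] oO].
  have og : nbhs g [set w : E | nm (w - g) < e] by apply/near_nm; exists e.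
  have := open_interior [set w : E | nm (w - g) < e].
  move=> /(dS _ _)[|w [/interior_subset ? ?]]; first by exists g.
  by exists w.
have /near_nm[e e0 eO] : nbhs g O by exact: open_nbhs_nbhs.
by have [v Sv vg] := HS g e e0; exists v; split => //; exact: eO.
Qed.

(* Gliding hump: each step moves the point by 3^-n so as to make its product with [y n] large. *)
Lemma uniform_boundedness (E : hilbertSpace R) (Y : set E) :
  (forall g : E, exists M : R, forall y, Y y -> cabs '[g, y] <= M) ->
  exists M : R, forall y, Y y -> nm y <= M.
Proof.
move=> Yb; apply: contrapT => Yunb.
(* Chosen so that half of [3^-n |y n|], the part of the product that survives the later moves, is
   still at least [n]. *)
have /choice[y Hy] : forall n : nat, exists y, Y y /\ 2 * 3 ^+ n * n%:R < nm y.
  move=> n; apply: contrapT => Hn; apply: Yunb; exists (2 * 3 ^+ n * n%:R) => y Yy.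
  by rewrite leNgt; apply/negP => ?; apply: Hn; exists y.
have yn0 n : 0 < nm (y n).
  by apply: le_lt_trans (Hy n).2; rewrite !mulr_ge0 // exprn_ge0.
have /choice[st Hst] : forall nx : nat * E, exists x',
    nm (x' - nx.2) <= 3^-1 ^+ nx.1 /\ 3^-1 ^+ nx.1 * nm (y nx.1) <= cabs '[x', y nx.1].
  move=> [n x] /=; set r : R := 3^-1 ^+ n; have r0 : 0 <= r by rewrite exprn_ge0.
  pose z := (r / nm (y n))%:C *: y n.
  have zr : nm z = r by rewrite nmZ cabsR ger0_norm ?divr_ge0 ?nm_ge0 // divfK // gt_eqF.
  have zy : '[z, y n] = (r * nm (y n))%:C.
    rewrite dotZl dot_nm -rmorphM /=; congr (_%:C); field; have := yn0 n; lra.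
  (* The two products differ by twice the product with [z], so one of [x + z] and [x - z] has a
     large product with [y n]. *)
  have c2 : 2 * (r * nm (y n)) <= cabs '[x + z, y n] + cabs '[x - z, y n].
    have := cabsB '[x + z, y n] '[x - z, y n]; rewrite -dotBl.
    have -> : x + z - (x - z) = 2 *: z by rewrite opprB addrC addrA subrK scaler_nat.
    rewrite dotZl zy cabsM cabs_nat cabsR ger0_norm // mulr_ge0 //; exact: nm_ge0.
  have [h|h] := leP (r * nm (y n)) (cabs '[x + z, y n]).
    by exists (x + z); rewrite addrAC subrr add0r zr.
  exists (x - z); rewrite addrAC subrr add0r nmN zr; split=> //; lra.
pose u := fix u n : E := if n is n'.+1 then st (n', u n') else 0.
have u1 n : nm (u n.+1 - u n) <= 1 * 3^-1 ^+ n by rewrite mul1r; exact: (Hst (n, u n)).1.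
have u2 n : 3^-1 ^+ n * nm (y n) <= cabs '[u n.+1, y n] := (Hst (n, u n)).2.
have r13 : 0 <= (3^-1 : R) < 1 by apply/andP; split; lra.
have [l lu] := geometric_seq ler01 r13 u1.
have [M HM] := Yb l.
have low n : n%:R <= M.
  apply: le_trans (HM _ (Hy n).1).
  have h1 := (Hy n).2.
  (* The moves after step [n] have total length at most [3^-n / 2], half of the gain made at step
     [n]. *)
  have h2 : cabs '[l - u n.+1, y n] <= 2^-1 * 3^-1 ^+ n * nm (y n).
    apply: (le_trans (cauchy_schwarz _ _)); apply: ler_wpM2r; first exact: nm_ge0.
    apply: (le_trans (lu n.+1)); rewrite exprS.
    have -> : 1 / (1 - 3^-1) * (3^-1 * 3^-1 ^+ n) = 2^-1 * 3^-1 ^+ n :> R by field.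
    by [].
  have h3 : cabs '[u n.+1, y n] <= cabs '[l, y n] + cabs '[l - u n.+1, y n].
    have -> : '[u n.+1, y n] = '[l, y n] - '[l - u n.+1, y n] by rewrite dotBl opprB addrC subrK.
    exact: cabsB.
  have h4 := u2 n.
  have h5 : n%:R <= 2^-1 * (3^-1 ^+ n * nm (y n)).
    have t0 : 0 < 3^-1 ^+ n :> R by rewrite exprn_gt0.
    have -> : n%:R = 2^-1 * (3^-1 ^+ n * (2 * 3 ^+ n * n%:R)) :> R.
      have -> : 3^-1 ^+ n * (2 * 3 ^+ n * n%:R) = (3^-1 * 3) ^+ n * (2 * n%:R) :> R.
        by rewrite exprMn; ring.
      by rewrite mulVf // expr1n; field.
    by apply: ler_wpM2l => //; apply: ler_wpM2l; apply: ltW.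
  by move: h2 h3 h4 h5; rewrite -mulrA; lra.
have := archi_boundP (low 0%N); have := low (Num.bound M); lra.
Qed.

Lemma evZD (a : C) u v x : ev (a *: u + v) x = a * ev u x + ev v x.
Proof. exact: hfs_fun_linear. Qed.

Lemma ev0 x : ev 0 x = 0.
Proof. by have := evZD (-1) 0 0 x; rewrite scaler0 addr0 mulN1r addNr. Qed.

Lemma evD u v x : ev (u + v) x = ev u x + ev v x.
Proof. by rewrite -[u]scale1r evZD mul1r scale1r. Qed.

Lemma evZ (a : C) u x : ev (a *: u) x = a * ev u x.
Proof. by rewrite -[a *: u]addr0 evZD ev0 addr0. Qed.

Lemma evN u x : ev (- u) x = - ev u x.
Proof. by rewrite -scaleN1r evZ mulN1r. Qed.

Lemma evB u v x : ev (u - v) x = ev u x - ev v x.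
Proof. by rewrite evD evN. Qed.

Lemma ev_sum (I : Type) (s : seq I) (F : I -> H) x :
  ev (\sum_(i <- s) F i) x = \sum_(i <- s) ev (F i) x.
Proof. by elim: s => [|i s IH]; rewrite ?big_nil ?ev0 // !big_cons evD IH. Qed.

Lemma ev_inj u v : (forall x, ev u x = ev v x) -> u = v.
Proof. by move=> E; apply: (@hfs_fun_inj _ _ H); apply/funext. Qed.

Variable kk : X -> H.
Hypothesis kkP : forall w u, ev u w = '[u, kk w].

Lemma gram_sum (E : hilbertSpace R) (I : finType) (c : I -> C) (h : I -> E) :
  \sum_i \sum_j c i * (c j)^* * '[h i, h j] = (nm (\sum_i c i *: h i) ^+ 2)%:C.
Proof.
rewrite -dot_nm dot_suml; apply: eq_bigr => i _; rewrite dotZl dot_sumr mulr_sumr.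
by apply: eq_bigr => j _; rewrite dotZr; ring.
Qed.

Let dot_comb (I : finType) u (d : I -> C) (x : I -> X) :
  '[u, \sum_i d i *: kk (x i)] = \sum_i (d i)^* * ev u (x i).
Proof. by rewrite dot_sumr; apply: eq_bigr => i _; rewrite dotZr kkP. Qed.

(** Riesz representation on the span of the kernels. The functional is given as a relation, since
    one vector may be written as a combination of kernels in several ways; the bound makes it
    single-valued. *)
Lemma rkhs_mem (F : X -> C) (M : R) : 0 <= M ->
  (forall n (x : 'I_n -> X) (d : 'I_n -> C),
     cabs (\sum_i (d i)^* * F (x i)) <= M * nm (\sum_i d i *: kk (x i))) ->
  exists u, ev u = F /\ nm u <= M.
Proof.
move=> M0 FM.
pose vec (s : seq (C * X)) : H := \sum_(p <- s) p.1 *: kk p.2.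
pose val (s : seq (C * X)) : C := \sum_(p <- s) p.1 * (F p.2)^*.
pose D v l := exists2 s, v = vec s & l = val s.
have D0 : D 0 0 by exists [::]; rewrite /vec /val big_nil.
have Dlin a u v k l : D u k -> D v l -> D (a *: u + v) (a * k + l).
  move=> [s -> ->] [t -> ->]; exists ([seq (a * p.1, p.2) | p <- s] ++ t).
    rewrite /vec big_cat big_map /= scaler_sumr; congr (_ + _).
    by apply: eq_bigr => p _; rewrite scalerA.
  rewrite /val big_cat big_map /= mulr_sumr; congr (_ + _).
  by apply: eq_bigr => p _; rewrite mulrA.
have DM v l : D v l -> cabs l <= M * nm v.
  move=> [s -> ->]; rewrite /vec /val !(big_tnth _ _ s).
  have := FM (size s) (fun i => (tnth (in_tuple s) i).2) (fun i => (tnth (in_tuple s) i).1).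
  rewrite -cabs_conj conj_sum.
  by under eq_bigr do rewrite conjM conjCK.
have [y [yl yM _]] := riesz M0 D0 Dlin DM.
exists y; split=> //; apply/funext => x; rewrite kkP dotC.
have -> : '[kk x, y] = (F x)^*; last by rewrite conjCK.
by apply: yl; exists [:: (1, x)]; rewrite /vec /val big_seq1 /= ?scale1r ?mul1r.
Qed.

(** The adjoint of multiplication by [phi] sends [k_w] to [phi(w)^* k_w]; the norm bound is stated
    for this adjoint on the span of the kernels. *)
Definition kbound (phi : X -> C) (M : R) : Prop := forall n (x : 'I_n -> X) (d : 'I_n -> C),
  nm (\sum_i (d i * (phi (x i))^*) *: kk (x i)) <= M * nm (\sum_i d i *: kk (x i)).

Lemma kbound_op phi M u : 0 <= M -> kbound phi M ->
  exists v, ev v = (fun x => phi x * ev u x) /\ nm v <= M * nm u.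
Proof.
move=> M0 phiM; apply: rkhs_mem; first by rewrite mulr_ge0 // nm_ge0.
move=> n x d.
have -> : \sum_i (d i)^* * (phi (x i) * ev u (x i)) =
    '[u, \sum_i (d i * (phi (x i))^*) *: kk (x i)].
  rewrite dot_comb; apply: eq_bigr => i _.
  by rewrite conjM conjCK mulrA.
apply: (le_trans (cauchy_schwarz _ _)).
have := ler_wpM2l (nm_ge0 u) (phiM n x d); lra.
Qed.

Let op_dot phi u v (I : finType) (d : I -> C) (x : I -> X) : ev v = (fun x => phi x * ev u x) ->
  '[u, \sum_i (d i * (phi (x i))^*) *: kk (x i)] = '[v, \sum_i d i *: kk (x i)].
Proof.
move=> E; rewrite !dot_comb; apply: eq_bigr => i _.
by rewrite E conjM conjCK mulrA.
Qed.

Lemma op_kbound phi M :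
  (forall u, exists v, ev v = (fun x => phi x * ev u x) /\ nm v <= M * nm u) ->
  kbound phi M.
Proof.
move=> phiM n x d; set y := \sum_i _; set s := \sum_i _.
have [v [ve vM]] := phiM y.
have E : (nm y ^+ 2)%:C = '[v, s] :> C by rewrite -dot_nm (op_dot d x ve).
have h : nm y ^+ 2 <= nm v * nm s.
  rewrite -[leLHS]ger0_norm ?sqr_ge0 // -cabsR E; exact: cauchy_schwarz.
have [->|yn0] := eqVneq y 0.
  rewrite nm0; have := nm_ge0 v; have := nm_ge0 s.
  (* [M] may be negative here, in which case the assumed norm bound forces [s = 0]. *)
  have [M0|M0] := leP 0 M; first by move=> *; rewrite mulr_ge0.
  have [s0|s0] := eqVneq s 0; first by rewrite s0 nm0 mulr0.
  have [v' [_ vM']] := phiM s.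
  have s0' : 0 < nm s by rewrite nm_gt0.
  have := nm_ge0 v'; have : M * nm s < 0 by rewrite nmulr_rlt0. lra.
have y0 : 0 < nm y by rewrite nm_gt0.
rewrite -(ler_pM2r y0) -expr2; apply: (le_trans h).
have := ler_wpM2r (nm_ge0 s) vM; lra.
Qed.

(** Uniform boundedness in place of the closed graph theorem: the adjoint images of the unit ball
    are weakly bounded, since their products with [g] are those of [phi g] with the unit ball. *)
Lemma mult_kbound phi : multiplier H phi -> exists2 M : R, 0 <= M & kbound phi M.
Proof.
move=> phim.
pose Y := [set y : H | exists n (x : 'I_n -> X) (d : 'I_n -> C),
   y = \sum_i (d i * (phi (x i))^*) *: kk (x i) /\ nm (\sum_i d i *: kk (x i)) <= 1].
have op u : exists v, ev v = (fun x => phi x * ev u x).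
  by have [|v _ <-] := phim (ev u); [exists u|exists v].
have [g|M MY] := @uniform_boundedness H Y.
  have [v ve] := op g; exists (nm v) => _ [n [x [d [-> s1]]]].
  rewrite (op_dot d x ve); apply: (le_trans (cauchy_schwarz _ _)).
  by rewrite ler_piMr // nm_ge0.
exists `|M| => // n x d.
set s := \sum_i d i *: kk (x i); set y := \sum_i _ *: _.
have [s0|sn0] := eqVneq s 0.
  have -> : y = 0; last by rewrite nm0 mulr_ge0 // nm_ge0.
  have [v ve] := op y; apply/eqP; rewrite -nm_eq0 -sqrf_eq0 -(inj_eq (@complexI R)) -dot_nm.
  by rewrite {2}/y (op_dot d x ve) -/s s0 dot0r.
have s0 : 0 < nm s by rewrite nm_gt0.
have : Y ((nm s)^-1%:C *: y).
  exists n, x, (fun i => (nm s)^-1%:C * d i); split.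
    by rewrite scaler_sumr; apply: eq_bigr => i _; rewrite scalerA mulrA.
  have -> : \sum_i ((nm s)^-1%:C * d i) *: kk (x i) = (nm s)^-1%:C *: s.
    by rewrite scaler_sumr; apply: eq_bigr => i _; rewrite scalerA.
  by rewrite nmZ cabsR ger0_norm ?invr_ge0 ?nm_ge0 // mulVf // gt_eqF.
move=> /MY; rewrite nmZ cabsR ger0_norm ?invr_ge0 ?nm_ge0 // ler_pdivrMl // => h.
by apply: (le_trans h); rewrite mulrC; apply: ler_wpM2r; [exact: ltW|exact: ler_norm].
Qed.

(** Kernels are eigenvectors of the adjoint. *)
Lemma kbound_le phi M x : kbound phi M -> kk x != 0 -> cabs (phi x) <= M.
Proof.
move=> phiM; rewrite -nm_gt0 => k0.
have := phiM 1%N (fun=> x) (fun=> 1); rewrite !big_ord1 !nmZ mul1r cabs_conj cabs1 mul1r.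
by rewrite ler_pM2r.
Qed.

Lemma kbound_mult phi M : 0 <= M -> kbound phi M -> multiplier H phi.
Proof.
move=> M0 phiM _ [u _ <-]; have [v [ve _]] := kbound_op u M0 phiM.
by exists v.
Qed.

End ReproducingKernel.

(** * Factorization in the complete Pick norm *)

Section CompletePick.
Variables (R : realType) (X : Type) (H : hilbertFunctionSpace R X).
Local Notation C := (Cplx R).
Local Notation Re := (@complex.Re R).
Local Notation Im := (@complex.Im R).
Local Notation "z ^*" := (@Num.conj C z) : complex_scope.
Local Notation "'[ u , v ]" := (hs_dot _ u v).
Local Notation ev := (@hfs_fun R X H).
Variables (kk : X -> H) (k : X -> X -> C).
Hypotheses (kkP : forall w u, ev u w = '[u, kk w]) (evk : forall w, ev (kk w) = k w).
Variables (w0 : X) (K : hilbertSpace R) (b : X -> K).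
Hypotheses (b0 : b w0 = 0) (kb : forall w z, 1 - '[b z, b w] != 0 /\ k w z = 1 / (1 - '[b z, b w])).
Local Notation bb w z := '[b z, b w].

Let k_dot w z : '[kk w, kk z] = k w z.
Proof. by rewrite -kkP evk. Qed.

Let k_bb w z : (1 - bb w z) * k w z = 1.
Proof. by have [n0 ->] := kb w z; rewrite mulrC divfK. Qed.

Let k_n0 w z : k w z != 0.
Proof.
apply/eqP => E; have := k_bb w z; rewrite E mulr0 => /eqP.
by rewrite eq_sym oner_eq0.
Qed.

Lemma nm_b_lt1 z : nm (b z) < 1.
Proof.
have E : (1 - nm (b z) ^+ 2) * nm (kk z) ^+ 2 = 1.
  apply: (@complexI R); rewrite rmorphM rmorphB -[RHS](k_bb z z) /=.
  by rewrite -!dot_nm k_dot.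
rewrite -(@ltr_pXn2r _ 2) ?nnegrE ?nm_ge0 // expr1n -subr_gt0.
rewrite ltNge; apply/negP => le0.
have := mulr_le0_ge0 le0 (exprn_ge0 2 (nm_ge0 (kk z))); rewrite E; lra.
Qed.

Lemma kk_neq0 z : kk z != 0.
Proof.
by apply/eqP => E; have := k_n0 z z; rewrite -k_dot E dot0l eqxx.
Qed.

Let ev1 x : ev (kk w0) x = 1.
Proof. by rewrite evk; have := k_bb w0 x; rewrite b0 dot0r subr0 mul1r. Qed.

(* The map [k_w |-> (1, b(w)^* (x) k_w)] is an isometry into C + K^* (x) H; its adjoint
   is the row operator [(c, h) |-> c + b h], hence a contraction. *)
Lemma pick_row (I : finType) (y : I -> X) (h : I -> H) (c : C) :
  exists v : H, (forall x, ev v x = c + \sum_i bb (y i) x * ev (h i) x) /\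
    (nm v ^+ 2)%:C <= (cabs c ^+ 2)%:C + \sum_i \sum_j bb (y i) (y j) * '[h i, h j].
Proof.
have psd (J : finType) (z : J -> X) (g : J -> H) :
    0 <= \sum_i \sum_j bb (z i) (z j) * '[g i, g j].
  apply: schur_product => e.
  rewrite (_ : \sum_i _ = (nm (\sum_i (e i)^* *: b (z i)) ^+ 2)%:C).
    by rewrite (lecR 0) exprn_ge0 // nm_ge0.
  rewrite -gram_sum exchange_big; apply: eq_bigr => i _; apply: eq_bigr => j _.
  by rewrite conjCK; ring.
set T := \sum_i _.
have T0 : 0 <= T by exact: psd.
have TE : T = (Re T)%:C by rewrite RRe_real // ger0_real.
set a := cabs c ^+ 2 + Re T.
have a0 : 0 <= a by rewrite addr_ge0 ?exprn_ge0 ?cabs_ge0 // -lecR -TE.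
pose F x := c + \sum_i bb (y i) x * ev (h i) x.
have [||v [vF vM]] := @rkhs_mem _ _ _ _ kkP F (Num.sqrt a); last first.
- exists v; split=> [x|]; first by rewrite vF.
  rewrite TE -rmorphD lecR -/a -(sqr_sqrtr a0).
  by apply: lerXn2r; rewrite ?nnegrE ?nm_ge0 ?sqrtr_ge0.
- move=> n x d; set s := \sum_i d i *: kk (x i).
  rewrite -(@ler_pXn2r _ 2) ?nnegrE ?cabs_ge0 ?mulr_ge0 ?nm_ge0 ?sqrtr_ge0 // exprMn sqr_sqrtr //.
  apply: discriminant_le; first by rewrite exprn_ge0 // nm_ge0.
  move=> t.
  pose S := \sum_i d i.
  pose Q := \sum_m (d m)^* * \sum_i bb (y i) (x m) * ev (h i) (x m).
  have FE : \sum_i (d i)^* * F (x i) = c * S^* + Q.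
    rewrite /F /S conj_sum mulr_sumr -big_split /=; apply: eq_bigr => i _.
    by rewrite mulrDr [c * _]mulrC.
  (* Positivity is tested on the given vectors together with multiples of the kernels at the points
     [x m]; the cross terms become the part of the quadratic form that is linear in [t]. *)
  pose z (m : I + 'I_n) := match m with inl i => y i | inr m => x m end.
  pose g (m : I + 'I_n) := match m with inl i => h i | inr m => (t^* * d m) *: kk (x m) end.
  have := psd _ z g.
  rewrite big_sumType /=.
  under eq_bigr do rewrite big_sumType /=.
  under [X in _ + X]eq_bigr do rewrite big_sumType /=.
  rewrite !big_split /= -/T.
  have -> : \sum_i \sum_j bb (y i) (x j) * '[h i, (t^* * d j) *: kk (x j)] = t * Q.
    rewrite exchange_big /Q mulr_sumr; apply: eq_bigr => m _.
    rewrite !mulr_sumr; apply: eq_bigr => i _.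
    by rewrite dotZr -kkP conjM conjCK; ring.
  have -> : \sum_j \sum_i bb (x j) (y i) * '[(t^* * d j) *: kk (x j), h i] = (t * Q)^*.
    rewrite conjM /Q conj_sum mulr_sumr; apply: eq_bigr => m _.
    rewrite conjM conjCK conj_sum !mulr_sumr; apply: eq_bigr => i _.
    rewrite dotZl conjM kkP -!dotC.
    by ring.
  (* For kernels [b k = k - 1], so this block is the norm of [s] with the scalar square [|S|^2]
     taken off. *)
  have -> : \sum_i \sum_j bb (x i) (x j) * '[(t^* * d i) *: kk (x i), (t^* * d j) *: kk (x j)]
     = (cabs t ^+ 2 * (nm s ^+ 2 - cabs S ^+ 2))%:C.
    have -> : (cabs t ^+ 2 * (nm s ^+ 2 - cabs S ^+ 2))%:C
       = t * t^* * (\sum_i \sum_j d i * (d j)^* * '[kk (x i), kk (x j)] - S * S^*).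
      by rewrite gram_sum !mulC_conj -rmorphB -rmorphM.
    have -> : S * S^* = \sum_i \sum_j d i * (d j)^*.
      rewrite /S conj_sum mulr_suml; apply: eq_bigr => i _; rewrite mulr_sumr //.
    rewrite -sumrB mulr_sumr; apply: eq_bigr => i _.
    rewrite -sumrB mulr_sumr; apply: eq_bigr => j _.
    rewrite dotZl dotZr conjM conjCK k_dot.
    have := k_bb (x i) (x j).
    move: (bb _ _) (k _ _) (d i) ((d j)^*) (t^*) => b1 k1 d1 d2 t1 E.
    have -> : b1 * (t1 * d1 * (t * d2 * k1)) = t * t1 * (d1 * d2) * (k1 - (1 - b1) * k1) by ring.
    by rewrite E; ring.
  rewrite TE FE lecE /= => /andP[_]; rewrite !ReD Re_conj /= => h1.
  (* The scalar component of the row: adding this square cancels [|t|^2 |S|^2] and supplies the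
     terms in [c]. *)
  have := exprn_ge0 2 (cabs_ge0 (c + t^* * S)).
  have -> : cabs (c + t^* * S) ^+ 2 = cabs c ^+ 2 + 2 * Re (t * (c * S^*)) + cabs t ^+ 2 * cabs S ^+ 2.
    apply: (@complexI R); rewrite -mulC_conj conjD conjM conjCK.
    rewrite !rmorphD (rmorphM _ (cabs t ^+ 2)) /= -!mulC_conj.
    have -> : (2 * Re (t * (c * S^*)))%:C = t * (c * S^*) + (t * (c * S^*))^*.
      by apply: complex_eqP; rewrite ?ReD ?ImD ?Re_conj ?Im_conj /=; lra.
    by rewrite !conjM !conjCK; ring.
  rewrite [t * (_ + _)]mulrDr ReD /a; move: h1.
  move: (Re (t * Q)) (Re (t * (c * S^*))) (Re T) (cabs c ^+ 2) (cabs t ^+ 2) (nm s ^+ 2) (cabs S ^+ 2).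
  by move=> x1 x2 x3 x4 x5 x6 x7; lra.
- by rewrite sqrtr_ge0.
Qed.

Lemma beta_op z (u : H) :
  exists v : H, ev v = (fun x => bb z x * ev u x) /\ nm v <= nm (b z) * nm u.
Proof.
have su (F : unit -> C) : \sum_i F i = F tt by rewrite (big_pred1 tt) //; case.
have [v [ve vM]] := @pick_row unit (fun=> z) (fun=> u) 0.
exists v; split; first by apply/funext => x; rewrite ve add0r su.
move: vM; rewrite cabs0 expr0n add0r !su !dot_nm -rmorphM lecR -exprMn.
by rewrite ler_pXn2r ?nnegrE ?mulr_ge0 ?nm_ge0.
Qed.

(** [k_z = 1 / (1 - beta)] where multiplication by [beta] has norm at most [|b z| < 1]; the adjoint
    of [1 - beta] is bounded below by [1 - |b z|]. *)
Lemma kernel_op z h : exists g : H, forall x, ev g x = k z x * ev h x.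
Proof.
have r1 := nm_b_lt1 z; have r0 := nm_ge0 (b z).
have beta : kbound kk (fun x => bb z x) (nm (b z)) by apply: (op_kbound kkP) => u; exact: beta_op.
have M0 : 0 <= (1 - nm (b z))^-1 by rewrite invr_ge0; lra.
have kbd : kbound kk (k z) (1 - nm (b z))^-1.
  move=> n x d; set s := \sum_i d i *: kk (x i).
  pose d' i := d i * (k z (x i))^*; rewrite -/d'.
  have := beta n x d'; set s' := \sum_i d' i *: kk (x i); set s2 := \sum_i _ => h1.
  have E : s = s' - s2.
    rewrite /s' /s2 -sumrB; apply: eq_bigr => i _; rewrite -scalerBl; congr (_ *: _).
    have c1 : (1 : C)^* = 1 by exact: rmorph1.
    have := congr1 (@Num.conj C) (k_bb z (x i)); rewrite conjM conjB c1 /d'.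
    move: (_^*) (_^*) (d i) => x1 x2 x3 e1.
    by rewrite -{1}[x3]mulr1 -e1; ring.
  have h2 : nm s' <= nm s + nm s2.
    have -> : s' = s + s2 by rewrite E subrK.
    exact: nmD.
  rewrite ler_pdivlMl; last by lra.
  lra.
have [v [ve _]] := kbound_op kkP h M0 kbd.
by exists v => x; rewrite ve.
Qed.

(** The Schur product of the positive matrix with [k] turns [(1 - b) k] into 1, so
    [(1 - theta^* theta) k] dominates the Gram matrix of [zeta] and is positive. *)
Lemma pick_contractive (theta : X -> C) (zeta : X -> H) :
  (forall n (x : 'I_n -> X) (c : 'I_n -> C), 0 <= \sum_i \sum_j
     (1 - (theta (x i))^* * theta (x j) - (1 - bb (x i) (x j)) * '[zeta (x i), zeta (x j)])
       * (c i * (c j)^*)) ->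
  kbound kk theta 1.
Proof.
move=> psd n x d; rewrite mul1r.
have := schur_product (fun i => d i *: kk (x i)) (psd n x).
have -> : \sum_i \sum_j (1 - (theta (x i))^* * theta (x j)
     - (1 - bb (x i) (x j)) * '[zeta (x i), zeta (x j)]) * '[d i *: kk (x i), d j *: kk (x j)]
   = (nm (\sum_i d i *: kk (x i)) ^+ 2)%:C
     - (nm (\sum_i (d i * (theta (x i))^*) *: kk (x i)) ^+ 2)%:C
     - (nm (\sum_i d i *: zeta (x i)) ^+ 2)%:C.
  rewrite -!gram_sum -!sumrB; apply: eq_bigr => i _; rewrite -!sumrB; apply: eq_bigr => j _.
  rewrite dotZl dotZr k_dot conjM conjCK.
  have := k_bb (x i) (x j).
  move: (bb (x i) (x j)) (k (x i) (x j)) (d i) ((d j)^*) ((theta (x i))^*) (theta (x j)).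
  move: '[zeta (x i), zeta (x j)].
  move=> z1 b1 k1 d1 d2 t1 t2 E.
  have -> : (1 - t1 * t2 - (1 - b1) * z1) * (d1 * (d2 * k1)) =
    d1 * d2 * (k1 - t1 * t2 * k1 - (1 - b1) * k1 * z1) by ring.
  by rewrite E; ring.
rewrite -!rmorphB (lecR 0) => h.
rewrite -(@ler_pXn2r _ 2) ?nnegrE ?nm_ge0 //.
by have := exprn_ge0 2 (nm_ge0 (\sum_i d i *: zeta (x i))); lra.
Qed.

Section Factor.
Variables (f : H) (Kf : X -> H).
Hypotheses (f1 : nm f = 1) (KfP : forall z x, ev (Kf z) x = k z x * ev f x).

Let A z := '[f, Kf z].

Let AC z : '[Kf z, f] = (A z)^*.
Proof. exact: dotC. Qed.

(** [f = (1 - beta) Kf] with [|beta| < 1] as an operator: if [Kf] is orthogonal to [f], then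
    [|Kf|^2 <= |b z| |Kf|^2], so [Kf] and with it [f] vanish. *)
Let A_neq0 z : A z != 0.
Proof.
apply/eqP => A0; have [v [ve vM]] := beta_op z (Kf z).
have fE : f = Kf z - v.
  apply: ev_inj => x; rewrite evB ve KfP; have := k_bb z x.
  move: (bb z x) (k z x) (ev f x) => b1 k1 f1' E.
  by rewrite -{1}[f1']mul1r -E; ring.
have : '[f, Kf z] = 0 by [].
rewrite fE dotBl dot_nm => /eqP; rewrite subr_eq0 => /eqP E.
have r1 := nm_b_lt1 z.
have K0 : nm (Kf z) = 0.
  apply/eqP; apply: contraT => Kn0.
  have Kp : 0 < nm (Kf z) by rewrite lt_def Kn0 nm_ge0.
  have h : nm (Kf z) ^+ 2 <= nm v * nm (Kf z).
    rewrite -[leLHS]ger0_norm ?sqr_ge0 // -cabsR E; exact: cauchy_schwarz.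
  move: h; rewrite expr2 ler_pM2r // => h.
  have : nm (b z) * nm (Kf z) < 1 * nm (Kf z) by rewrite ltr_pM2r.
  lra.
have v0 : nm v = 0 by apply/eqP; rewrite eq_le nm_ge0 andbT; move: vM; rewrite K0 mulr0.
have := nmB (Kf z) v; rewrite -fE f1 K0 v0; lra.
Qed.

Let AC_neq0 z : (A z)^* != 0.
Proof. by rewrite conjC_eq0. Qed.

(* [f = phi / (1 - psi)] with two contractive multipliers [phi] and [psi]. *)
Let phi z : C := ev f z / A z.
Let psi z : C := 1 - (A z)^-1.

Let gram_form n (x : 'I_n -> X) (c : 'I_n -> C) (theta : X -> C) (zeta : X -> H) :
  \sum_i \sum_j
     (1 - (theta (x i))^* * theta (x j) - (1 - bb (x i) (x j)) * '[zeta (x i), zeta (x j)])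
       * (c i * (c j)^*) =
  (cabs (\sum_i c i) ^+ 2)%:C - (cabs (\sum_i c i * (theta (x i))^*) ^+ 2)%:C
   - (nm (\sum_i c i *: zeta (x i)) ^+ 2)%:C
   + \sum_i \sum_j bb (x i) (x j) * '[c i *: zeta (x i), c j *: zeta (x j)].
Proof.
rewrite -gram_sum -!mulC_conj !conj_sum !mulr_suml -!sumrB -big_split /=.
apply: eq_bigr => i _; rewrite !mulr_sumr -!sumrB -big_split /=.
apply: eq_bigr => j _; rewrite dotZl dotZr conjM conjCK.
by move: (theta (x i))^* (c j)^* => t1 c1; ring.
Qed.

(** [zeta] is made orthogonal to [f]. The row operator then yields [v = P f + Z] with orthogonal
    summands, and the bound of [pick_row] on [|P|^2 + |Z|^2] is exactly the positivity asked for. *)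
Let phi_contractive : kbound kk phi 1.
Proof.
pose zeta z := kk z - (phi z)^* *: Kf z.
have zf z : '[zeta z, f] = 0.
  rewrite /zeta dotBl dotZl AC dotC -kkP /phi conjM conjV divfK ?subrr //.
apply: (@pick_contractive _ zeta) => n x c; rewrite gram_form.
set S := \sum_i c i; set P := \sum_i c i * _; set Z := \sum_i c i *: zeta _.
have [v [ve vM]] := pick_row x (fun i => c i *: zeta (x i)) S.
have vE : v = P *: f + Z.
  apply: ev_inj => y; rewrite ve evD evZ /P /Z ev_sum mulr_suml -!big_split /=.
  apply: eq_bigr => i _; rewrite evZ /zeta evB evZ KfP evk.
  have := k_bb (x i) y.
  move: (bb (x i) y) (k (x i) y) (ev f y) (phi (x i))^* (c i) => b1 k1 f1' p1 c1 E.
  have -> : c1 + b1 * (c1 * (k1 - p1 * (k1 * f1'))) =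
    c1 * (1 + (k1 - (1 - b1) * k1) * (1 - p1 * f1')) by ring.
  by rewrite E; ring.
have nv : nm v ^+ 2 = cabs P ^+ 2 + nm Z ^+ 2.
  rewrite vE nm_sqrD nmZ f1 mulr1 dotZl.
  have -> : '[f, Z] = 0.
    rewrite dotC /Z dot_suml big1 => [|i _]; first by exact: rmorph0.
    by rewrite dotZl zf mulr0.
  by rewrite mulr0 /=; lra.
move: vM; rewrite nv rmorphD /= -subr_ge0.
by congr (0 <= _); ring.
Qed.

(** Here [zeta] is normalised to have product 1 with [f]. Then [v = Z - (S - P) f] and
    [|v|^2 = |Z|^2 - |S|^2 + |P|^2], which again turns the row bound into positivity. *)
Let psi_contractive : kbound kk psi 1.
Proof.
pose zeta z := ((A z)^*)^-1 *: Kf z.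
have zf z : '[zeta z, f] = 1 by rewrite /zeta dotZl AC mulVf.
apply: (@pick_contractive _ zeta) => n x c; rewrite gram_form.
set S := \sum_i c i; set P := \sum_i c i * _; set Z := \sum_i c i *: zeta _.
have [v [ve vM]] := pick_row x (fun i => c i *: zeta (x i)) 0.
have vE : v = Z - (S - P) *: f.
  apply: ev_inj => y; rewrite ve add0r evB evZ /S /P /Z ev_sum -sumrB mulr_suml -!sumrB /=.
  apply: eq_bigr => i _; rewrite evZ /zeta evZ KfP /psi conjB conjV.
  have c1' : (1 : C)^* = 1 by exact: rmorph1.
  rewrite c1'; have := k_bb (x i) y.
  move: (bb (x i) y) (k (x i) y) (ev f y) ((A (x i))^*)^-1 (c i) => b1 k1 f1' p1 c1 E.
  have -> : b1 * (c1 * (p1 * (k1 * f1'))) = c1 * p1 * f1' * (k1 - (1 - b1) * k1) by ring.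
  by rewrite E; ring.
have Zf : '[Z, f] = S.
  by rewrite /Z dot_suml; apply: eq_bigr => i _; rewrite dotZl zf mulr1.
have nv : nm v ^+ 2 = nm Z ^+ 2 - cabs S ^+ 2 + cabs P ^+ 2.
  rewrite vE nm_sqrB dotZr Zf nmZ f1 mulr1.
  rewrite !sqr_cabs ReM Re_conj Im_conj ReD ImD ReN ImN.
  by move: (nm Z) (Re S) (Im S) (Re P) (Im P) => x0 x1 x2 x3 x4; ring.
move: vM; rewrite nv cabs0 expr0n add0r rmorphD rmorphB /= -subr_ge0.
by congr (0 <= _); ring.
Qed.

Let q z : C := (A z)^-1.

Let q_op u : exists2 p : H, nm p <= nm u & ev (u - p) = (fun x => q x * ev u x).
Proof.
have [p [pe pM]] := kbound_op kkP u ler01 psi_contractive.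
exists p; first by rewrite -[nm u]mul1r.
by apply/funext => x; rewrite evB pe /psi /q; ring.
Qed.

Let q_mult : multiplier H q.
Proof. by move=> _ [u _ <-]; have [p _ pE] := q_op u; exists (u - p). Qed.

(* If [r] is orthogonal to [q H] then [psi r = r] since [psi] is contractive, so [q r = 0]. *)
Let q_cyclic : cyclic H q.
Proof.
have q1 : ev (kk w0) = (fun=> 1) by apply/funext => x; exact: ev1.
split.
  have [p _ pE] := q_op (kk w0); exists (kk w0 - p) => //.
  by rewrite pE q1; apply/funext => x; rewrite mulr1.
apply/denseP => g e e0.
pose S := [set g : H | exists2 th, multiplier H th & ev g = (fun x => th x * q x)].
pose D (v : H) (l : C) := S v /\ l = '[v, g].
have S_lin a u v : S u -> S v -> S (a *: u + v).
  move=> [t1 t1m u1] [t2 t2m v2]; exists (fun x => a * t1 x + t2 x); last first.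
    by apply/funext => x; rewrite evZD u1 v2; ring.
  move=> h hH; have [h1 _ h1E] := t1m h hH; have [h2 _ h2E] := t2m h hH.
  exists (a *: h1 + h2) => //; apply/funext => x; rewrite evZD h1E h2E; ring.
have S0 : S 0.
  exists (fun=> 0); last by apply/funext => x; rewrite ev0 mul0r.
  by move=> h _; exists 0 => //; apply/funext => x; rewrite ev0 mul0r.
have D0 : D 0 0 by split=> //; rewrite dot0l.
have Dlin a u v i j : D u i -> D v j -> D (a *: u + v) (a * i + j).
  by move=> [Su ->] [Sv ->]; split; [exact: S_lin|rewrite dotDl dotZl].
have DM v l : D v l -> cabs l <= nm g * nm v.
  by move=> [_ ->]; rewrite mulrC; exact: cauchy_schwarz.
(* [y] is the projection of [g] to the closure of the multiples of [q]; the remainder [r] has to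
   vanish. *)
have [y [yl _ yS]] := riesz (nm_ge0 g) D0 Dlin DM.
set r := g - y.
have rS v : S v -> '[v, r] = 0.
  by move=> Sv; rewrite dotBr (yl v '[v, g]) ?subrr.
have rk w (v : H) : ev v = (fun x => q x * k w x) -> '[v, r] = 0.
  move=> ve; apply: rS; exists (k w); last by rewrite ve; apply/funext => x; rewrite mulrC.
  move=> _ [h _ <-]; have [g' g'E] := kernel_op w h; exists g' => //.
  by apply/funext.
(* The functional sending [h] to the product of [q h] with [r] is bounded and vanishes on kernels:
   [k_w] is a multiplier, so [q k_w] lies in [S]. Hence its representing vector [s] is 0, and [r] is
   orthogonal to all of [q H]. *)
pose D' (h : H) (l : C) := exists2 v : H, ev v = (fun x => q x * ev h x) & l = '[v, r].
have D'0 : D' 0 0.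
  by exists 0; [apply/funext => x; rewrite ev0 mulr0|rewrite dot0l].
have D'lin a u v i j : D' u i -> D' v j -> D' (a *: u + v) (a * i + j).
  move=> [u' u'E ->] [v' v'E ->]; exists (a *: u' + v'); last by rewrite dotDl dotZl.
  by apply/funext => x; rewrite !evZD u'E v'E; ring.
have r20 : 0 <= 2 * nm r by rewrite mulr_ge0 // nm_ge0.
have D'M h l : D' h l -> cabs l <= 2 * nm r * nm h.
  move=> [v vE ->]; have [p pM pE] := q_op h.
  have -> : v = h - p by apply: ev_inj => x; rewrite vE pE.
  apply: (le_trans (cauchy_schwarz _ _)); have := nmB h p => hp.
  have : nm (h - p) * nm r <= (2 * nm h) * nm r by apply: ler_wpM2r; [exact: nm_ge0|lra].
  lra.
have [s [sl _ _]] := riesz r20 D'0 D'lin D'M.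
have s0 : s = 0.
  apply: ev_inj => w; rewrite ev0 kkP dotC.
  have [p _ pE] := q_op (kk w).
  have -> : '[kk w, s] = 0; last exact: rmorph0.
  rewrite (sl _ '[kk w - p, r]); last by exists (kk w - p).
  by apply: (rk w); rewrite pE evk.
have [p pM pE] := q_op r.
have rp : '[r - p, r] = 0.
  by rewrite -(sl r '[r - p, r]); [rewrite s0 dot0r|exists (r - p)].
(* With [p = psi r] and the product of [p] and [r] equal to [|r|^2], one gets
   [|r - p|^2 = |p|^2 - |r|^2 <= 0]. *)
have rp0 : r - p = 0.
  apply/eqP; rewrite -nm_eq0 -sqrf_eq0 eq_le sqr_ge0 andbT.
  have : '[p, r] = (nm r ^+ 2)%:C.
    by move: rp; rewrite dotBl dot_nm => /eqP; rewrite subr_eq0 => /eqP.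
  move=> pr; rewrite nm_sqrB dotC pr Re_conj /=.
  have : nm p ^+ 2 <= nm r ^+ 2 by apply: lerXn2r; rewrite ?nnegrE ?nm_ge0.
  lra.
have r0 : r = 0.
  apply: ev_inj => x; rewrite ev0; have := congr1 (fun u => ev u x) rp0.
  rewrite /= pE ev0 => /eqP; rewrite mulf_eq0 invr_eq0 (negbTE (A_neq0 x)) /=.
  by move=> /eqP.
have [v [l [[Sv _] vy]]] := yS e e0; exists v => //.
have -> : g = y by apply/eqP; rewrite -subr_eq0 -/r r0.
by rewrite nmBC.
Qed.

Lemma unit_factor : exists phi q, [/\ multiplier H phi, multiplier H q, cyclic H q,
  forall x, q x != 0 & forall x, phi x = ev f x * q x].
Proof.
exists phi, q; split=> //; first exact: (kbound_mult kkP ler01 phi_contractive).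
by move=> x; rewrite invr_eq0.
Qed.

End Factor.

Lemma pick_factor (g : X -> C) : hfs_set H g -> exists phi q,
  [/\ multiplier H phi, multiplier H q, cyclic H q,
      forall x, q x != 0 & forall x, phi x = g x * q x].
Proof.
move=> [f _ <-].
have main u : u != 0 -> exists phi q,
  [/\ multiplier H phi, multiplier H q, cyclic H q,
      forall x, q x != 0 & forall x, phi x = ev u x * q x].
  move=> un0; have u0 : 0 < nm u by rewrite nm_gt0.
  pose c : C := (nm u)^-1%:C.
  have /choice[Kf KfP] := kernel_op^~ (c *: u).
  have n1 : nm (c *: u) = 1 by rewrite nmZ cabsR ger0_norm ?invr_ge0 ?nm_ge0 // mulVf // gt_eqF.
  have [phi [q [pm qm qc q0 pq]]] := unit_factor n1 KfP.
  exists (fun x => (nm u)%:C * phi x), q; split=> //.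
    move=> h hH; have [v _ vE] := pm h hH; exists ((nm u)%:C *: v) => //.
    by apply/funext => x; rewrite evZ vE mulrA.
  move=> x; rewrite pq evZ !mulrA -rmorphM divff ?gt_eqF // mul1r //.
(* The zero function cannot be normalised; its denominator is borrowed from the kernel at [w0]. *)
have [f0|fn0] := eqVneq f 0; last exact: main.
have [phi [q [pm qm qc q0 pq]]] := main _ (kk_neq0 w0).
exists (fun=> 0), q; split=> //.
  by move=> h _; exists 0 => //; apply/funext => x; rewrite ev0 mul0r.
by move=> x; rewrite f0 ev0 mul0r.
Qed.

End CompletePick.

(** * Transfer to an equivalent norm; cyclic functions *)

Section CompletePickSpaces.
Variables (R : realType) (X : Type) (H : hilbertFunctionSpace R X).
Local Notation C := (Cplx R).
Local Notation ev := (@hfs_fun R X H).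

(** Multipliers depend only on the set of functions; norm estimates and density are carried across
    by this identification of the two spaces. *)
Let equiv_transfer (H' : hilbertFunctionSpace R X) : equivalent_norms H H' ->
  exists tr : H -> H', [/\ forall u, hfs_fun (tr u) = ev u,
    exists2 c : R, 0 < c & forall u v, nm (u - v) <= c * nm (tr u - tr v) &
    exists2 c : R, 0 < c & forall u, nm (tr u) <= c * nm u].
Proof.
move=> [setE [_ [_ [/posC[c1 c10 ->] /posC[c2 c20 ->] eqn]]]].
have /choice[tr trE] : forall u : H, exists u' : H', hfs_fun u' = ev u.
  move=> u; have : hfs_set H (ev u) by exists u.
  by rewrite setE => -[u' _ <-]; exists u'.
exists tr; split=> //.
  exists c1^-1; first by rewrite invr_gt0.
  move=> u v; rewrite ler_pdivlMl //.
  have E : ev (u - v) = hfs_fun (tr u - tr v).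
    by apply/funext => x; rewrite !evB !trE.
  by have [] := eqn _ _ E; rewrite !nmE -rmorphM lecR.
exists c2 => // u; have [_] := eqn u (tr u) (esym (trE u)).
by rewrite !nmE -rmorphM lecR.
Qed.

Let cyclic_transfer (H' : hilbertFunctionSpace R X) f :
  equivalent_norms H H' -> cyclic H' f -> cyclic H f.
Proof.
move=> eqn [fH fd]; have [setE _] := eqn.
have [tr [trE [c c0 cP] _]] := equiv_transfer eqn.
split; first by rewrite setE.
apply/denseP => g e e0.
have [v' [th thm v'E] v'g] := (denseP _).1 fd (tr g) (e / c) (divr_gt0 e0 c0).
have [v _ vE] : hfs_set H (hfs_fun v') by rewrite setE; exists v'.
have trv : tr v = v' by apply: ev_inj => x; rewrite trE vE.
exists v; first by exists th; [move: thm; rewrite /multiplier setE|rewrite vE].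
apply: le_lt_trans (cP v g) _; rewrite trv.
by move: v'g; rewrite ltr_pdivlMr // mulrC.
Qed.

Hypothesis H_pick : complete_pick H.

Let kernel_data : exists (H' : hilbertFunctionSpace R X) (kk : X -> H') k w0
    (K : hilbertSpace R) (b : X -> K),
  [/\ equivalent_norms H H', forall w u, hfs_fun u w = hs_dot H' u (kk w),
      forall w, hfs_fun (kk w) = k w, b w0 = 0 & forall w z, 1 - hs_dot K (b z) (b w) != 0 /\
                k w z = 1 / (1 - hs_dot K (b z) (b w))].
Proof.
have [H' [eqn [k rk [w0 [K [b [b0 kb]]]]]]] := H_pick.
have /choice[kk kkE] : forall w, exists kw : H', hfs_fun kw = k w /\
    forall f : H', hfs_fun f w = hs_dot H' f kw by move=> w; have [kw ? ?] := rk w; exists kw.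
by exists H', kk, k, w0, K, b; split=> // w; [move=> u|]; have [] := kkE w.
Qed.

Lemma pick_multiplier_bounded phi : multiplier H phi -> exists2 M : R, 0 <= M &
  forall u v : H, ev v = (fun x => phi x * ev u x) -> nm v <= M * nm u.
Proof.
move=> phim; have [H' [kk [k [w0 [K [b [eqn kkP evk b0 kb]]]]]]] := kernel_data.
have [setE _] := eqn; have [tr [trE [c c0 cP] [c2 c20 c2P]]] := equiv_transfer eqn.
have phim' : multiplier H' phi by move: phim; rewrite /multiplier setE.
have [M M0 kM] := mult_kbound kkP phim'.
exists (c * (M * c2)); first by rewrite !mulr_ge0 // ltW.
move=> u v vE; have [v' [v'E v'M]] := kbound_op kkP (tr u) M0 kM.
have trv : tr v = v' by apply: ev_inj => x; rewrite trE vE v'E trE.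
have tr0 : tr 0 = 0 by apply: ev_inj => x; rewrite trE !ev0.
have := cP v 0; rewrite tr0 !subr0 trv => h1.
apply: (le_trans h1); rewrite -mulrA; apply: ler_wpM2l; first exact: ltW.
by apply: (le_trans v'M); rewrite -mulrA; apply: ler_wpM2l.
Qed.

Lemma pick_multiplier_le phi : multiplier H phi ->
  exists Q : R, forall x, cabs (phi x) <= Q.
Proof.
move=> phim; have [H' [kk [k [w0 [K [b [eqn kkP evk b0 kb]]]]]]] := kernel_data.
have phim' : multiplier H' phi by move: phim; rewrite /multiplier eqn.1.
have [M M0 kM] := mult_kbound kkP phim'; exists M => x.
exact: (kbound_le kM (kk_neq0 kkP evk kb x)).
Qed.

Lemma pick_eval_le x : exists c : R, forall u : H, cabs (ev u x) <= c * nm u.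
Proof.
have [H' [kk [k [w0 [K [b [eqn kkP evk b0 kb]]]]]]] := kernel_data.
have [tr [trE _ [c2 c20 c2P]]] := equiv_transfer eqn.
exists (nm (kk x) * c2) => u; rewrite -trE kkP.
apply: (le_trans (cauchy_schwarz _ _)); rewrite mulrC -mulrA.
by apply: ler_wpM2l; [exact: nm_ge0|exact: c2P].
Qed.

Lemma pick_space_factor g : hfs_set H g -> exists phi q,
  [/\ multiplier H phi, multiplier H q, cyclic H q,
      forall x, q x != 0 & forall x, phi x = g x * q x].
Proof.
move=> gH; have [H' [kk [k [w0 [K [b [eqn kkP evk b0 kb]]]]]]] := kernel_data.
have gH' : hfs_set H' g by rewrite -eqn.1.
have [phi [q [pm qm qc q0 pq]]] := pick_factor kkP evk b0 kb gH'.
exists phi, q; split=> //; try by move: pm qm; rewrite /multiplier eqn.1.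
exact: cyclic_transfer eqn qc.
Qed.

Lemma pick_smirnov_mem g : hfs_set H g -> pick_smirnov H g.
Proof.
move=> /pick_space_factor[phi [q [pm qm qc q0 pq]]]; exists phi, q; split=> //.
by apply/funext => x; rewrite pq mulfK.
Qed.

Lemma mult_mul phi psi : multiplier H phi -> multiplier H psi ->
  multiplier H (fun x => phi x * psi x).
Proof.
move=> pm qm h hH; have := pm _ (qm h hH).
by have -> : (fun x => phi x * (psi x * h x)) = (fun x => phi x * psi x * h x);
  [apply/funext => x; rewrite mulrA|].
Qed.

Lemma mult_lin (a : C) phi psi : multiplier H phi -> multiplier H psi ->
  multiplier H (fun x => a * phi x + psi x).
Proof.
move=> pm qm h hH; have [u _ uE] := pm h hH; have [v _ vE] := qm h hH.
by exists (a *: u + v) => //; apply/funext => x; rewrite evZD uE vE mulrDl mulrA.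
Qed.

Lemma mult_cst (a : C) : multiplier H (fun=> a).
Proof.
by move=> _ [u _ <-]; exists (a *: u) => //; apply/funext => x; rewrite evZ.
Qed.

Lemma mult_pow phi n : multiplier H phi -> multiplier H (fun x => phi x ^+ n).
Proof.
move=> pm; elim: n => [|n IH]; first exact: mult_cst.
by have := mult_mul pm IH; under eq_fun do rewrite -exprS.
Qed.

Lemma cyclicP f : cyclic H f <-> hfs_set H f /\ forall (g : H) (e : R), 0 < e ->
  exists (th : X -> C) (v : H), [/\ multiplier H th, ev v = (fun x => th x * f x) & nm (v - g) < e].
Proof.
split=> [[fH /denseP fd]|[fH fd]]; split=> //.
  by move=> g e e0; have [v [th thm vE] vg] := fd g e e0; exists th, v.
apply/denseP => g e e0; have [th [v [thm vE vg]]] := fd g e e0.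
by exists v => //; exists th.
Qed.

(** Multipliers act boundedly, so approximating [q] by multiples of [f] approximates every multiple
    of [q] as well. *)
Lemma cyclic_of_closure f q (uq : H) : hfs_set H f -> ev uq = q -> cyclic H q ->
  (forall e : R, 0 < e -> exists (th : X -> C) (v : H),
     [/\ multiplier H th, ev v = (fun x => th x * f x) & nm (v - uq) < e]) ->
  cyclic H f.
Proof.
move=> fH uqE /cyclicP[_ qd] fq; apply/cyclicP; split=> // g e e0.
have e2 : 0 < e / 2 by rewrite divr_gt0.
have [th [v [thm vE vg]]] := qd g (e / 2) e2.
have [M M0 MP] := pick_multiplier_bounded thm.
have M1 : 0 < M + 1 by lra.
have [th' [v' [th'm v'E v'g]]] := fq _ (divr_gt0 e2 M1).
have [v2 _ v2E] : hfs_set H (fun x => th x * ev v' x) by apply: thm; exists v'.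
exists (fun x => th x * th' x), v2; split; first exact: mult_mul.
  by rewrite v2E v'E; apply/funext => x; rewrite mulrA.
have h : nm (v2 - v) <= M * nm (v' - uq).
  by apply: MP; apply/funext => x; rewrite !evB v2E vE uqE mulrBr.
have -> : v2 - g = (v2 - v) + (v - g) by rewrite addrA subrK.
apply: (le_lt_trans (nmD _ _)).
move: v'g; rewrite ltr_pdivlMr // => v'g; have := nm_ge0 (v' - uq); lra.
Qed.

Hypothesis H1 : hfs_set H (fun=> 1).

Lemma mult_mem phi : multiplier H phi -> hfs_set H phi.
Proof. by move=> pm; have := pm _ H1; under eq_fun do rewrite mulr1. Qed.

(* [1] is approximated by multiples of [f], so [q] is by multiples of [q f]. *)
Lemma cyclic_mul q f : multiplier H q -> cyclic H q -> cyclic H f ->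
  cyclic H (fun x => q x * f x).
Proof.
move=> qm qc fc; have [uq _ uqE] := mult_mem qm.
have [u1 _ u1E] := H1; have /cyclicP[fH fd] := fc.
apply: (cyclic_of_closure _ uqE qc); first exact: qm.
move=> e e0; have [M M0 MP] := pick_multiplier_bounded qm.
have M1 : 0 < M + 1 by lra.
have [th [v [thm vE vg]]] := fd u1 _ (divr_gt0 e0 M1).
have [v2 _ v2E] : hfs_set H (fun x => q x * ev v x) by apply: qm; exists v.
exists th, v2; split=> //; first by rewrite v2E vE; apply/funext => x; rewrite mulrCA.
have h : nm (v2 - uq) <= M * nm (v - u1).
  by apply: MP; apply/funext => x; rewrite !evB v2E uqE u1E mulrBr mulr1.
apply: (le_lt_trans h).
move: vg; rewrite ltr_pdivlMr // => vg; have := nm_ge0 (v - u1); lra.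
Qed.

Lemma cyclic_pow q n : multiplier H q -> cyclic H q -> cyclic H (fun x => q x ^+ n.+1).
Proof.
move=> qm qc; elim: n => [|n IH]; first by under eq_fun do rewrite expr1.
by have := cyclic_mul qm qc IH; under eq_fun do rewrite -exprS.
Qed.

(** If [q x = 0] then all multiples of [q] vanish at [x], and by continuity of the evaluation they
    stay away from the function 1. *)
Lemma cyclic_neq0 q x : cyclic H q -> q x != 0.
Proof.
move=> /cyclicP[_ qd]; apply/eqP => qx0.
have [c cP] := pick_eval_le x; have [u1 _ u1E] := H1.
have c0 : 0 < `|c| + 1 by rewrite ltr_wpDl.
have c1 : 0 < (`|c| + 1)^-1 by rewrite invr_gt0.
have [th [v [_ vE]]] := qd u1 _ c1.
rewrite -[_^-1]mul1r ltr_pdivlMr // => h.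
have := cP (v - u1); rewrite evB vE u1E qx0 mulr0 sub0r cabsN cabs1.
have h1 := ler_norm c; have h2 := nm_ge0 (v - u1).
have := ler_wpM2r h2 h1; lra.
Qed.

End CompletePickSpaces.

(** * Comparison of branches of the logarithm *)

Section LogBranches.
Variables (R : realType) (d : nat).
Local Notation C := (Cplx R).
Local Notation B := (unit_ball R d).

(** Along each radius [cexp] of [D] is constant, so by the chain rule the derivative of [D] is 0
    there. *)
Let cexp1_cst (D : B -> C) : hol R d D -> (forall x, cexp (D x) = 1) ->
  forall x, D x = extend0 D 0.
Proof.
move=> hD D1 x.
pose g (s : C) := extend0 D (0 + s *: val x).
have Bt (t : R) : 0 <= t <= 1 -> B (0 + t%:C *: val x).
  move=> /andP[t0 t1]; rewrite add0r; apply/unit_ballP.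
  apply: le_lt_trans ((unit_ballP _).1 (val_ball x)); apply: ler_sum => j _.
  rewrite mxE cabsM cabsR (ger0_norm t0); apply: lerXn2r; rewrite ?nnegrE ?mulr_ge0 ?cabs_ge0 //.
  by rewrite ler_piMl // cabs_ge0.
have g0 (t : R) : 0 <= t <= 1 -> cder g t%:C 0.
  move=> t01; have /slice_cder := hD _ (Bt t t01).
  set A := 'D_(val x) _ _; move=> gA; suff <- : A = 0 by [].
  have /cder_comp/(_ (@cexp_cder R (g t%:C))) := gA; set E := cexp _ * A => H.
  suff E0 : E = 0.
    by move/eqP: E0; rewrite mulf_eq0 (negbTE (cexp_neq0 _)) /= => /eqP.
  have [r r0 rP] : exists2 r : R, 0 < r &
      forall s : C, cabs (s - t%:C) < r -> B (0 + s *: val x).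
    have /near_nm[e e0 eP] := near_ball (Bt t t01).
    have n0 : 0 < nm (val x) + 1 by rewrite ltr_wpDl // nm_ge0.
    exists (e / (nm (val x) + 1)); first by rewrite divr_gt0.
    move=> s; rewrite ltr_pdivlMr // => hs; apply: eP.
    rewrite !add0r -scalerBl nmZ; apply: le_lt_trans hs.
    by apply: ler_wpM2l; [exact: cabs_ge0|rewrite lerDl].
  apply/eqP; rewrite -cabs_eq0 eq_le cabs_ge0 andbT; apply/ler_addgt0Pr => e e0.
  have [dl dl0 dlP] := H e e0.
  pose h := Num.min r dl / 2.
  have h0 : 0 < h by rewrite divr_gt0 // lt_min r0.
  have hm : h < Num.min r dl by move: h0; rewrite /h; lra.
  have hr : h < r by apply: (lt_le_trans hm); rewrite ge_min lexx.
  have hdl : h < dl by apply: (lt_le_trans hm); rewrite ge_min lexx orbT.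
  have hE : cabs (t%:C + h%:C - t%:C : C) = h by rewrite addrC addKr cabsR ger0_norm // ltW.
  have one s : B (0 + s *: val x) -> (@cexp R \o g) s = 1.
    by move=> /ball_val[y yE]; rewrite /= /g -yE extend0_val D1.
  have := dlP (t%:C + h%:C); rewrite hE => /(_ hdl).
  rewrite !one; [|exact: Bt|by apply: rP; rewrite hE].
  rewrite subrr sub0r cabsN cabsM hE ler_pM2r // add0r //.
have K0 (t : R) : 0 <= t <= 1 -> cabs (0 : C) <= (0 : R) by rewrite cabs0.
have := @cder_segment _ g (fun=> 0) 0 g0 K0.
rewrite mulr0 => h; have := cabs_ge0 (g 1 - g 0); rewrite le_eqVlt ltNge h orbF eq_sym.
rewrite cabs_eq0 subr_eq0 /g scale1r scale0r !add0r extend0_val.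
by move=> /eqP.
Qed.

(** Two branches differ by a constant, so a bound for one of them gives a bound for all. *)
Lemma log_branch_bounded (f L : B -> C) : bounded_argument f -> log_branch f L ->
  exists M : R, forall x, `|complex.Im (L x)| <= M.
Proof.
move=> [L0 [hL0 L0f] [M M0 LM]] [hL Lf].
have D1 x : cexp (L x - L0 x) = 1 by rewrite cexpD cexpN Lf L0f divff // -L0f cexp_neq0.
have := cexp1_cst (holB hL hL0) D1; set c := extend0 _ 0 => Dc.
exists (M + `|complex.Im c|) => x.
have -> : L x = L0 x + c by rewrite -(Dc x) addrC subrK.
by rewrite ImD; apply: (le_trans (ler_normD _ _)); rewrite lerD2r.
Qed.

End LogBranches.

(** * Cyclicity and the Pick-Smirnov class *)

Section BesovPick.
Variables (R : realType) (d : nat).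
Local Notation C := (Cplx R).
Local Notation Re := (@complex.Re R).
Local Notation Im := (@complex.Im R).
Local Notation B := (unit_ball R d).
Variables (sigma : probability (borelCd R d) R)
  (mu : {finite_measure set R -> \bar R})
  (omega : {measure set (borelCd R d) -> \bar R}) (N : nat).
Variable H : hilbertFunctionSpace R B.
Hypotheses (adm : admissible_radial sigma mu omega)
  (setE : hfs_set H = besov sigma mu omega N)
  (normE : forall u : H, (Re (`|u| ^+ 2))%:E = besov_normsq sigma mu omega N (hfs_fun u))
  (H_pick : complete_pick H).
Local Notation ev := (@hfs_fun R B H).
Local Notation inB := (inB sigma mu omega N).
Local Notation bmult := (bmult sigma mu omega N).
Local Notation m := (expo N).

Let memE u : hfs_set H u <-> inB u.
Proof. by rewrite setE; exact: besovP. Qed.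

Let H1 : hfs_set H (fun=> 1).
Proof. by apply/memE; exact: inB_cst. Qed.

Let mult_bmult q : multiplier H q -> bmult q.
Proof.
move=> qm; split; first by have /memE[] := mult_mem H1 qm.
  exact: (pick_multiplier_le H_pick qm).
by move=> h /memE hH; apply/memE; exact: qm.
Qed.

Let measurable_closed_ball : measurable (closed_unit_ball R d : set (borelCd R d)).
Proof.
have -> : closed_unit_ball R d = B `|` unit_sphere R d.
  apply/seteqP; split=> z; rewrite /closed_unit_ball /unit_ball /unit_sphere /=.
    by rewrite le_eqVlt => /orP[/eqP|]; [right|left].
  by case=> [/ltW//|->].
by apply: measurableU; [exact: measurable_unit_ball|exact: measurable_unit_sphere].
Qed.

Let B0 : B 0.
Proof. by apply/unit_ballP; rewrite big1 // => j _; rewrite mxE cabs0 expr0n. Qed.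

(** For [N > 0] the value at the origin is part of the norm; for [N = 0] its presence only weakens
    the bound, so both cases share one statement. *)
Let nm_le : exists2 W : R, 0 <= W & forall (u : H) (E : R),
  (En sigma mu omega (iter N (@Rd R d) (ev u)) <= E%:E)%E ->
  nm u ^+ 2 <= W * cabs (extend0 (ev u) 0) ^+ 2 + E.
Proof.
have o0 : (0 <= omega (closed_unit_ball R d))%E by exact: measure_ge0.
pose W := fine (omega (closed_unit_ball R d)).
have W0 : 0 <= W by rewrite fine_ge0.
have WE : omega (closed_unit_ball R d) = W%:E.
  by rewrite fineK // ge0_fin_numE // (omega_fin adm measurable_closed_ball).
exists W => // u E uE; rewrite -lee_fin.
have -> : (nm u ^+ 2)%:E = besov_normsq sigma mu omega N (ev u).
  by rewrite -normE nmE -rmorphXn.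
rewrite /besov_normsq L2_normsq_extend0 EFinD; apply: leeD => //.
case: eqP => _; last by rewrite WE -EFinM.
by rewrite lee_fin mulr_ge0 // exprn_ge0 // cabs_ge0.
Qed.

Section Quotient.
Variables (p q : B -> C).
Hypotheses (pm : multiplier H p) (qm : multiplier H q) (qc : cyclic H q).

Let q0 x : q x != 0.
Proof. exact: (cyclic_neq0 H_pick H1). Qed.

Let K x := p x / q x.
Let qK x : q x * K x = p x.
Proof. by rewrite mulrC divfK. Qed.

Lemma hol_quotient : hol R d K.
Proof.
have [hp _ _] := mult_bmult pm; have [hq _ _] := mult_bmult qm.
by apply: holM => //; exact: hol_inv.
Qed.
Let hK := hol_quotient.

Lemma quotient_exp_mult (S : {poly C}) (E : R) : (size S <= 3)%N ->
  (forall x, cabs (cexp S.[K x]) <= E) -> multiplier H (fun x => q x ^+ m * cexp S.[K x]).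
Proof.
move=> S3 SE h /memE hB; apply/memE.
exact: (mult_exp (mult_bmult pm) (mult_bmult qm) hK qK S3 SE hB).
Qed.

Lemma quotient_log_mult : (forall x, 0 <= Re (K x)) ->
  multiplier H (fun x => q x ^+ m * clog (1 + K x)).
Proof.
move=> K0 h /memE hB; apply/memE.
exact: (mult_log (mult_bmult pm) (mult_bmult qm) hK qK K0 hB).
Qed.

Variable M : R.
Hypothesis KM : forall x, `|Im (K x)| <= M.

(** With [K = x + i y] the real part of the exponent is [a x - dl^2 x^2 + dl^2 y^2]; completing the
    square bounds it, as [|y| <= M]. Both [a = 0] and [a = 1] are used. *)
Lemma gauss_mult (a dl : R) : 0 < dl ->
  multiplier H (fun x => q x ^+ m * cexp (a%:C * K x - (dl%:C * K x) ^+ 2)).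
Proof.
move=> dl0; pose S : {poly C} := a%:C *: 'X - (dl%:C ^+ 2) *: 'X^2.
have SE x : S.[K x] = a%:C * K x - (dl%:C * K x) ^+ 2.
  by move: (K x) => y; rewrite /S hornerD hornerN !hornerZ hornerX hornerXn exprMn.
under eq_fun do rewrite -SE.
apply: (@quotient_exp_mult _ (expR (dl ^- 2 * a ^+ 2 + dl ^+ 2 * M ^+ 2))).
  rewrite /S (leq_trans (size_polyD _ _)) // geq_max size_polyN.
  by rewrite !(leq_trans (size_scale_leq _ _)) // ?size_polyX ?size_polyXn.
move=> x; rewrite cabs_cexp ler_expR SE; move: (KM x); move: (K x) => y yM.
rewrite ReD ReN expr2 [Re (_ * _ * _)]ReM.
have -> : Re (a%:C * y) = a * Re y by rewrite ReM /= mul0r subr0.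
have -> : Re (dl%:C * y) = dl * Re y by rewrite ReM /= mul0r subr0.
have -> : Im (dl%:C * y) = dl * Im y by rewrite ImM /= mul0r addr0.
have iM : Im y ^+ 2 <= M ^+ 2.
  rewrite -[leLHS]real_normK ?num_real //; apply: lerXn2r; rewrite ?nnegrE //.
  exact: le_trans yM.
have := ler_wpM2l (sqr_ge0 dl) iM.
have : 0 <= (dl^-1 * a - dl * Re y) ^+ 2 by exact: sqr_ge0.
have -> : (dl^-1 * a - dl * Re y) ^+ 2 =
    dl ^- 2 * a ^+ 2 - 2 * (a * Re y) + dl ^+ 2 * Re y ^+ 2.
  by rewrite -exprVn; field; lra.
have : 0 <= dl ^- 2 * a ^+ 2 by rewrite mulr_ge0 ?invr_ge0 ?sqr_ge0.
have : 0 <= dl ^+ 2 * Re y ^+ 2 by rewrite mulr_ge0 ?sqr_ge0.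
have -> : dl * Re y * (dl * Re y) = dl ^+ 2 * Re y ^+ 2 by ring.
have -> : dl * Im y * (dl * Im y) = dl ^+ 2 * Im y ^+ 2 by ring.
lra.
Qed.

Lemma gauss_approx (u : H) (e : R) : 0 < e -> ev u = (fun x => q x ^+ m) ->
  exists2 dl : R, 0 < dl & forall v : H,
    ev v = (fun x => q x ^+ m * cexp (- (dl%:C * K x) ^+ 2)) -> nm (v - u) < e.
Proof.
move=> e0 uE.
have [K0 K00 HK] := gauss_cvg adm (mult_bmult pm) (mult_bmult qm) hK qK KM.
have [W W0 HW] := nm_le.
have [x0 x0E] := ball_val B0.
set c := cabs (q x0 ^+ m) * (2 * (cabs (K x0) ^+ 2 * expR (M ^+ 2))).
have c0 : 0 <= c by rewrite /c !mulr_ge0 ?exprn_ge0 ?cabs_ge0 ?expR_ge0.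
(* The squared error is at most [(W c^2 + K0) dl^2]: the first part comes from the value at the
   origin, the second from [gauss_cvg]. As [T >= 1], this is at most [(T dl)^2]. *)
set T := W * c ^+ 2 + K0 + 1.
have T0 : 0 < T by rewrite ltr_wpDl // addr_ge0 // mulr_ge0 // sqr_ge0.
pose dl : R := Num.min 1 (e / (2 * T)).
have eT : 0 < e / (2 * T) by rewrite divr_gt0 // mulr_gt0.
have dl0 : 0 < dl by rewrite lt_min ltr01.
have dl1 : dl <= 1 by rewrite ge_min lexx.
have dlT : dl * T < e.
  apply: (@le_lt_trans _ _ (e / (2 * T) * T)).
    by apply: ler_wpM2r; [exact: ltW|rewrite ge_min lexx orbT].
  have -> : e / (2 * T) * T = e / 2 by field; lra.
  lra.
exists dl => // v vE.
have dE : ev (v - u) = (fun x => q x ^+ m * (cexp (- (dl%:C * K x) ^+ 2) - 1)).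
  by apply/funext => x; rewrite evB vE uE mulrBr mulr1.
have dl01 : 0 < dl <= 1 by rewrite dl0.
have := HW (v - u) (K0 * dl ^+ 2); rewrite dE => /(_ (HK dl dl01)).
have dlT2 : dl ^+ 2 * T ^+ 2 < e ^+ 2.
  by rewrite -exprMn ltr_pXn2r ?nnegrE ?ltW // mulr_gt0.
have c1 : cabs (extend0 (fun x => q x ^+ m * (cexp (- (dl%:C * K x) ^+ 2) - 1)) 0) <= c * dl.
  rewrite -x0E extend0_val cabsM /c -mulrA; apply: ler_wpM2l; first exact: cabs_ge0.
  have E1 : 1 <= expR (M ^+ 2) by rewrite -expR0 ler_expR sqr_ge0.
  have rE : expR (Re (- (dl%:C * K x0) ^+ 2)) <= expR (M ^+ 2).
    move: (KM x0); move: (K x0) => y yM; rewrite ler_expR ReN expr2 ReM.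
    have -> : Re (dl%:C * y) = dl * Re y by rewrite ReM /= mul0r subr0.
    have -> : Im (dl%:C * y) = dl * Im y by rewrite ImM /= mul0r addr0.
    have iM : (dl * Im y) ^+ 2 <= M ^+ 2.
      rewrite -[leLHS]real_normK ?num_real //; apply: lerXn2r; rewrite ?nnegrE //.
        exact: le_trans yM.
      rewrite normrM (gtr0_norm dl0); apply: le_trans yM.
      by rewrite ler_piMl.
    have := sqr_ge0 (dl * Re y); move: iM; rewrite !expr2; lra.
  apply: (le_trans (cexp_sub1 E1 rE)); move: (K x0) => y.
  rewrite cabsN cabsX cabsM cabsR (gtr0_norm dl0).
  have h : (dl * cabs y) ^+ 2 <= cabs y ^+ 2 * dl.
    rewrite exprMn mulrC; apply: ler_wpM2l; first by rewrite exprn_ge0 // cabs_ge0.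
    by rewrite expr2 ler_piMl // ltW.
  have := ler_wpM2r (expR_ge0 (M ^+ 2)) h; lra.
have c2 : cabs (extend0 (fun x => q x ^+ m * (cexp (- (dl%:C * K x) ^+ 2) - 1)) 0) ^+ 2
     <= c ^+ 2 * dl ^+ 2.
  rewrite -exprMn; apply: lerXn2r; rewrite ?nnegrE ?cabs_ge0 //.
  by apply: mulr_ge0 => //; exact: ltW.
move=> h1; rewrite -(@ltr_pXn2r _ 2) ?nnegrE ?nm_ge0 ?(ltW e0) //.
apply: (le_lt_trans h1); apply: le_lt_trans dlT2.
have := ler_wpM2l W0 c2.
have TT : W * c ^+ 2 + K0 <= T ^+ 2.
  have T1 : 1 <= T by rewrite /T lerDr addr_ge0 // mulr_ge0 // sqr_ge0.
  apply: (@le_trans _ _ T); first by rewrite /T lerDl.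
  by rewrite expr2 ler_peMr // ltW.
have := ler_wpM2l (sqr_ge0 dl) TT; lra.
Qed.

(** The factor [w] serves two uses: [w = 1] for [f = e^(- K)] in the space, and [w = q^m] where
    [e^(- K)] has to be multiplied by [q^m] first. *)
Lemma cyclic_exp (w f : B -> C) : multiplier H w -> cyclic H (fun x => w x * q x ^+ m) ->
  hfs_set H f -> (forall x, f x = w x * cexp (- K x)) -> cyclic H f.
Proof.
move=> wm wc fH fE.
have qmm := mult_pow m qm; have [uq _ uqE] := mult_mem H1 qmm.
have [uw _ uwE] := mult_mem H1 (mult_mul wm qmm).
apply: (cyclic_of_closure H_pick fH uwE wc) => e e0.
have [A A0 AP] := pick_multiplier_bounded H_pick wm.
have A1 : 0 < A + 1 by lra.
have [dl dl0 dlP] := gauss_approx (divr_gt0 e0 A1) uqE.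
have [vq _ vqE] := mult_mem H1 (gauss_mult 0 dl0).
have tm := gauss_mult 1 dl0; have [v _ vE] := tm _ fH.
eexists _, v; split; [exact: tm|exact: vE|].
have h1 : nm (vq - uq) < e / (A + 1).
  by apply: dlP; rewrite vqE; apply/funext => x; rewrite mul0r sub0r.
have h2 : nm (v - uw) <= A * nm (vq - uq).
  apply: AP; apply/funext => x; rewrite !evB vE uwE vqE uqE fE mul0r sub0r mul1r.
  rewrite cexpD.
  have E : cexp (K x) * cexp (- K x) = 1 by rewrite cexpN divff // cexp_neq0.
  have F (y1 y2 y3 y4 y5 : C) : y1 * y2 = 1 ->
      y4 * (y1 * y3) * (y5 * y2) - y5 * y4 = y5 * (y4 * y3 - y4).
    move=> y12; have -> : y4 * (y1 * y3) * (y5 * y2) = y4 * y3 * y5 * (y1 * y2) by ring.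
    by rewrite y12; ring.
  exact: F E.
apply: (le_lt_trans h2); move: h1; rewrite ltr_pdivlMr // => h1.
have := nm_ge0 (vq - uq); lra.
Qed.

End Quotient.

Let mE : m = (3 * N + 2).+1.
Proof. by rewrite /expo addnS. Qed.

Let cyclic_m q : multiplier H q -> cyclic H q -> cyclic H (fun x => q x ^+ m).
Proof. by move=> qm qc; rewrite mE; exact: (cyclic_pow H_pick H1). Qed.

Lemma cyclic_of_smirnov K (M : R) f : pick_smirnov H K -> (forall x, `|Im (K x)| <= M) ->
  hfs_set H f -> (forall x, f x = cexp (- K x)) -> cyclic H f.
Proof.
move=> [p [q [pm qm qc ->]]] KM fH fE.
apply: (cyclic_exp pm qm qc KM (mult_cst 1)) => //; last by move=> x; rewrite mul1r.
by under eq_fun do rewrite mul1r; exact: cyclic_m.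
Qed.

Lemma smirnov_of_cyclic L (M : R) f : hol R d L -> (forall x, `|Im (L x)| <= M) ->
  (forall x, f x = cexp (L x)) -> cyclic H f -> pick_smirnov H L.
Proof.
move=> hL LM fE fc; have [fH _] := fc.
have [phi [q [pm qm qc q0 pE]]] := pick_space_factor H_pick fH.
have phic : cyclic H phi.
  have -> : phi = (fun x => q x * f x) by apply/funext => x; rewrite pE mulrC.
  exact: (cyclic_mul H_pick H1).
have pqm := mult_mul pm qm; have pqc := cyclic_mul H_pick H1 pm phic qc.
exists (fun x => (phi x * q x) ^+ m * L x), (fun x => (phi x * q x) ^+ m).
split; [| exact: mult_pow | exact: cyclic_m |].
  move=> h /memE hB; apply/memE.
  apply: (mult_log_quotient (mult_bmult pm) (mult_bmult qm) hL _ LM hB) => x.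
  by rewrite pE fE mulrC.
apply/funext => x; rewrite [RHS]mulrC mulKf // expf_neq0 // mulf_neq0 //.
exact: (cyclic_neq0 H_pick H1).
Qed.

Lemma smirnov_opp K : pick_smirnov H K -> pick_smirnov H (fun x => - K x).
Proof.
move=> [p [q [pm qm qc ->]]]; exists (fun x => -1 * p x), q; split=> //.
  exact: (mult_mul (mult_cst _) pm).
by apply/funext => x; rewrite mulN1r mulNr.
Qed.

Lemma smirnov_log K : (forall x, 0 <= Re (K x)) -> pick_smirnov H K ->
  pick_smirnov H (fun x => clog (1 + K x)).
Proof.
move=> K0 [p [q [pm qm qc KE]]]; rewrite {}KE in K0 *.
exists (fun x => q x ^+ m * clog (1 + p x / q x)), (fun x => q x ^+ m).
split; [exact: quotient_log_mult | exact: mult_pow | exact: cyclic_m |].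
apply/funext => x; rewrite [RHS]mulrC mulKf // expf_neq0 //.
exact: (cyclic_neq0 H_pick H1).
Qed.

Let Re_1K (z : C) : 0 <= Re z -> 1 <= Re (1 + z).
Proof. by move=> z0; rewrite ReD /= lerDl. Qed.

(** [Im K] may be unbounded, but [log (1 + K) = p / q] has imaginary part at most [pi / 2] in
    modulus, so [cyclic_exp] applies to [p / q]. Since [|1 + K| >= 1], [u = q^m / (1 + K)] is a
    multiplier, and [K = (q^m - u) / u]. *)
Lemma smirnov_of_log K : (forall x, 0 <= Re (K x)) ->
  pick_smirnov H (fun x => clog (1 + K x)) -> pick_smirnov H K.
Proof.
move=> K0 [p [q [pm qm qc LE]]].
have Lx x : clog (1 + K x) = p x / q x by have := congr1 (fun g => g x) LE.
have R1 x := Re_1K (K0 x).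
have R0 x : 0 < Re (1 + K x) by apply: lt_le_trans (R1 x).
have n1K x : 1 + K x != 0 by apply: contraTneq (R0 x) => ->; rewrite ltxx.
have KM x : `|Im (p x / q x)| <= pi / 2 by rewrite -Lx; exact: Im_clog.
have cE x : cexp (- (p x / q x)) = (1 + K x)^-1 by rewrite -Lx cexpN clogK.
pose u x := q x ^+ m * cexp (- (p x / q x)).
have um : multiplier H u.
  have SE x : (- 'X : {poly C}).[p x / q x] = - (p x / q x) by rewrite hornerN hornerX.
  rewrite /u; under eq_fun do rewrite -SE.
  apply: (@quotient_exp_mult _ _ pm qm qc _ 1).
    by rewrite size_polyN size_polyX.
  move=> x; rewrite SE cE cabsV invf_le1 ?cabs_gt0 //.
  by apply: (le_trans (R1 x)); apply: le_trans (Re_le_cabs _); exact: ler_norm.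
have qmm := mult_pow m qm; have qmc := cyclic_m qm qc.
have uc : cyclic H u.
  apply: (cyclic_exp pm qm qc KM qmm) => //; last exact: mult_mem.
  exact: (cyclic_mul H_pick H1).
exists (fun x => -1 * u x + q x ^+ m), u; split=> //; first exact: mult_lin.
apply/funext => x; rewrite /u cE.
have q0 : q x ^+ m != 0 by rewrite expf_neq0 // (cyclic_neq0 H_pick H1).
move: (n1K x) q0; move: (q x ^+ m) (K x) => y z z0 y0.
by field; rewrite z0 y0.
Qed.

(** The half-plane is preserved because [Re log (1 + z) = ln |1 + z| >= 0]; the index starts at 1,
    where [G] is the identity. *)
Lemma smirnov_G L : (forall x, 0 <= Re (L x)) -> forall n,
  (forall x, 0 <= Re (G n.+1 (L x))) /\ (pick_smirnov H (G n.+1 \o L) <-> pick_smirnov H L).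
Proof.
move=> L0; elim=> [|n [IH0 IH]]; first by split.
have GS : G n.+2 \o L = (fun x => clog (1 + (G n.+1 \o L) x)) by [].
split.
  move=> x; rewrite /= ln_ge0 //; apply: (le_trans (Re_1K (IH0 x))).
  by apply: le_trans (Re_le_cabs _); exact: ler_norm.
rewrite GS; split=> [/(smirnov_of_log IH0)/IH //|/IH]; exact: smirnov_log.
Qed.

End BesovPick.

Theorem theorem1p1 (R : realType) (d : nat) (d_gt0 : (0 < d)%N)
    (H : hilbertFunctionSpace R (unit_ball R d))
    (H_besov : radially_weighted_besov H) (H_pick : complete_pick H)
    (f : unit_ball R d -> Cplx R) (fH : hfs_set H f)
    (f_neq0 : forall z, f z != 0) (f_arg : bounded_argument f) :
  (forall L : unit_ball R d -> Cplx R, log_branch f L ->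
     (pick_smirnov H L <-> cyclic H f))
  /\
  ((sup_norm f <= 1)%E ->
   forall L : unit_ball R d -> Cplx R, log_branch (fun z => (f z)^-1) L ->
     [/\ cyclic H f <->
           (exists n : nat, (0 < n)%N /\ pick_smirnov H (G n \o L)),
         cyclic H f <->
           (forall n : nat, (0 < n)%N -> pick_smirnov H (G n \o L)) &
         (exists n : nat, (0 < n)%N /\ hfs_set H (G n \o L)) ->
           cyclic H f]).
Proof.
have [sigma [mu [omega [N [_ adm setE normE]]]]] := H_besov.
have E_cyclic L : log_branch f L -> pick_smirnov H L <-> cyclic H f.
  move=> fL; have [M LM] := log_branch_bounded f_arg fL; have [hL Lf] := fL.
  split=> [LN|]; last exact: (smirnov_of_cyclic adm setE H_pick hL LM (fun x => esym (Lf x))).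
  (* [cyclic_of_smirnov] is stated for [f = e^(- K)], so it is applied to [K = - L]. *)
  have NM x : `|complex.Im (- L x)| <= M by rewrite ImN normrN.
  apply: (cyclic_of_smirnov adm setE normE H_pick (smirnov_opp LN) NM fH) => x.
  by rewrite opprK Lf.
split=> // f1 L [hL Lf].
(* Part (b) starts from a branch of [log (1 / f)]; its negative is a branch of [log f], to which
   part (a) applies. *)
have NL : log_branch f (fun x => - L x).
  by split; [exact: holN|move=> x; rewrite cexpN Lf invrK].
(* [|f| <= 1] means [e^(Re L) = 1 / |f| >= 1]: the values of [L] lie in the domain of the functions
   [G n]. *)
have L0 x : 0 <= complex.Re (L x).
  have fx : (cabs (f x) <= 1)%R.
    by rewrite -lee_fin; apply: le_trans f1; apply: ereal_sup_ubound; exists x.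
  have : cabs (cexp (L x)) = (cabs (f x))^-1 by rewrite Lf cabsV.
  rewrite cabs_cexp => E; rewrite -ler_expR expR0 E invf_ge1 // cabs_gt0.
  exact: f_neq0.
have L_cyclic : pick_smirnov H L <-> cyclic H f.
  rewrite -(E_cyclic _ NL); split=> [/smirnov_opp //|/smirnov_opp].
  by under eq_fun do rewrite opprK.
have GL n : (0 < n)%N -> pick_smirnov H (G n \o L) <-> cyclic H f.
  by case: n => // n _; rewrite (smirnov_G adm setE normE H_pick L0 n).2.
split.
- by split=> [fc|[n [n0 /(GL n n0)]]//]; exists 1%N; split=> //; apply/GL.
- by split=> [fc n n0|/(_ 1%N isT)/(GL 1%N isT)]; first exact/GL.
- by move=> [n [n0 /(pick_smirnov_mem H_pick)/(GL n n0)]].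
Qed.
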